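(* Let $L$ be a non-degenerate integral lattice of rank $n$ with $\mathbb{Z}$-basis $B=\{\beta_1,\dots,\beta_n\}$, let $R=\{\beta_1,\dots,\beta_r\}$ and $S=\{\beta_{r+1},\dots,\beta_{r+s}\}$ be disjoint subsets of $B$ (with $r=|R|$, $s=|S|$), and let $\lambda=l_1\beta_1+\cdots+l_n\beta_n\in L^\circ$ ($l_i\in\mathbb{Q}$). Put $\mathbf{l}=(l_1,\dots,l_n)$ and let $A=(\langle\beta_i,\beta_j\rangle)_{1\le i,j\le n}$ be the Gram matrix. Then the graded dimension of $W(R,S;\lambda)$ is given by $$\chi_{W(R,S;\lambda)}(\mathbf{x};q)=\sum_{\substack{k_1,\dots,k_r\ge0\\ k_{r+1},\dots,k_{r+s}\in\mathbb{Z}}}\frac{q^{\frac{(\mathbf{k}+\mathbf{l})\cdot A\cdot(\mathbf{k}+\mathbf{l})}{2}}}{(q)_{k_1}\cdots(q)_{k_r}\cdot(q)_\infty^s}\,x_1^{k_1}\cdots x_{r+s}^{k_{r+s}},$$ where $\mathbf{k}=(k_1,\dots,k_{r+s},0,\dots,0)\in\mathbb{Z}^n$ and $\mathbf{v}\cdot A\cdot\mathbf{v}$ denotes the value at $\mathbf{v}$ of the quadratic form of $A$.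
   Context: $L$ has form $\langle\cdot,\cdot\rangle:L\times L\to\mathbb{Z}$ and dual lattice $L^\circ$. $\mathfrak h=\mathbb{C}\otimes_{\mathbb Z}L$; $\widehat{\mathfrak h}=\mathfrak h\otimes\mathbb{C}[t,t^{-1}]\oplus\mathbb{C}\mathbf{k}$ is the affine (Heisenberg) central extension; $M(1)\cong\mathrm{S}(\mathfrak h\otimes t^{-1}\mathbb{C}[t^{-1}])$ is its module induced from the one-dimensional module on which $\mathfrak h\otimes\mathbb{C}[t]$ acts by $0$ and the central element by $1$; $h_j$ is the action of $h\otimes t^j$. $V_L=M(1)\otimes\mathbb{C}[L]$ is the lattice vertex operator (super)algebra, and $V_{L^\circ}=M(1)\otimes\mathbb{C}[L^\circ]$ is a $V_L$-module, with $Y(e^\alpha,x)=\sum_{m\in\mathbb{Z}}(e^\alpha)_mx^{-m-1}=\exp(-\sum_{j<0}\frac{x^{-j}}{j}\alpha_j)\exp(-\sum_{j>0}\frac{x^{-j}}{j}\alpha_j)\,e_\alpha x^\alpha$, where $e_\alpha(h\otimes e^\beta)=\epsilon(\alpha,\beta)h\otimes e^{\alpha+\beta}$, $\epsilon(\alpha,\beta)\in\mathbb{C}^\times$ the standard 2-cocycle, and $x^\alpha(h\otimes e^\beta)=x^{\langle\alpha,\beta\rangle}h\otimes e^\beta$. Write $e^\beta$ for $1\otimes e^\beta$. The intermediate vertex subalgebra $W(R,S)\subset V_L$ is the smallest vertex subalgebra containing $e^\rho$ ($\rho\in R$), $e^{\pm\sigma}$ and $\sigma_{-1}\otimes1$ ($\sigma\in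 S$). For $\lambda\in L^\circ$, $W(R,S;\lambda)=W(R,S)\cdot e^\lambda\subset V_{L^\circ}$ is the cyclic $W(R,S)$-submodule generated by $e^\lambda$. Gradings: the weight grading of $V_{L^\circ}$ is by eigenvalues of $L(0)$ for the standard conformal vector of $V_L$, so that $e^\beta$ has weight $\langle\beta,\beta\rangle/2$ and $h_{-j}$ raises weight by $j$. The charge grading of $W(R,S;\lambda)$ is $(W(R,S;\lambda))^\tau=W(R,S;\lambda)\cap(M(1)\otimes e^{\tau+\lambda})$ for $\tau\in L^\circ$. $(W(R,S;\lambda))^\tau_r$ is the subspace of charge $\tau$ and weight $r$. The graded dimension is the formal sum $$\chi_{W(R,S;\lambda)}(\mathbf{x};q)=\sum_{\tau\in L^\circ,\,r\in\mathbb{Q}}\dim_{\mathbb C}\big((W(R,S;\lambda))^\tau_r\big)\,q^r x_1^{k_1}\cdots x_n^{k_n},\qquad \tau=k_1\beta_1+\cdots+k_n\beta_n.$$ Notation: $(q)_0=1$, $(q)_k=(1-q)(1-q^2)\cdots(1-q^k)$ for $k\ge1$, $(q)_\infty=\prod_{i\ge1}(1-q^i)$. *)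

(* Defs.v *)
From HB Require Import structures.
From mathcomp Require Import all_boot all_order all_algebra.
From mathcomp Require Import finmap.
From mathcomp Require Import mathcomp_extra boolp classical_sets functions.
From mathcomp Require Import cardinality fsbigop reals.
From mathcomp Require Import complex.
From mathcomp Require Import monalg.

Set Implicit Arguments.
Unset Strict Implicit.
Unset Printing Implicit Defensive.

Import Order.TTheory GRing.Theory Num.Theory.
Local Open Scope classical_set_scope.
Local Open Scope ring_scope.

(* An integral lattice of rank n with a Z-basis (beta_1, ..., beta_n), indexed
   from 0; lcoord x is the row of coordinates of x. *)
Record based_lattice (n : nat) := BasedLattice {
  lattice_sort :> zmodType;
  lform : lattice_sort -> lattice_sort -> int;
  lbasis : 'I_n -> lattice_sort;
  lcoord : lattice_sort -> 'rV[int]_n;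
  lformC : forall x y, lform x y = lform y x;
  lformDl : forall x y z, lform (x + y) z = lform x z + lform y z;
  lcoordK : forall x, \sum_i lbasis i *~ lcoord x 0 i = x;
  lbasisK : forall k : 'rV[int]_n, lcoord (\sum_i lbasis i *~ k 0 i) = k
}.

Definition lattice_nondegenerate n (L : based_lattice n) : Prop :=
  forall x : L, (forall y : L, lform x y = 0) -> x = 0.

Section Lattice.
Context (n : nat) (L : based_lattice n).

Definition gram : 'M[int]_n := \matrix_(i, j) lform (lbasis L i) (lbasis L j).

(* The scalar extension F (x) L is F^n, in coordinates on the basis; formF is
   the F-bilinear extension of the form. *)
Definition formF (F : fieldType) (u v : 'rV[F]_n) : F :=
  (u *m map_mx intr gram *m v^T) 0 0.

Definition coordF (F : fieldType) (x : L) : 'rV[F]_n := map_mx intr (lcoord x).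

Definition dual_pred : pred 'rV[rat]_n :=
  [pred l | `[< forall x : L, formF l (coordF rat x) \is a Num.int >]].

Fact dual_pred_zmod : zmod_closed dual_pred.
Proof.
split=> [|u v /asboolP Hu /asboolP Hv]; apply/asboolP => x.
  by rewrite /formF !mul0mx mxE rpred0.
by rewrite /formF !mulmxBl mxE [X in _ + X]mxE rpredB // -/(formF _ _) ?Hu ?Hv.
Qed.

HB.instance Definition _ := GRing.isZmodClosed.Build _ dual_pred dual_pred_zmod.

(* The dual lattice, inside Q (x) L = Q^n. *)
Record dual_lattice := Dual { dual_val : 'rV[rat]_n; _ : dual_pred dual_val }.
HB.instance Definition _ := [isSub for dual_val].
HB.instance Definition _ := [Choice of dual_lattice by <:].
HB.instance Definition _ := [SubChoice_isSubZmodule of dual_lattice by <:].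

Fact coordF_dual (x : L) : dual_pred (coordF rat x).
Proof.
apply/asboolP => y; rewrite /formF /coordF map_trmx -!map_mxM mxE.
by rewrite intr_int.
Qed.

Definition to_dual (x : L) : dual_lattice := Dual (coordF_dual x).

End Lattice.

Section Fock.
Context (K : fieldType) (n : nat) (L : based_lattice n).

(* M(1) is the polynomial algebra on the beta_i (x) t^-(p+1), for i : 'I_n and
   p : nat; such a generator is encoded by the pair (i, p). *)
Definition mode := ('I_n * nat)%type.

(* The pair (m, b) indexes the basis vector m (x) e^b. *)
Definition fock := {malg K[({cmonom mode} * dual_lattice L)%type]}.

Definition fvec (m : {cmonom mode}) (b : dual_lattice L) : fock := << (m, b) >>.

Definition fexp (b : dual_lattice L) : fock := fvec mone b.

Definition fvac : fock := fexp 0.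

Definition linext (f : {cmonom mode} -> dual_lattice L -> fock) (v : fock) : fock :=
  \sum_(x <- msupp v) v@_x *: f x.1 x.2.

Definition dualK (b : dual_lattice L) : 'rV[K]_n := map_mx ratr (val b).

(* The action h_j of h (x) t^j, for h in K (x) L = K^n. As k acts by 1,
   [h_(p+1), h'_(-(p+1))] = (p + 1) <h, h'>. *)
Definition heis (h : 'rV[K]_n) (j : int) : fock -> fock :=
  linext (fun m b =>
    match j with
    | Negz p => \sum_i h 0 i *: fvec (mmul (ucm (i, p)) m) b
    | Posz 0 => formF L h (dualK b) *: fvec m b
    | Posz p.+1 =>
        \sum_i (p.+1%:R * formF L h (delta_mx 0 i) * (m (i, p))%:R)
          *: fvec (divcm m (ucm (i, p))) b
    end).

(* For commuting operators a_j, j >= 1, the coefficient of x^p in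
   (\sum_(j >= 1) a_j x^j)^k and in exp(\sum_(j >= 1) a_j x^j). *)
Fixpoint powcoef (a : nat -> fock -> fock) (k p : nat) (v : fock) : fock :=
  if k is k'.+1 then \sum_(1 <= j < p.+1) a j (powcoef a k' (p - j) v)
  else if p == 0%N then v else 0.

Definition expcoef (a : nat -> fock -> fock) (p : nat) (v : fock) : fock :=
  \sum_(k < p.+1) (k`!%:R)^-1 *: powcoef a k p v.

(* The coefficient of x^p in exp(- \sum_(j < 0) x^(-j) / j * alpha_j). *)
Definition exp_creation (a : dual_lattice L) : nat -> fock -> fock :=
  expcoef (fun j v => j%:R^-1 *: heis (dualK a) (- j%:Z) v).

(* The coefficient of x^(-d) in exp(- \sum_(j > 0) x^(-j) / j * alpha_j). *)
Definition exp_annihilation (a : dual_lattice L) : nat -> fock -> fock :=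
  expcoef (fun j v => - (j%:R^-1 *: heis (dualK a) j%:Z v)).

(* Only the values of eps on L x L° matter: e_a e_b = eps(a, b) e_(a + b) for a, b
   in L, and the last clause is the commutator map of the lattice vertex
   superalgebra, in which e^a has parity <a, a>. *)
Definition standard_cocycle (eps : dual_lattice L -> dual_lattice L -> K) : Prop :=
  let io := @to_dual n L in
  [/\ forall a b, eps a b != 0,
      forall b, eps 0 b = 1,
      forall a : L, eps (io a) 0 = 1,
      forall (a b : L) (c : dual_lattice L),
        eps (io a) (io b) * eps (io a + io b) c
        = eps (io b) c * eps (io a) (io b + c)
    & forall a b : L,
        eps (io a) (io b)
        = (-1) ^ (lform a b + lform a a * lform b b) * eps (io b) (io a)].

Variable eps : dual_lattice L -> dual_lattice L -> K.

Definition etrans (a : dual_lattice L) : fock -> fock :=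
  linext (fun m b => eps a b *: fvec m (a + b)).

(* The mode (e^a)_k: the coefficient of x^(-k-1) in Y(e^a, x), where a pair
   (p, d) stands for x^p in the first exponential and x^(-d) in the second one.
   The sums over infinite sets here and below have finite support. *)
Definition exp_mode (a : dual_lattice L) (k : int) : fock -> fock :=
  linext (fun m b =>
    \sum_(pd \in [set pd : nat * nat |
        (pd.1)%:R - (pd.2)%:R + formF L (val a) (val b) = - k%:~R - 1])
      exp_creation a pd.1
        (exp_annihilation a pd.2 (etrans a (fvec m b)))).

(* The k-th mode of Y(u, x) for u = h_1(-p_1-1) ... h_l(-p_l-1) (x) e^a, where
   h_1, ..., h_l are basis vectors and s lists the (h_i, p_i). It is the normal
   ordered product given by
     Y(h_(-p-1) u, x) = : (d/dx)^p / p! h(x) Y(u, x) :,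
   with h(x) = \sum_j h_j x^(-j-1) and the h_j, j < 0, placed on the left. *)
Fixpoint mon_mode (s : seq mode) (a : dual_lattice L) (k : int) (v : fock) : fock :=
  if s is (i, p) :: s' then
    let h := delta_mx 0 i : 'rV[K]_n in
    \sum_(d \in [set: nat]) ('C(p + d, p))%:R *:
        heis h (- (p + d).+1%:Z) (mon_mode s' a (k + d%:Z) v)
    + \sum_(d \in [set: nat]) ((-1) ^+ p * ('C(p + d, p))%:R) *:
        mon_mode s' a (k - (p + d).+1%:Z) (heis h d%:Z v)
  else exp_mode a k v.

Definition factors (m : {cmonom mode}) : seq mode :=
  flatten [seq nseq (m x) x | x <- finsupp m].

(* u_k v, where Y(u, x) = \sum_k u_k x^(-k-1). It is meant for u in V_L; for
   other u only the integral powers of x are taken into account. *)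
Definition vprod (u : fock) (k : int) (v : fock) : fock :=
  linext (fun m a => mon_mode (factors m) a k v) u.

Definition is_subspace (U : set fock) : Prop :=
  U 0 /\ forall (c : K) (u v : fock), U u -> U v -> U (c *: u + v).

(* V_L = M(1) (x) C[L], inside V_{L°}. *)
Definition VL : set fock :=
  [set v | forall x, x \in msupp v -> exists y : L, x.2 = to_dual y].

Definition is_vertex_subalgebra (U : set fock) : Prop :=
  [/\ is_subspace U, U `<=` VL, U fvac
    & forall u v k, U u -> U v -> U (vprod u k v)].

Definition is_submodule (W M : set fock) : Prop :=
  is_subspace M /\ forall w v k, W w -> M v -> M (vprod w k v).

Definition Wgenerators (R S : set L) : set fock :=
  [set fexp (to_dual x) | x in R]
  `|` [set fexp (to_dual x) | x in S]
  `|` [set fexp (to_dual (- x)) | x in S]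
  `|` [set heis (coordF K x) (-1) fvac | x in S].

Definition Walg (R S : set L) : set fock :=
  smallest is_vertex_subalgebra (Wgenerators R S).

Definition Wmod (R S : set L) (l : dual_lattice L) : set fock :=
  smallest (is_submodule (Walg R S)) [set fexp l].

(* The standard conformal vector 1/2 \sum_i h^i_(-1) h_i_(-1) 1 for dual bases
   (h_i) and (h^i), here those given by the basis of L. *)
Definition conformal : fock :=
  2^-1 *: \sum_i \sum_j (invmx (map_mx intr (gram L)) i j : K) *:
    heis (delta_mx 0 i) (-1) (heis (delta_mx 0 j) (-1) fvac).

(* L(0), as Y(conformal, x) = \sum_k L(k) x^(-k-2) *)
Definition L0 (v : fock) : fock := vprod conformal 1 v.

Definition weight_space (r : rat) : set fock := [set v | L0 v = ratr r *: v].

(* M(1) (x) e^b *)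
Definition charge_space (b : dual_lattice L) : set fock :=
  [set v | forall x, x \in msupp v -> x.2 = b].

Definition has_dim (U : set fock) (d : nat) : Prop :=
  exists b : 'I_d -> fock,
    (forall c : 'I_d -> K, \sum_i c i *: b i = 0 -> forall i, c i = 0) /\
    (forall v, U v <-> exists c : 'I_d -> K, v = \sum_i c i *: b i).

End Fock.

(* Formal power series in q. *)
Definition fps := nat -> int.

Definition fps_one : fps := fun m => (m == 0%N)%:R.

Definition fps_mul (f g : fps) : fps :=
  fun m => \sum_(i < m.+1) f i * g (m - i)%N.

(* 1 / f = \sum_j (1 - f)^j, for f with constant coefficient 1 *)
Definition fps_inv (f : fps) : fps :=
  fun m => (\sum_(j < m.+1) (1 - \poly_(i < m.+1) f i) ^+ j)`_m.

Definition qpoch (k : nat) : fps :=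
  fun m => (\prod_(1 <= i < k.+1) (1 - 'X^i) : {poly int})`_m.

(* (q)_oo: the factors 1 - q^i with i > m do not affect the coefficient of q^m *)
Definition qpoch_inf : fps := fun m => qpoch m m.

(* Formal sums of monomials q^e x_1^(k_1) ... x_n^(k_n) with rational
   exponents: chi k e is the coefficient of that monomial. *)
Definition formal_sum (n : nat) := 'rV[rat]_n -> rat -> int.

(* The coefficient of q^e in q^c f(q). *)
Definition qshift (c : rat) (f : fps) (e : rat) : int :=
  \sum_(m \in [set m : nat | c + m%:R = e]) f m.

(* chi is the graded dimension of W, with respect to the weight and to the
   charge, shifted by l; in particular all the dimensions are finite. *)
Definition is_graded_dim (K : fieldType) n (L : based_lattice n)
    (eps : dual_lattice L -> dual_lattice L -> K) (W : set (fock K L))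
    (l : dual_lattice L)
    (chi : formal_sum n) : Prop :=
  (forall (t : dual_lattice L) (e : rat), exists d : nat,
      has_dim (W `&` charge_space (t + l) `&` weight_space eps e) d /\
      chi (val t) e = d%:Z) /\
  (forall (k : 'rV[rat]_n) (e : rat), ~~ dual_pred L k -> chi k e = 0).

(* (q)_(k_1) ... (q)_(k_r) (q)_oo^s *)
Definition char_denominator n (r s : nat) (k : 'rV[int]_n) : fps :=
  fps_mul (\big[fps_mul/fps_one]_(i < n | (i < r)%N) qpoch (absz (k 0 i)))
          (iter s (fps_mul qpoch_inf) fps_one).

Definition char_sum n (L : based_lattice n) (r s : nat) (l : 'rV[rat]_n) :
    formal_sum n :=
  fun x e =>
    \sum_(k \in [set k : 'rV[int]_n |
        (forall i : 'I_n, (i < r)%N -> 0 <= k 0 i) /\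
        (forall i : 'I_n, (r + s <= i)%N -> k 0 i = 0)])
      (if x == map_mx intr k then
         let kl := map_mx intr k + l in
         qshift (formF L kl kl / 2) (fps_inv (char_denominator r s k)) e
       else 0).

(* Main.v *)
(* Let G_i(y) be the substitution beta_i(-j) |-> beta_i(-j) - y^j on M(1). For
   y = 1/x it is the annihilation part of the vertex operator attached to the dual
   basis vector beta^i, and with the zero mode of beta^i included it satisfies
     G_i(x) Y(u, z) = Y(G_i(x - z) u, z) G_i(x).
   Hence the P (x) e^(k+l) such that G_i(y) P has degree at most k_i in y for all
   beta_i not in S (where k_i >= 0, and k_i = 0 if beta_i is not in R either) span
   a space stable under the vertex operators of its own l = 0 case; it contains
   W(R,S;l). Conversely, if U_k is the space of these P, then U_(k + e_i) is the
   sum of the h_p(beta_i) U_k, where h_p(beta_i) is the complete symmetric function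
   in the power sums beta_i(-j). As Y(e^(beta_i), x) is, up to a power of x, the
   product of \sum_p h_p(beta_i) x^p and of an operator unitriangular for the weight,
   the modes of the e^(beta_i), with the Heisenberg operators of S, yield all of
   U_k (x) e^(k+l).
     Taking the coefficient of y^(k_i) maps the weight N part of U_k onto its weight
   N - k_i part, with kernel U_(k - e_i). So the graded dimension of U_k, multiplied
   by 1 - q^(k_i), is that of U_(k - e_i), whence the product of the 1 / (q)_(k_i).
   In weight N, a direction in S may be given any bound k_i >= N. *)

Require Import Defs.
From HB Require Import structures.
From mathcomp Require Import all_boot all_order all_algebra.
From mathcomp Require Import finmap.
From mathcomp Require Import boolp classical_sets functions.
From mathcomp Require Import fsbigop reals complex.
From mathcomp Require Import monalg.
From mathcomp Require Import zify ring.

Set Implicit Arguments.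
Unset Strict Implicit.
Unset Printing Implicit Defensive.

Import Order.TTheory GRing.Theory Num.Theory.
Local Open Scope classical_set_scope.
Local Open Scope ring_scope.

(** * Polynomials in the creation operators *)

(** The modes are sums over infinite sets whose supports depend on the vector, so that even
    linearity of u_k v in v is not formal. They are replaced by operators [tmode] and [pmode] on
    M(1) whose sums stop at an index N. The comparison holds for all large N, and identities are
    proved at fixed N. No associativity or Jacobi identity is invoked: the upper bound is closed
    under products by the relation between G_i and Y alone, checked on coefficients. With y = 1/x
    and u of charge k_i in direction i, this relation contains (x - z)^(k_i - d) = x^(k_i - d) (1 -
    z y)^(k_i - d), where d is the degree in the translation of u. As d <= k_i, this is a polynomial
    in y, so the degrees add up to at most the sum of the bounds for u and v. Nonnegative charges
    outside S are essential here. Exponentials are handled through the Newton recursion p u_p =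
    \sum_j a_j u_(p-j): it determines the creation and annihilation exponentials, the translations
    and the complete symmetric functions, as p is invertible in characteristic 0. *)

Section LinearExtension.
Context (K : fieldType) (T : choiceType).
Implicit Types (u v : {malg K[T]}).

Lemma malg_span u : u = \sum_(x <- msupp u) u@_x *: << x >>.
Proof.
rewrite {1}[u]monalgE; apply: eq_bigr => x _; apply/malgP => y.
by rewrite mcoeffZ !mcoeffU mulrnAr mulr1.
Qed.

Lemma malg_ind (Q : {malg K[T]} -> Prop) :
  Q 0 -> (forall c u v, Q u -> Q v -> Q (c *: u + v)) ->
  (forall x, Q << x >>) -> forall u, Q u.
Proof.
move=> Q0 Ql Qx u; rewrite [u]malg_span.
by elim/big_rec: _ => // x v _ Qv; apply: Ql.
Qed.

(** [linext] is convertible to an instance of this map, whose linearity is thus proved once; the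
    arbitrary target also gives the operators on M(1) and the projections to charge components. *)
Definition lext (V : lmodType K) (f : T -> V) u : V :=
  \sum_(x <- msupp u) u@_x *: f x.

Context (V : lmodType K).
Implicit Types (f : T -> V).

Lemma lextEw f (d : {fset T}) u : (msupp u `<=` d)%fset ->
  lext f u = \sum_(x <- d) u@_x *: f x.
Proof.
move=> le; rewrite /lext (big_fset_incl _ le) // => x _ /mcoeff_outdom ->.
by rewrite scale0r.
Qed.

Lemma lext_linear f : linear (lext f).
Proof.
move=> c u v; pose d := (msupp u `|` msupp v)%fset.
have lu : (msupp u `<=` d)%fset by apply: fsubsetUl.
have lv : (msupp v `<=` d)%fset by apply: fsubsetUr.
have luv : (msupp (c *: u + v) `<=` d)%fset.
  apply: fsubset_trans (msuppD_le _ _) _; rewrite fsubUset lv andbT.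
  by apply: fsubset_trans (msuppZ_le _ _) lu.
rewrite !(lextEw _ lu, lextEw _ lv, lextEw _ luv) scaler_sumr -big_split /=.
by apply: eq_bigr => x _; rewrite mcoeffD mcoeffZ scalerDl scalerA.
Qed.

HB.instance Definition _ f :=
  GRing.isLinear.Build K {malg K[T]} V _ (lext f) (lext_linear f).

Lemma lextU f x : lext f << x >> = f x.
Proof. by rewrite /lext msuppU oner_eq0 big_seq_fset1 mcoeffUU scale1r. Qed.

End LinearExtension.

(* M(1), as an abstract algebra: with [{malg K[_]}] itself, unification would
   unfold the operations. *)
Record polyalg (K : fieldType) (n : nat) := Polyalg {
  pol :> comAlgType K;
  mono : {cmonom mode n} -> pol;
  pext : forall V : lmodType K, ({cmonom mode n} -> V) -> {linear pol -> V};
  pextU : forall (V : lmodType K) (f : {cmonom mode n} -> V) m,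
    pext f (mono m) = f m;
  mono1 : mono mone = 1;
  monoM : forall m m', mono (mmul m m') = mono m * mono m';
  pol_ind : forall Q : pol -> Prop, Q 0 ->
    (forall c u v, Q u -> Q v -> Q (c *: u + v)) ->
    (forall m, Q (mono m)) -> forall u, Q u;
  polP : forall P Q : pol,
    (forall m, pext (fun m' => (m' == m)%:R : K^o) P
               = pext (fun m' => (m' == m)%:R : K^o) Q) -> P = Q
}.

Lemma polyalg_exists (K : fieldType) (n : nat) : polyalg K n.
Proof.
pose M : comAlgType K := {malg K[{cmonom mode n}]}.
pose mono m : M := << m >>.
pose pext (V : lmodType K) (f : {cmonom mode n} -> V) : {linear M -> V} := lext f.
exists M mono pext => [V f m||m m'|Q Q0 Ql Qm|P Q PQ].
- exact: lextU.
- by [].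
- by rewrite /mono /GRing.mul /= fgmulUU mul1r.
- exact: malg_ind.
apply/malgP => m; have coefE (u : M) : pext K^o (fun m' => (m' == m)%:R) u = u@_m.
  rewrite /pext /= /lext [in RHS](malg_span u) raddf_sum /=.
  by apply: eq_bigr => x _; rewrite mcoeffZ mcoeffU.
by rewrite -!coefE.
Qed.

Section Polynomials.
Context (K : fieldType) (n : nat) (M : polyalg K n).
Local Notation mode := (mode n).
Local Notation mon := {cmonom mode}.
Implicit Types (P Q : M) (m : mon) (x : mode) (d N : nat).

Definition pcoef m P : K^o := pext M (fun m' => (m' == m)%:R : K^o) P.
HB.instance Definition _ m := GRing.Linear.on (pcoef m).

Lemma pcoefU m m' : pcoef m (mono M m') = (m' == m)%:R.
Proof. exact: pextU. Qed.

Lemma pcoef_diag (f : {linear M -> M}) (e : mon -> K) :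
  (forall m, f (mono M m) = e m *: mono M m) ->
  forall P m, pcoef m (f P) = e m * pcoef m P.
Proof.
move=> fE P m; elim/pol_ind: P => [|c u v IHu IHv|y].
- by rewrite !linear0 mulr0.
- by rewrite !linearP /= IHu IHv mulrDr /GRing.scale /= mulrCA.
rewrite fE linearZ /= pcoefU /GRing.scale /=; case: eqP => [->//|_]; by rewrite !mulr0.
Qed.

Definition gen x : M := mono M (ucm x).

Lemma gen_mul x m : gen x * mono M m = mono M (mmul (ucm x) m).
Proof. by rewrite monoM. Qed.

Lemma mon_decomp m : m != mone -> exists x, m = mmul (ucm x) (divcm m (ucm x)).
Proof.
move=> m1; have [x mx] : exists x, m x != 0%N.
  apply: contrapT => /forallNP H; move/negP: m1; apply; apply/cmP => x.
  by rewrite cm1; apply/eqP/negP => /negP/H.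
exists x; apply/eqP/cmP => y; rewrite cmM divcmE ucmE.
by case: eqP => [<-|_]; rewrite ?subn0 // subnKC // lt0n.
Qed.

Lemma mon_ind (Q : mon -> Prop) :
  Q mone -> (forall x m, Q m -> Q (mmul (ucm x) m)) -> forall m, Q m.
Proof.
move=> Q1 QM m; have [d] := ubnP (mdeg m); elim: d m => // d IH m.
have [->//|/mon_decomp[x ->]] := eqVneq m mone.
by rewrite mdegM mdegU add1n ltnS => /IH; apply: QM.
Qed.

(** Most operator identities on M(1) follow by this induction, from the rule by which each operator
    passes multiplication by one generator: [wproj_gen], [pder_gen], [tcoef_gen], [ders_gen],
    [pmode_gen]. *)
Lemma gen_ind (Q : M -> Prop) :
  Q 0 -> (forall c P P', Q P -> Q P' -> Q (c *: P + P')) ->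
  Q 1 -> (forall x P, Q P -> Q (gen x * P)) -> forall P, Q P.
Proof.
move=> Q0 Ql Q1 QM; apply: pol_ind; [exact: Q0|exact: Ql|].
by apply: mon_ind => [|x m Qm]; [rewrite mono1|rewrite -gen_mul; apply: QM].
Qed.

Definition wt m : nat := \sum_(x <- finsupp m) (m x * x.2.+1)%N.

Lemma wtEw m (d : {fset mode}) : (finsupp m `<=` d)%fset ->
  wt m = \sum_(x <- d) (m x * x.2.+1)%N.
Proof.
move=> le; rewrite /wt (big_fset_incl _ le) // => x _.
by rewrite -cmE_eq0 => /eqP ->.
Qed.

Lemma wt1 : wt mone = 0%N.
Proof. by rewrite /wt mdom1 big_seq_fset0. Qed.

Lemma wtM m m' : wt (mmul m m') = (wt m + wt m')%N.
Proof.
rewrite [wt (mmul m m')]/wt mdomD (wtEw (fsubsetUl _ (finsupp m'))).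
rewrite (wtEw (fsubsetUr (finsupp m) _)) -big_split /=.
by apply: eq_bigr => x _; rewrite cmM mulnDl.
Qed.

Lemma wtU x : wt (ucm x) = x.2.+1.
Proof. by rewrite /wt mdomU big_seq_fset1 cmUU mul1n. Qed.

Definition wproj N : M -> M := pext M (fun m => if wt m == N then mono M m else 0).
HB.instance Definition _ N := GRing.Linear.on (wproj N).

(** The coefficient of y^d in y^(p+1) \sum_e f_e y^e; the exponent p + 1 is the weight of a
    generator encoded by (i, p). *)
Definition shift (f : nat -> M) p d : M := if (p < d)%N then f (d - p.+1)%N else 0.

Lemma wprojU N m : wproj N (mono M m) = if wt m == N then mono M m else 0.
Proof. exact: pextU. Qed.

Lemma wproj1 N : wproj N 1 = if N is 0 then 1 else 0.
Proof. by rewrite -mono1 wprojU wt1; case: N. Qed.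

Lemma wproj_gen N x P : wproj N (gen x * P) = gen x * shift (wproj^~ P) x.2 N.
Proof.
rewrite /shift; elim/pol_ind: P => [|c P P' IH IH'|m].
- by rewrite mulr0 linear0; case: ifP; rewrite ?linear0 mulr0.
- rewrite mulrDr -scalerAr linearP /= IH IH'; case: ifP => _.
    by rewrite linearP /= mulrDr -scalerAr.
  by rewrite !mulr0 scaler0 addr0.
rewrite gen_mul !wprojU wtM wtU; case: ltnP => xN.
  rewrite (_ : (_ == N) = (wt m == N - x.2.+1)%N); last by lia.
  by case: ifP; rewrite ?mulr0 ?gen_mul.
by rewrite ifF ?mulr0 //; apply/negbTE; lia.
Qed.

Lemma wproj_id N N' P : wproj N (wproj N' P) = if N == N' then wproj N' P else 0.
Proof.
elim/pol_ind: P => [|c u v IHu IHv|m]; first by rewrite !linear0 if_same.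
  by rewrite !linearP /= IHu IHv; case: ifP; rewrite ?scaler0 ?addr0.
rewrite !wprojU; case: (eqVneq (wt m) N') => [<-|mN]; last by rewrite linear0 if_same.
by rewrite wprojU eq_sym.
Qed.

Lemma wproj_sum P : exists B, forall B', (B <= B')%N -> P = \sum_(N < B') wproj N P.
Proof.
elim/pol_ind: P => [|c u v [B HB] [B' HB']|m].
- by exists 0%N => B _; rewrite big1 // => i _; rewrite linear0.
- exists (maxn B B') => D; rewrite geq_max => /andP[h h'].
  rewrite {1}(HB _ h) {1}(HB' _ h') scaler_sumr -big_split /=.
  by apply: eq_bigr => i _; rewrite linearP.
exists (wt m).+1 => B wB; rewrite (bigD1 (Ordinal wB)) //= wprojU eqxx.
by rewrite big1 ?addr0 // => i; rewrite -val_eqE /= wprojU eq_sym => /negbTE ->.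
Qed.

Definition pder x : M -> M := pext M (fun m => (m x)%:R *: mono M (divcm m (ucm x))).
HB.instance Definition _ x := GRing.Linear.on (pder x).

Lemma pderU x m : pder x (mono M m) = (m x)%:R *: mono M (divcm m (ucm x)).
Proof. exact: pextU. Qed.

Lemma pder1 x : pder x 1 = 0.
Proof. by rewrite -mono1 pderU cm1 scale0r. Qed.

Lemma pder_gen x y P : pder x (gen y * P) = (x == y)%:R *: P + gen y * pder x P.
Proof.
elim/pol_ind: P => [|c P P' IH IH'|m].
- by rewrite !(mulr0, linear0) ?addr0.
- rewrite mulrDr -scalerAr !linearP /= IH IH' mulrDr -scalerAr /=.
  rewrite !scalerDr !scalerA (mulrC c) -!addrA; congr (_ + _).
  by rewrite addrCA.
rewrite gen_mul !pderU cmM ucmE -scalerAr.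
case: (eqVneq x y) => [<-|xy] /=; last first.
  rewrite scale0r add0n add0r gen_mul.
  have [->|mx] := posnP (m x); first by rewrite !scale0r.
  congr (_ *: mono M _); apply/eqP/cmP => z; rewrite cmM !divcmE cmM !ucmE.
  by case: (eqVneq x z) => [<-|_]; lia.
rewrite scale1r.
have -> : divcm (mmul (ucm x) m) (ucm x) = m.
  by apply/eqP/cmP => z; rewrite divcmE cmM ucmE; lia.
rewrite add1n -natr1 scalerDl scale1r addrC; congr (_ + _).
have [->|mx] := posnP (m x); first by rewrite !scale0r.
rewrite gen_mul; congr (_ *: mono M _); apply/eqP/cmP => z.
rewrite cmM divcmE ucmE; case: (eqVneq x z) => [<-|_]; lia.
Qed.

Lemma gen_pder x m : gen x * pder x (mono M m) = (m x)%:R *: mono M m.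
Proof.
rewrite pderU -scalerAr gen_mul.
have [->|mx] := posnP (m x); first by rewrite !scale0r.
congr (_ *: mono M _); apply/eqP/cmP => z.
rewrite cmM divcmE ucmE; case: (eqVneq x z) => [<-|_]; lia.
Qed.

(** The operator [gen x * pder x] multiplies the monomial m by [m x], so in characteristic 0 the
    vanishing of [pder x P] kills the coefficients of all monomials containing x. *)
Lemma pder_eq0 P : (forall k, k.+1%:R != 0 :> K) ->
  (forall x, pder x P = 0) -> exists a, P = a *: 1.
Proof.
move=> charK H; exists (pcoef mone P); apply: polP => m; rewrite -!/(pcoef _ _).
rewrite linearZ /= -mono1 pcoefU eq_sym.
case: (eqVneq m mone) => [->|m1]; first by rewrite /GRing.scale /= mulr1.
rewrite scaler0; have [x mx] : exists x, m x != 0%N.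
  apply: contrapT => /forallNP mx; move/negP: m1; apply; apply/cmP => x.
  by rewrite cm1; apply/eqP/negP => /negP/mx.
pose f := pext M (fun m' : mon => (m' x)%:R *: mono M m').
have fE : f P = 0.
  rewrite -[RHS](mulr0 (gen x)) -[X in _ * X](H x); move: {H} P.
  apply: pol_ind => [|c P P' IH IH'|m']; first by rewrite !linear0 mulr0.
    by rewrite !linearP /= IH IH' mulrDr -scalerAr.
  by rewrite gen_pder /f pextU.
have := @pcoef_diag f (fun m' : mon => (m' x)%:R) (fun m' => pextU _ _ m') P m.
rewrite fE linear0 => /esym/eqP; rewrite mulf_eq0 -(prednK (n := m x)) ?lt0n //.
by rewrite (negbTE (charK _)) => /eqP.
Qed.

(* [tcoef c d P] is the coefficient of y^d in the polynomial obtained from P by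
   the substitution beta_i(-j) |-> beta_i(-j) - c_i y^j. *)
Section Translation.
Context (c : 'I_n -> K).

Definition tgen x : {poly pol M} := (gen x)%:P - (c x.1 *: 1)%:P * 'X^(x.2.+1).

Definition tmon m : {poly pol M} := \prod_(x <- finsupp m) tgen x ^+ m x.

Lemma tmonEw m (D : {fset mode}) : (finsupp m `<=` D)%fset ->
  tmon m = \prod_(x <- D) tgen x ^+ m x.
Proof.
move=> le; rewrite /tmon (big_fset_incl _ le) // => x _.
by rewrite -cmE_eq0 => /eqP ->.
Qed.

Lemma tmon1 : tmon mone = 1.
Proof. by rewrite /tmon mdom1 big_seq_fset0. Qed.

Lemma tmonM m m' : tmon (mmul m m') = tmon m * tmon m'.
Proof.
rewrite [tmon (mmul m m')]/tmon mdomD (tmonEw (fsubsetUl _ (finsupp m'))).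
rewrite (tmonEw (fsubsetUr (finsupp m) _)) -big_split /=.
by apply: eq_bigr => x _; rewrite cmM exprD.
Qed.

Lemma tmonU x : tmon (ucm x) = tgen x.
Proof. by rewrite /tmon mdomU big_seq_fset1 cmUU expr1. Qed.

Definition tcoef d : M -> M := pext M (fun m => (tmon m)`_d).
HB.instance Definition _ d := GRing.Linear.on (tcoef d).

Lemma tcoefU d m : tcoef d (mono M m) = (tmon m)`_d.
Proof. exact: pextU. Qed.

Lemma tcoef1 d : tcoef d 1 = (d == 0%N)%:R.
Proof. by rewrite -[X in tcoef d X]mono1 tcoefU tmon1 coef1. Qed.

Lemma tcoef_gen d x P : tcoef d (gen x * P) =
  gen x * tcoef d P - c x.1 *: shift (tcoef^~ P) x.2 d.
Proof.
rewrite /shift; elim/pol_ind: P => [|a P P' IH IH'|m].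
- by rewrite mulr0 !linear0; case: ifP; rewrite mulr0 scaler0 subr0.
- rewrite mulrDr -scalerAr !linearP /= IH IH' mulrDr -scalerAr; case: ifP => _.
    rewrite scalerBr scalerDr opprD addrACA.
    by rewrite !scalerA (mulrC a).
  by rewrite !scaler0 !subr0.
rewrite gen_mul !tcoefU tmonM tmonU mulrBl coefB coefCM; congr (_ - _).
rewrite -mulrA coefCM coefXnM -scalerAl mul1r ltnS; congr (_ *: _).
by case: ltnP; rewrite ?ltnn //= => ?; rewrite tcoefU.
Qed.

Lemma tcoef0 P : tcoef 0 P = P.
Proof.
elim/gen_ind: P => [|a P P' IH IH'||x P IH]; first by rewrite linear0.
- by rewrite linearP /= IH IH'.
- by rewrite tcoef1.
by rewrite tcoef_gen /shift IH scaler0 subr0.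
Qed.

Lemma tcoefM d P Q :
  tcoef d (P * Q) = \sum_(j < d.+1) tcoef j P * tcoef (d - j) Q.
Proof.
elim/pol_ind: P => [|a P P' IH IH'|m].
- by rewrite mul0r linear0 big1 // => j _; rewrite linear0 mul0r.
- rewrite mulrDl -scalerAl linearP /= IH IH' scaler_sumr -big_split /=.
  by apply: eq_bigr => j _; rewrite linearP /= mulrDl scalerAl.
elim/pol_ind: Q => [|a P P' IH IH'|m'].
- by rewrite mulr0 linear0 big1 // => j _; rewrite linear0 mulr0.
- rewrite mulrDr -scalerAr linearP /= IH IH' scaler_sumr -big_split /=.
  by apply: eq_bigr => j _; rewrite linearP /= mulrDr scalerAr.
rewrite -monoM tcoefU tmonM coefM.
by apply: eq_bigr => j _; rewrite !tcoefU.
Qed.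

(** If y is given weight 1, each y^j has the weight of the beta_i(-j) it is subtracted from, so the
    substitution is homogeneous. *)
Lemma tcoef_wproj d N P :
  tcoef d (wproj N P) = if (d <= N)%N then wproj (N - d) (tcoef d P) else 0.
Proof.
elim/gen_ind: P d N => [|a P P' IH IH'||x P IH] d N.
- by rewrite !linear0 if_same.
- by rewrite !linearP /= IH IH'; case: ifP; rewrite ?scaler0 ?addr0 // linearP.
- rewrite wproj1 tcoef1; case: d N => [|d] [|N]; rewrite ?leqn0 ?subn0 //=.
  all: rewrite ?tcoef1 ?mulr1n ?mulr0n ?linear0 ?wproj1 //=.
  by rewrite if_same.
rewrite wproj_gen tcoef_gen [in RHS]tcoef_gen [wproj _ (_ - _)]linearB /=.
rewrite wproj_gen [wproj _ (_ *: _)]linearZ /= /shift /=.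
case: (ltnP x.2 N) => xN; last first.
  rewrite !(linear0, if_same, addr0, mulr0); case: ifP => dN //.
  rewrite ifF; last by lia.
  by rewrite ifF ?(mulr0, linear0, oppr0, addr0) //; lia.
rewrite !IH; case: (leqP d N) => dN; last first.
  by rewrite ifF ?mulr0 ?sub0r; [rewrite ifT ?IH ?ifF ?scaler0 ?oppr0 //|]; lia.
congr (_ - _ *: _).
  congr (_ * _); case: (leqP d (N - x.2.+1)%N) => h1.
    by rewrite ifT; [congr (wproj _ _)|]; lia.
  by rewrite ifF //; lia.
case: (ltnP x.2 d) => xd; rewrite ?linear0 // ifT; last by lia.
by congr (wproj _ _); lia.
Qed.

Lemma tcoef_pder d x P : tcoef d (pder x P) = pder x (tcoef d P).
Proof.
elim/gen_ind: P d => [|a P P' IH IH'||y P IH] d.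
- by rewrite !linear0.
- by rewrite !linearP /= IH IH'.
- by rewrite tcoef1 pder1 linear0; case: eqP; rewrite ?pder1 ?linear0.
rewrite pder_gen [tcoef _ (_ + _)]linearD /= [tcoef _ (_ *: P)]linearZ /= !tcoef_gen.
rewrite [pder _ (_ - _)]linearB /= [pder _ (_ *: shift _ _ _)]linearZ /= pder_gen -addrA.
congr (_ + _); rewrite IH; congr (_ - _ *: _); rewrite /shift.
by case: ifP => _; rewrite ?linear0 // IH.
Qed.

Lemma tcoef_bound P : exists B, forall d, (B <= d)%N -> tcoef d P = 0.
Proof.
elim/pol_ind: P => [|a P P' [B HB] [B' HB']|m].
- by exists 0%N => d _; rewrite linear0.
- exists (maxn B B') => d; rewrite geq_max => /andP[h h'].
  by rewrite linearP /= HB // HB' // scaler0 addr0.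
by exists (size (tmon m)) => d h; rewrite tcoefU nth_default.
Qed.

(** For [c i] = <h, beta_i> and j > 0 this is the annihilation operator h_j; the predecessor of j
    appears because (i, p) encodes beta_i(-p-1). *)
Definition ders j P : M := \sum_i (j%:R * c i) *: pder (i, j.-1) P.

Lemma dersE j P : ders j P = \sum_i (j%:R * c i) *: pder (i, j.-1) P.
Proof. by []. Qed.

Lemma ders_linear j : linear (ders j).
Proof.
move=> a P Q; rewrite scaler_sumr -big_split /=; apply: eq_bigr => i _.
by rewrite linearP /= scalerDr !scalerA mulrC.
Qed.
HB.instance Definition _ j :=
  GRing.isLinear.Build K M M _ (ders j) (ders_linear j).

Lemma ders1 j : ders j 1 = 0.
Proof. by apply: big1 => i _; rewrite pder1 scaler0. Qed.

Lemma ders_gen j x P : (0 < j)%N -> ders j (gen x * P) =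
  (if j == x.2.+1 then (j%:R * c x.1) *: P else 0) + gen x * ders j P.
Proof.
move=> j0; rewrite /ders; under eq_bigr do rewrite pder_gen scalerDr.
rewrite big_split /= mulr_sumr; congr (_ + _); last first.
  by apply: eq_bigr => i _; rewrite scalerAr.
case: eqP => jx.
  rewrite (bigD1 x.1) //= jx /= -surjective_pairing eqxx scale1r big1 ?addr0 //.
  move=> i /negbTE ix; rewrite [x]surjective_pairing /= xpair_eqE ix.
  by rewrite scale0r scaler0.
rewrite big1 // => i _; rewrite [x]surjective_pairing xpair_eqE.
rewrite [_ == x.2](_ : _ = false) ?andbF ?scale0r ?scaler0 //.
by apply/negbTE; lia.
Qed.

(** The substitution is G(y) = exp(- \sum_j (y^j / j) [ders j]), and this is the coefficient of y^d
    in its logarithmic derivative with respect to y d/dy. It will identify [tcoef] with the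
    annihilation exponential. *)
Lemma tcoef_newton d P :
  d%:R *: tcoef d P = - \sum_(1 <= j < d.+1) tcoef (d - j) (ders j P).
Proof.
elim/gen_ind: P d => [|a P P' IH IH'||x P IH] d.
- by rewrite linear0 scaler0 big1 ?oppr0 // => j _; rewrite !linear0.
- rewrite linearP scalerDr scalerA mulrC -scalerA IH IH' scalerN -opprD.
  rewrite scaler_sumr -big_split /=; congr (- _); apply: eq_bigr => j _.
  by rewrite !linearP.
- rewrite tcoef1 big1 ?oppr0 => [|j _]; last by rewrite ders1 linear0.
  by case: d => [|d] /=; rewrite ?scale0r // scaler0.
have tD j : (0 < j)%N -> tcoef (d - j) (ders j (gen x * P)) =
  (if j == x.2.+1 then (j%:R * c x.1) *: tcoef (d - j) P else 0) +
  (gen x * tcoef (d - j) (ders j P) -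
   c x.1 *: shift (tcoef^~ (ders j P)) x.2 (d - j)).
  move=> j0; rewrite ders_gen // linearD /= tcoef_gen; congr (_ + _).
  by case: ifP => _; rewrite ?linear0 ?linearZ.
rewrite (eq_big_nat _ _ (fun j jd => tD j (proj1 (andP jd)))) !big_split /=.
rewrite sumrN -mulr_sumr -scaler_sumr tcoef_gen scalerBr scalerAr IH /shift.
case: (ltnP x.2 d) => xd; last first.
  rewrite [X in - (X + _)]big1_seq => [|j]; last first.
    by rewrite mem_index_iota => /andP[_ /andP[j0 jd]]; rewrite ifF //; lia.
  rewrite !scaler0 subr0 add0r mulrN.
  rewrite [X in c x.1 *: X]big1_seq => [|j]; last first.
    by rewrite mem_index_iota => /andP[_ /andP[j0 jd]]; rewrite ifF //; lia.
  by rewrite scaler0 subr0.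
rewrite -big_mkcond (big_nat1_eq _ (fun j => (j%:R * c x.1) *: tcoef (d - j) P)).
rewrite ifT //.
have -> : \sum_(1 <= j < d.+1) (if (x.2 < d - j)%N then
    tcoef (d - j - x.2.+1) (ders j P) else 0)
  = - ((d - x.2.+1)%:R *: tcoef (d - x.2.+1) P).
  rewrite IH opprK (big_cat_nat (n := (d - x.2.+1).+1)) //=; last by lia.
  rewrite [X in _ + X]big1_seq ?addr0 => [|j]; last first.
    by rewrite mem_index_iota => /andP[_ /andP[j0 jd]]; rewrite ifF //; lia.
  apply: eq_big_nat => j /andP[j0 jd]; rewrite ifT; last by lia.
  by congr (tcoef _ _); lia.
rewrite mulrN scalerN opprK opprD opprD addrCA; congr (_ + _).
rewrite -opprD !scalerA -scalerDl; congr (- (_ *: _)).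
by rewrite natrB //; ring.
Qed.

End Translation.

Lemma tcoefC c c' d d' P : tcoef c d (tcoef c' d' P) = tcoef c' d' (tcoef c d P).
Proof.
elim/gen_ind: P d d' => [|a P P' IH IH'||x P IH] d d'.
- by rewrite !linear0.
- by rewrite !linearP /= IH IH'.
- by rewrite !tcoef1; case: d d' => [|d] [|d'] /=; rewrite ?tcoef1 ?linear0.
have E a a' k k' : tcoef a k (tcoef a' k' (gen x * P)) =
    gen x * tcoef a k (tcoef a' k' P)
    - a x.1 *: shift (fun i => tcoef a i (tcoef a' k' P)) x.2 k
    - a' x.1 *: shift (fun i => tcoef a k (tcoef a' i P)) x.2 k'.
  rewrite tcoef_gen linearB /= [tcoef a k (_ *: _)]linearZ /= tcoef_gen.
  by congr (_ - _ *: _); rewrite /shift; case: ifP; rewrite ?linear0.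
rewrite !E IH addrAC; congr (_ - _ *: _ - _ *: _); rewrite /shift.
  by case: ifP.
by case: ifP.
Qed.

End Polynomials.

(** * Complete symmetric functions and bounded translations *)

Section GeneralizedBinomials.
Context (K : fieldType).

(* The coefficient of t^j in (1 - t)^e. *)
Definition gbin (e : int) (j : nat) : K :=
  match e with
  | Posz n => (-1) ^+ j * 'C(n, j)%:R
  | Negz n => 'C(n + j, j)%:R
  end.

Arguments gbin : simpl never.

Lemma gbin0 e : gbin e 0 = 1.
Proof. by case: e => n; rewrite /gbin bin0 // mul1r. Qed.

Lemma gbin_pascal e j : gbin (e + 1) j.+1 = gbin e j.+1 - gbin e j.
Proof.
case: e => [n|[|n]]; rewrite /gbin /=.
- rewrite addn1 binS natrD mulrDr [in X in _ + X]exprS; congr (_ + _).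
  by rewrite mulN1r mulNr.
- by rewrite bin0n mulr0 !binn subrr.
by rewrite subn1 [in RHS]addnS binS natrD addrK addSnnS.
Qed.

Lemma gbin_rec e j : j.+1%:R * gbin e j.+1 = (j%:R - e%:~R) * gbin e j.
Proof.
case: e => [n|n]; rewrite /gbin.
- rewrite mulrCA -natrM mul_bin_left exprS natrM mulN1r mulNr -mulrN mulrA.
  rewrite -mulrN mulrCA; have [jn|nj] := leqP j n.
    by rewrite natrB // -pmulrn; ring.
  by rewrite bin_small // !(mulr0n, mulr0, oppr0).
rewrite addnS -natrM -mul_bin_diag natrM NegzE; congr (_ * _).
by rewrite mulrNz opprK -pmulrn -natrD; congr _%:R; lia.
Qed.

Lemma gbin_small (e j : nat) : (e < j)%N -> gbin e j = 0.
Proof. by move=> ej; rewrite /gbin bin_small // mulr0. Qed.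

Lemma gbin11 : gbin 1 1 = -1.
Proof. by rewrite -[1]/(Posz 1) /gbin bin1 mulr1. Qed.

(** The equation t d/dt (1 - t)^e = - e t (1 - t)^(e-1), where division by 1 - t turns coefficients
    into partial sums. *)
Lemma gbin_sum e j : e%:~R * \sum_(m < j) gbin e m = - (j%:R * gbin e j).
Proof.
elim: j => [|j IH]; first by rewrite big_ord0 mulr0 mul0r oppr0.
by rewrite big_ord_recr /= mulrDr IH gbin_rec; ring.
Qed.

Lemma gbin_sub1 e j : gbin (e - 1) j = \sum_(m < j.+1) gbin e m.
Proof.
elim: j => [|j IH]; first by rewrite big_ord1 !gbin0.
by rewrite big_ord_recr /= -IH -[in gbin e _](subrK 1 e) gbin_pascal addrC subrK.
Qed.

(* (1 - t)^e (1 - t)^(-p-1) = (1 - t)^(e-p-1). *)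
Lemma gbin_sub e p j :
  gbin (e - p.+1%:Z) j = \sum_(m < j.+1) 'C(p + m, p)%:R * gbin e (j - m).
Proof.
elim: p e j => [|p IH] e j.
  rewrite gbin_sub1 (reindex_inj rev_ord_inj) /=.
  by apply: eq_bigr => m _; rewrite add0n bin0 mul1r subSS.
rewrite -[p.+2]addn1 PoszD opprD addrA gbin_sub1.
elim: j => [|j IHj].
  by rewrite !big_ord1 gbin0 subnn gbin0 addn0 binn mul1r.
rewrite big_ord_recr /= IHj IH -IHj.
rewrite [RHS]big_ord_recl /= subn0 addn0 binn mul1r.
rewrite IHj [X in _ + X = _]big_ord_recl /= subn0 addn0 binn mul1r.
rewrite addrCA; congr (_ + _); rewrite -big_split /=; apply: eq_bigr => m _.
rewrite /bump /= !add1n subSS -mulrDl -natrD; congr (_%:R * _).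
by rewrite [in RHS]addnS binS [(p + m.+1)%N]addnS addSn.
Qed.

End GeneralizedBinomials.
Arguments gbin : simpl never.

Section Newton.
Context (K : fieldType) (n : nat) (M : polyalg K n).
Hypothesis charK : forall k, k.+1%:R != 0 :> K.
Local Notation mode := (mode n).
Implicit Types (P Q : M) (c : 'I_n -> K) (i : 'I_n).

(* [newton c p] is the coefficient of y^p in
   exp(\sum_(j > 0) (\sum_i c_i beta_i(-j)) y^j / j): with the beta_i(-j) as power
   sums, [newton (delta i)] is the sequence of complete symmetric functions. *)
Definition cgen c j : M := \sum_i c i *: gen M (i, j.-1).

Fixpoint newton_seq c p : seq M :=
  if p is p'.+1 then
    let s := newton_seq c p' in
    rcons s (p%:R^-1 *: \sum_(1 <= j < p.+1) cgen c j * s`_(p - j))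
  else [:: 1].

Definition newton c p : M := (newton_seq c p)`_p.

Lemma size_newton_seq c p : size (newton_seq c p) = p.+1.
Proof. by elim: p => //= p IH; rewrite size_rcons IH. Qed.

Lemma nth_newton_seq c p q : (q <= p)%N -> (newton_seq c p)`_q = newton c q.
Proof.
elim: p => [|p IH]; first by rewrite leqn0 => /eqP ->.
rewrite leq_eqVlt => /predU1P[->//|qp] /=.
by rewrite nth_rcons size_newton_seq qp IH.
Qed.

Lemma newton0 c : newton c 0 = 1.
Proof. by []. Qed.

Lemma newtonE c p :
  p%:R *: newton c p = \sum_(1 <= j < p.+1) cgen c j * newton c (p - j).
Proof.
case: p => [|p]; first by rewrite scale0r big_geq.
rewrite {1}/newton /= nth_rcons size_newton_seq ltnn eqxx scalerA mulfV //.
rewrite scale1r; apply: eq_big_nat => j /andP[j0 jp].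
by rewrite nth_newton_seq //; lia.
Qed.

Definition delta i : 'I_n -> K := fun j => (j == i)%:R.
Definition tc i := @tcoef K n M (delta i).
HB.instance Definition _ i d := GRing.Linear.on (tc i d).

Lemma tc_gen i d x P : tc i d (gen M x * P) =
  gen M x * tc i d P - (x.1 == i)%:R *: shift (tc i ^~ P) x.2 d.
Proof. exact: tcoef_gen. Qed.

Lemma tcM i d P Q :
  tc i d (P * Q) = \sum_(j < d.+1) tc i j P * tc i (d - j) Q.
Proof. exact: tcoefM. Qed.

Lemma tc_wproj i d N P :
  tc i d (wproj N P) = if (d <= N)%N then wproj (N - d) (tc i d P) else 0.
Proof. exact: tcoef_wproj. Qed.

Lemma tcC i c d d' P : tc i d (tcoef c d' P) = tcoef c d' (tc i d P).
Proof. exact: tcoefC. Qed.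

Lemma tc_cgen i d c j P : (0 < j)%N -> tc i d (cgen c j * P) =
  cgen c j * tc i d P - c i *: (if (j <= d)%N then tc i (d - j) P else 0).
Proof.
case: j => // j _; rewrite /cgen mulr_suml raddf_sum /=.
under eq_bigr => k _ do rewrite -scalerAl linearZ /= tc_gen scalerBr.
rewrite sumrB mulr_suml; congr (_ - _).
  by apply: eq_bigr => k _; rewrite scalerAl.
rewrite (bigD1 i) //= eqxx scale1r big1 ?addr0 // => k /negbTE ->.
by rewrite scale0r scaler0.
Qed.

(** The substitution sends [cgen c j] to [cgen c j] - a y^j, so the generating series exp(\sum_j
    [cgen c j] z^j / j) is multiplied by exp(- a \sum_j (y z)^j / j) = (1 - y z)^a. *)
Lemma tc_newton i c (a : int) p d : c i = a%:~R ->
  tc i d (newton c p) = if (d <= p)%N then gbin K a d *: newton c (p - d) else 0.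
Proof.
move=> ca; have [m] := ubnP p; elim: m p d => // m IH [|p] d pm.
  rewrite newton0 /tc tcoef1; case: d => [|d] //=.
  by rewrite gbin0 scale1r.
apply: (scalerI (charK p)); rewrite -linearZ /= newtonE raddf_sum /=.
(* Each [cgen c j] contributes itself and - a y^j. The first contributions rebuild
   [newton c (p.+1 - d)] with the factor p + 1 - d; the second form the partial sums of [gbin_sum]
   and supply the missing factor d. *)
rewrite (eq_big_nat _ _ (F2 := fun j =>
  (if (d <= p.+1 - j)%N then gbin K a d *: (cgen c j * newton c (p.+1 - j - d)) else 0)
  - (if (d <= p.+1)%N then
    (if (j <= d)%N then (a%:~R * gbin K a (d - j)) *: newton c (p.+1 - d) else 0)
    else 0))); last first.
  move=> j /andP[j0 jp]; rewrite tc_cgen // IH; last by lia.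
  rewrite ca; congr (_ - _).
    by case: ifP => _; rewrite ?mulr0 // scalerAr.
  case: (leqP j d) => jd; last by rewrite scaler0 if_same.
  rewrite IH; last by lia.
  rewrite (_ : (d - j <= p.+1 - j)%N = (d <= p.+1)%N); last by lia.
  case: ifP => // dp; last by rewrite scaler0.
  by rewrite scalerA; congr (_ *: newton _ _); lia.
rewrite big_split /= sumrN; have [dp|pd] := leqP d p.+1; last first.
  rewrite !big1_seq ?subr0 ?scaler0 // => j; rewrite mem_index_iota.
  by move=> /andP[_ /andP[j0 jp]]; rewrite ifF //; lia.
rewrite (big_cat_nat (n := (p.+1 - d).+1)) //=; last by lia.
rewrite [X in _ + X - _]big1_seq ?addr0 => [|j]; last first.
  by rewrite mem_index_iota => /andP[_ /andP[j0 jp]]; rewrite ifF //; lia.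
rewrite (eq_big_nat _ _ (F2 := fun j =>
  gbin K a d *: (cgen c j * newton c (p.+1 - d - j)))); last first.
  move=> j /andP[j0 jp]; rewrite ifT; last by lia.
  by congr (_ *: (_ * newton _ _)); lia.
rewrite -scaler_sumr -newtonE.
rewrite (big_cat_nat (n := d.+1)) //=.
rewrite [X in _ - (_ + X)]big1_seq ?addr0 => [|j]; last first.
  by rewrite mem_index_iota => /andP[_ /andP[j0 jp]]; rewrite ifF //; lia.
rewrite (eq_big_nat _ _ (F2 := fun j =>
  (a%:~R * gbin K a (d - j)) *: newton c (p.+1 - d))); last first.
  by move=> j /andP[j0 jp]; rewrite ifT //; lia.
rewrite -scaler_suml -mulr_sumr big_add1 big_mkord (reindex_inj rev_ord_inj) /=.
rewrite (eq_bigr (fun j : 'I_d => gbin K a j)) => [|j _]; last first.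
  by congr (gbin K a _); have := ltn_ord j; lia.
rewrite gbin_sum !scalerA scaleNr opprK -scalerDl; congr (_ *: _).
by rewrite natrB //; ring.
Qed.

Definition hsym i := newton (delta i).

(** The case a = 1, in which (1 - y z)^a has only the terms 1 and - y z. *)
Lemma tc_hsym i p d P : tc i d.+1 (hsym i p.+1 * P) =
  hsym i p.+1 * tc i d.+1 P - hsym i p * tc i d P.
Proof.
rewrite tcM 2!big_ord_recl big1 ?addr0 => [|j _]; last first.
  rewrite (@tc_newton i _ 1) ?/delta ?eqxx // gbin_small // scale0r if_same.
  by rewrite mul0r.
rewrite /= !(@tc_newton i _ 1) ?/delta ?eqxx // /bump /= ?addn0 ?subn0 ?subSS ?subn0 gbin0.
by rewrite gbin11 scale1r scaleN1r mulNr.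
Qed.

Lemma tc_hsymN i j p d P : j != i -> tc j d (hsym i p * P) = hsym i p * tc j d P.
Proof.
move=> ji; rewrite tcM big_ord_recl big1 ?addr0 => [|k _]; last first.
  rewrite (@tc_newton j _ 0) ?/delta ?(negbTE ji) // gbin_small // scale0r if_same.
  by rewrite mul0r.
by rewrite (@tc_newton j _ 0) ?/delta ?(negbTE ji) //= gbin0 scale1r !subn0.
Qed.

(* For k large in the directions of S, these spaces exhaust W(R,S;l)^k, with its
   factor e^(k+l) removed. *)
Definition bounded (k : 'I_n -> nat) P : Prop :=
  forall i d, (k i < d)%N -> tc i d P = 0.

Definition incr (k : 'I_n -> nat) i : 'I_n -> nat := fun j => (k j + (j == i))%N.

Lemma bounded0 k : bounded k 0.
Proof. by move=> i d _; rewrite linear0. Qed.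

Lemma boundedP k a P Q : bounded k P -> bounded k Q -> bounded k (a *: P + Q).
Proof. by move=> hP hQ i d kd; rewrite linearP /= hP // hQ // scaler0 addr0. Qed.

Lemma bounded_tcoef k c d P : bounded k P -> bounded k (tcoef c d P).
Proof. by move=> hP i e ke; rewrite tcC hP // linear0. Qed.

Lemma bounded_wproj k N P : bounded k P -> bounded k (wproj N P).
Proof.
move=> hP i e ke; rewrite tc_wproj hP // linear0.
by rewrite if_same.
Qed.

Lemma bounded_hsym k i p P : bounded k P -> bounded (incr k i) (hsym i p * P).
Proof.
move=> hP j d; rewrite /incr; have [->|ji] := eqVneq j i; last first.
  by rewrite addn0 => kd; rewrite tc_hsymN // hP // mulr0.
case: d p => [|d] [|p]; rewrite ?addn1 // ltnS => kd.
  by rewrite /hsym newton0 mul1r hP // ltnS ltnW.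
by rewrite tc_hsym !hP ?mulr0 ?subr0 // ltnS ltnW.
Qed.

Inductive hspan k i : M -> Prop :=
| hspan0 : hspan k i 0
| hspanD p Q P : bounded k Q -> hspan k i P -> hspan k i (hsym i p * Q + P).

Lemma hspan_add k i P Q : hspan k i P -> hspan k i Q -> hspan k i (P + Q).
Proof.
by elim=> [|p R P' hR _ IH] hQ; rewrite ?add0r // -addrA; apply: hspanD => //; apply: IH.
Qed.

Lemma hspan_sum k i m (F : 'I_m -> M) :
  (forall j, hspan k i (F j)) -> hspan k i (\sum_j F j).
Proof.
move=> hF; elim/big_rec: _ => [|j P _ hP]; first exact: hspan0.
exact: hspan_add.
Qed.

Lemma hspan_bounded k i P : hspan k i P -> bounded (incr k i) P.
Proof.
elim=> [|p Q P' hQ _ IH]; first exact: bounded0.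
by rewrite -[_ * _]scale1r; apply: boundedP => //; apply: bounded_hsym.
Qed.

Definition tc_onto i m := forall k, k i = m -> forall P, bounded k P ->
  exists2 P', bounded k P' & tc i m P' = P.

(* By induction on the weight: [tc i m.+1] lifts from the span of the
   [hsym i p * Q], as it maps [hsym i p.+1 * Q] to [- hsym i p * tc i m Q], and
   its kernel satisfies the bound k. *)
Lemma tc_onto_hspan i m : tc_onto i m -> forall k, k i = m ->
  forall P, bounded (incr k i) P -> hspan k i P.
Proof.
move=> onto k km P hP.
have lift Q : hspan k i Q -> exists2 P', hspan k i P' & tc i m.+1 P' = Q.
  elim=> [|p R Q' hR _ [P' hP' <-]].
    by exists 0; [exact: hspan0|rewrite linear0].
  have [R' hR' <-] := onto k km R hR.
  exists (hsym i p.+1 * (- R') + P').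
    apply: hspanD => // j d kd; rewrite linearN /= hR' ?oppr0 //.
  rewrite linearD /= tc_hsym !linearN /= (hR' i m.+1) ?km // oppr0 mulr0 sub0r.
  by rewrite mulrN opprK.
have [B /(_ B (leqnn B)) ->] := wproj_sum P.
apply: hspan_sum => N; have {hP} := bounded_wproj N hP.
have : wproj N (wproj N P) = wproj N P by rewrite wproj_id eqxx.
move: (wproj N P) => {}P; move: (nat_of_ord N) => {B}N.
have [b] := ubnP N; elim: b N P => // b IH N P Nb PN hP.
have [P' hP' eP'] : exists2 P', hspan k i P' & tc i m.+1 P' = tc i m.+1 P.
  apply: lift; rewrite -PN tc_wproj.
  have [mN|mN] := leqP m.+1 N; last exact: hspan0.
  apply: (IH (N - m.+1)%N); first by lia.
    by rewrite wproj_id eqxx.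
  exact: bounded_wproj (bounded_tcoef _ _ hP).
have hD : bounded k (P - P').
  move=> j d kd; rewrite linearB /=.
  have [ij|ji] := eqVneq j i; last first.
    by rewrite hP ?(hspan_bounded hP') ?subrr // /incr (negbTE ji) addn0.
  rewrite ij in kd *; have [->|dm] := eqVneq d m.+1; first by rewrite eP' subrr.
  by rewrite hP ?(hspan_bounded hP') ?subrr // /incr eqxx addn1; lia.
(* As h_0 = 1, the remainder, which satisfies the bound k, is itself a term of the span. *)
by have := hspanD 0 hD hP'; rewrite /hsym newton0 mul1r subrK.
Qed.

(** Surjectivity and generation alternate: surjectivity at m makes the products h_p Q span the space
    with the bound raised to m + 1, and this span gives surjectivity at m + 1. If Q = [tc i m Q'],
    then h_p Q is the image of - h_(p+1) Q', because [tc i m.+1 Q'] vanishes. *)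
Lemma tc_ontoP i m : tc_onto i m.
Proof.
elim: m => [|m IH] k km P hP; first by exists P => //; rewrite /tc tcoef0.
pose k' j := (k j - (j == i))%N.
have kE : incr k' i = k.
  by apply/funext => j; rewrite /incr /k'; case: eqP => [->|_]; lia.
have k'm : k' i = m by rewrite /k' km eqxx subn1.
have := tc_onto_hspan IH k'm; rewrite kE => /(_ P hP).
elim=> [|p Q P' hQ _ [R hR <-]]; first by exists 0; [exact: bounded0|rewrite linear0].
have [Q' hQ' <-] := IH k' k'm Q hQ.
exists (hsym i p.+1 * (- Q') + R).
  rewrite -[_ * _]scale1r; apply: boundedP => //; rewrite -kE; apply: bounded_hsym.
  by move=> j d kd; rewrite linearN /= hQ' ?oppr0.
rewrite linearD /= tc_hsym !linearN /= (hQ' i m.+1) ?k'm // oppr0 mulr0 sub0r.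
by rewrite mulrN opprK.
Qed.

Lemma bounded_hspan k i P : bounded (incr k i) P -> hspan k i P.
Proof. exact: (tc_onto_hspan (@tc_ontoP i _) erefl). Qed.

(** P is invariant under all translations, so only the last term of [tcoef_newton] survives; it is a
    nonzero multiple of a partial derivative of P. *)
Lemma bounded_const k P : (forall i, k i = 0%N) -> bounded k P ->
  exists a, P = a *: 1.
Proof.
move=> k0 hP; apply: pder_eq0 => // -[i p].
have := tcoef_newton (delta i) p.+1 P; rewrite -/(tc _ _ _) hP ?k0 // scaler0.
rewrite big_nat_recr //= subnn tcoef0 big1_seq => [|j]; last first.
  rewrite mem_index_iota => /andP[_ /andP[j0 jp]].
  rewrite /ders raddf_sum big1 //= => l _.
  rewrite linearZ /= tcoef_pder -/(tc _ _ _) hP ?linear0 ?scaler0 // k0.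
  by rewrite subn_gt0.
rewrite add0r /ders (bigD1 i) //= big1 ?addr0 => [|j /negbTE ji]; last first.
  by rewrite /delta ji mulr0 scale0r.
rewrite /delta eqxx mulr1 => /esym/eqP; rewrite oppr_eq0 scaler_eq0.
by rewrite (negbTE (charK p)) => /eqP.
Qed.

End Newton.

(** * Dimensions and power series *)

Section Dimension.
Context (K : fieldType).

(** [has_dim] for an arbitrary module: dimensions are computed in M(1) and carried to the Fock space
    by an injection. *)
Definition hasdim (V : lmodType K) (U : V -> Prop) (d : nat) : Prop :=
  exists b : 'I_d -> V,
    (forall c : 'I_d -> K, \sum_i c i *: b i = 0 -> forall i, c i = 0) /\
    (forall v, U v <-> exists c : 'I_d -> K, v = \sum_i c i *: b i).

Lemma hasdim0 (V : lmodType K) (U : V -> Prop) :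
  (forall v, U v <-> v = 0) -> hasdim U 0.
Proof.
move=> U0; exists (fun _ => 0); split=> [c _ []//|v]; rewrite U0; split=> [->|[c ->]].
  by exists (fun _ => 0); rewrite big_ord0.
by rewrite big_ord0.
Qed.

Lemma eq_hasdim (V : lmodType K) (U U' : V -> Prop) d :
  (forall v, U v <-> U' v) -> hasdim U d -> hasdim U' d.
Proof. by move=> UU' [b [fb sb]]; exists b; split=> // v; rewrite -UU'. Qed.

Lemma hasdim_inj (V W : lmodType K) (f : {linear V -> W}) (U : V -> Prop) d :
  injective f -> hasdim U d -> hasdim (fun w => exists2 v, U v & f v = w) d.
Proof.
move=> fI [b [fb sb]]; exists (f \o b); split=> [c|w].
  rewrite (_ : \sum_i _ = f (\sum_i c i *: b i)); last first.
    by rewrite raddf_sum; apply: eq_bigr => i _; rewrite /= linearZ.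
  by rewrite -(linear0 f) => /fI; apply: fb.
split=> [[v /sb[c ->] <-]|[c ->]].
  by exists c; rewrite raddf_sum; apply: eq_bigr => i _; rewrite /= linearZ.
exists (\sum_i c i *: b i); first by apply/sb; exists c.
by rewrite raddf_sum; apply: eq_bigr => i _; rewrite /= linearZ.
Qed.

(** Rank and nullity: a basis of the kernel, completed by lifts of a basis of the image. *)
Lemma hasdim_exact (V W : lmodType K) (f : {linear V -> W}) (U : V -> Prop)
    (U' : W -> Prop) d d' :
  (forall a u v, U u -> U v -> U (a *: u + v)) ->
  (forall v, U v -> U' (f v)) ->
  (forall w, U' w -> exists2 v, U v & f v = w) ->
  hasdim (fun v => U v /\ f v = 0) d -> hasdim U' d' -> hasdim U (d + d').
Proof.
move=> Ul fU Uf [b [fb sb]] [b' [fb' sb']].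
have U0 : U 0 by have /sb[] : exists c : 'I_d -> K, 0 = \sum_i c i *: b i
  by exists (fun _ => 0); rewrite big1 // => i _; rewrite scale0r.
have Us m (c : 'I_m -> K) (u : 'I_m -> V) :
    (forall i, U (u i)) -> U (\sum_i c i *: u i).
  by move=> Uu; elim/big_rec: _ => // i v _; apply: Ul.
have b'U j : U' (b' j).
  apply/sb'; exists (fun i => (i == j)%:R); rewrite (bigD1 j) //= eqxx scale1r.
  by rewrite big1 ?addr0 // => i /negbTE ->; rewrite scale0r.
have /choice[l lP] : forall j, exists v, U v /\ f v = b' j.
  by move=> j; have [v] := Uf _ (b'U j); exists v.
have bU i : U (b i) /\ f (b i) = 0.
  apply/sb; exists (fun j => (j == i)%:R); rewrite (bigD1 i) //= eqxx scale1r.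
  by rewrite big1 ?addr0 // => j /negbTE ->; rewrite scale0r.
pose B (i : 'I_(d + d')) := match fintype.split i with inl i => b i | inr j => l j end.
have BL i : B (lshift d' i) = b i by rewrite /B (unsplitK (inl i)).
have BR j : B (rshift d j) = l j by rewrite /B (unsplitK (inr j)).
have sumB (c : 'I_(d + d') -> K) : \sum_i c i *: B i =
    \sum_i c (lshift d' i) *: b i + \sum_j c (rshift d j) *: l j.
  by rewrite big_split_ord /=; congr (_ + _); apply: eq_bigr => i _; rewrite ?BL ?BR.
have fl (c : 'I_d' -> K) : f (\sum_j c j *: l j) = \sum_j c j *: b' j.
  by rewrite raddf_sum; apply: eq_bigr => j _; rewrite /= linearZ /= (lP j).2.
have fb0 (c : 'I_d -> K) : f (\sum_j c j *: b j) = 0.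
  by rewrite raddf_sum big1 //= => j _; rewrite linearZ /= (bU j).2 scaler0.
exists B; split=> [c|v].
  rewrite sumB => c0; have cr j : c (rshift d j) = 0.
    apply: (fb' (fun j => c (rshift d j))).
    by rewrite -fl -[LHS]add0r -(fb0 (fun i => c (lshift d' i))) -linearD c0 linear0.
  move=> i; rewrite -(splitK i); case: (fintype.split i) => [i'|j] /=; last exact: cr.
  apply: (fb (fun i => c (lshift d' i))); move: c0.
  by rewrite [X in _ + X]big1 ?addr0 // => j _; rewrite cr scale0r.
split=> [Uv|[c ->]]; last first.
  by apply: Us => i; rewrite /B; case: fintype.split => [i'|j]; [case: (bU i')|case: (lP j)].
have /sb'[c' ec'] := fU _ Uv.
have /sb[c ec] : U (v - \sum_j c' j *: l j) /\ f (v - \sum_j c' j *: l j) = 0.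
  split; last by rewrite linearB /= fl ec' subrr.
  rewrite addrC -scaleN1r; apply: Ul => //; apply: Us => j; exact: (lP j).1.
exists (fun i => match fintype.split i with inl i => c i | inr j => c' j end).
rewrite sumB -[v](subrK (\sum_j c' j *: l j)) ec; congr (_ + _); apply: eq_bigr => i _.
  by rewrite (unsplitK (inl i)).
by rewrite (unsplitK (inr i)).
Qed.

End Dimension.

(** * Power series in q, through congruences of polynomials *)

Section PowerSeries.

Definition eqX N (P Q : {poly int}) := forall i, (i <= N)%N -> P`_i = Q`_i.

Lemma eqX_sym N P Q : eqX N P Q -> eqX N Q P.
Proof. by move=> h i iN; rewrite h. Qed.

Lemma eqX_trans N P Q S : eqX N P Q -> eqX N Q S -> eqX N P S.
Proof. by move=> h h' i iN; rewrite h ?h'. Qed.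

Lemma eqX_mul N P P' Q Q' : eqX N P P' -> eqX N Q Q' -> eqX N (P * Q) (P' * Q').
Proof.
move=> h h' i iN; rewrite !coefM; apply: eq_bigr => j _.
have := ltn_ord j; rewrite ltnS => ji.
by rewrite h ?h' //; [exact: leq_trans (leq_subr _ _) iN|exact: leq_trans iN].
Qed.

Lemma eqX_poly N (f : fps) (P : {poly int}) : (forall i, (i <= N)%N -> f i = P`_i) ->
  eqX N (\poly_(i < N.+1) f i) P.
Proof. by move=> h i iN; rewrite coef_poly ltnS iN h. Qed.

(** The geometric series telescopes: with P the truncation of f, the product is 1 - (1 - P)^(N+1),
    and 1 - P is divisible by X. *)
Lemma fps_invP (f : fps) N (F : {poly int}) : f 0%N = 1 -> (forall i, (i <= N)%N -> f i = F`_i) ->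
  eqX N (F * \sum_(j < N.+1) (1 - \poly_(i < N.+1) f i) ^+ j) 1.
Proof.
move=> f0 fF; set P := \poly_(i < _) _; set S := \sum_(j < _) _.
apply: (@eqX_trans _ _ (P * S)).
  by apply: eqX_mul => //; apply/eqX_sym/eqX_poly.
have -> : P * S = 1 - (1 - P) ^+ N.+1.
  have := subrXX 1 (1 - P) N.+1; rewrite expr1n subKr => ->.
  by congr (_ * _); apply: eq_bigr => i _; rewrite expr1n mul1r.
have [Q ->] : exists Q, 1 - P = Q * 'X.
  have /factor_theorem[Q] : root (1 - P) 0.
    by rewrite rootE hornerD hornerN hornerC horner_coef0 coef_poly f0 subrr.
  by rewrite subr0 => ->; exists Q.
by move=> i iN; rewrite exprMn coefB coefMXn ltnS iN subr0.
Qed.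

Lemma fps_invE (f : fps) N (F G : {poly int}) :
  f 0%N = 1 -> (forall i, (i <= N)%N -> f i = F`_i) ->
  eqX N (F * G) 1 -> fps_inv f N = G`_N.
Proof.
move=> f0 fF FG; rewrite /fps_inv; set S := \sum_(j < _) _.
rewrite -[S]mulr1 -[G]mul1r.
have FS := fps_invP f0 fF.
rewrite (eqX_mul (fun i _ => erefl S`_i) (eqX_sym FG) (leqnn N)).
by rewrite mulrA [S * F]mulrC (eqX_mul FS (fun i _ => erefl G`_i) (leqnn N)).
Qed.

Lemma eq_fps_inv (f g : fps) N :
  (forall i, (i <= N)%N -> f i = g i) -> fps_inv f N = fps_inv g N.
Proof.
move=> fg; rewrite /fps_inv (_ : \poly_(i < N.+1) f i = \poly_(i < N.+1) g i) //.
by apply/polyP => i; rewrite !coef_poly ltnS; case: leqP => // /fg.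
Qed.

Lemma fps_inv_one N : fps_inv (fun m => (1 : {poly int})`_m) N = (N == 0%N)%:R.
Proof.
rewrite (@fps_invE _ N 1 1) ?coef1 // mulr1; by [].
Qed.

(** The identity 1/(F (1 - X^l)) = 1/F + X^l / (F (1 - X^l)): the numerical counterpart of a kernel
    and an image of weight lowered by l. *)
Lemma fps_inv_mul1subXn (F : {poly int}) l N : F`_0 = 1 -> (0 < l)%N ->
  fps_inv (fun m => (F * (1 - 'X^l))`_m) N =
  fps_inv (fun m => F`_m) N +
  (if (l <= N)%N then fps_inv (fun m => (F * (1 - 'X^l))`_m) (N - l)%N else 0).
Proof.
move=> F0 l0; set f' := fun m => (F * (1 - 'X^l))`_m.
have f'0 : f' 0%N = 1.
  by rewrite /f' mulrBr mulr1 coefB coefMXn l0 subr0.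
pose G := \poly_(i < N.+1) fps_inv f' i.
have GE : eqX N (F * (1 - 'X^l) * G) 1.
  have := @fps_invP f' N _ f'0 (fun i _ => erefl).
  set S := \sum_(j < _) _ => FS; apply: eqX_trans FS.
  apply: eqX_mul => // i iN; rewrite coef_poly ltnS iN.
  apply: (@fps_invE _ _ (F * (1 - 'X^l))) => // j ji.
  by apply: fps_invP => //; apply: leq_trans iN.
rewrite -mulrA in GE; rewrite (@fps_invE (fun m => F`_m) N F _ F0 _ GE) //.
rewrite mulrBl mul1r coefB coefXnM !coef_poly ltnSn ltnS leq_subr.
by case: (leqP l N) => lN; rewrite ?subrK // subr0 addr0.
Qed.

Definition qpochp (k : nat) : {poly int} := \prod_(1 <= i < k.+1) (1 - 'X^i).

Lemma qpochpS k : qpochp k.+1 = qpochp k * (1 - 'X^(k.+1)).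
Proof. by rewrite /qpochp big_nat_recr. Qed.

Lemma qpochp0 k : (qpochp k)`_0 = 1.
Proof.
elim: k => [|k IH]; first by rewrite /qpochp big_geq // coef1.
by rewrite qpochpS coef0M IH coefB coef1 coefXn subr0 mul1r.
Qed.

Lemma qpochp_stable k m : (m <= k)%N -> eqX m (qpochp k) (qpochp m).
Proof.
elim: k => [|k IH]; first by rewrite leqn0 => /eqP ->.
rewrite leq_eqVlt => /predU1P[->//|mk] i im; rewrite qpochpS mulrBr mulr1 coefB.
by rewrite coefMXn ifT ?subr0 ?IH //; apply: leq_ltn_trans im mk.
Qed.

Definition qprod n (k : 'I_n -> nat) : {poly int} := \prod_i qpochp (k i).

Lemma qprod0 n (k : 'I_n -> nat) : (qprod k)`_0 = 1.
Proof.
rewrite /qprod; elim/big_rec: _ => [|i P _ IH]; first by rewrite coef1.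
by rewrite coef0M qpochp0 IH mul1r.
Qed.

End PowerSeries.

Section BoundedDimension.
Context (K : fieldType) (n : nat) (M : polyalg K n).
Hypothesis charK : forall k, k.+1%:R != 0 :> K.

Definition boundedw (k : 'I_n -> nat) N (P : M) := bounded k P /\ wproj N P = P.

(* [tc i (k i)] maps the weight N part onto the weight N - k i part, and its
   kernel is the space with k i replaced by k i - 1. *)
Lemma bounded_dim (k : 'I_n -> nat) N : exists d,
  hasdim (boundedw k N) d /\ d%:Z = fps_inv (fun m => (qprod k)`_m) N.
Proof.
have [b] := ubnP (\sum_i k i); elim: b k N => // b IH k N kb.
have [/forallP k0|] := boolP [forall i, k i == 0%N].
  have -> : qprod k = 1.
    by rewrite /qprod big1 // => i _; rewrite (eqP (k0 i)) /qpochp big_geq.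
  rewrite fps_inv_one; have bc P : boundedw k N P -> exists a, P = a *: 1.
    by case=> hP _; apply: (bounded_const charK) hP => i; apply/eqP/k0.
  case: N bc => [|N] bc.
    have one0 : (1 : M) != 0 by exact: oner_neq0.
    exists 1%N; split=> //; exists (fun _ => 1); split=> [c|v].
      rewrite big_ord1 => /eqP; rewrite scaler_eq0 (negbTE one0) orbF => /eqP c0 i.
      by rewrite ord1.
    split=> [/bc[a ->]|[c ->]]; first by exists (fun _ => a); rewrite big_ord1.
    rewrite big_ord1; split; last by rewrite linearZ /= wproj1.
    move=> i [//|d] _; rewrite linearZ /= /tc tcoef1 scaler0 //.
  exists 0%N; split=> //; apply: hasdim0 => v; split=> [hv|->]; last first.
    by split; [exact: bounded0|rewrite linear0].
  have [a va] := bc _ hv; case: hv => _; rewrite va linearZ /= wproj1.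
  by rewrite scaler0.
move=> /forallPn[i ki]; pose k' j := (k j - (j == i))%N.
have kE : incr k' i = k.
  by apply/funext => j; rewrite /incr /k'; case: eqP => [->|_]; lia.
have {ki} ki : k i = (k' i).+1 by rewrite /k' eqxx; lia.
have k'b : (\sum_i k' i < b)%N.
  rewrite -ltnS (leq_trans _ kb) // ltnS (bigD1 i) //= [X in (_ < X)%N](bigD1 i) //=.
  rewrite ki addSn ltnS leq_add2l leq_sum // => j _; exact: leq_subr.
have qk : qprod k = qprod k' * (1 - 'X^(k i)).
  rewrite /qprod [LHS](bigD1 i) //= [in RHS](bigD1 i) //= ki qpochpS -!mulrA.
  congr (_ * _); rewrite mulrC; congr (_ * _); apply: eq_bigr => j /negbTE ji.
  by rewrite /k' ji subn0.
(* An inner induction on the weight: the image of [tc i (k i)] has the same bounds, hence the same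
   total bound, but its weight is lowered by k_i > 0. *)
have [m] := ubnP N; elim: m N => // m IHm N Nm.
have [d1 [hd1 ed1]] := IH k' N k'b.
have ker P : boundedw k N P /\ tc i (k i) P = 0 <-> boundedw k' N P.
  split=> [[[hP wP] tP]|[hP wP]].
    split=> // j d; rewrite /k'; have [->|ji] := eqVneq j i; last first.
      by rewrite subn0 => /hP.
    move=> kd; have [->//|dk] := eqVneq d (k i); apply: hP; lia.
  split; last by apply: hP; rewrite ki.
  by split=> // j d kd; apply: hP; apply: leq_ltn_trans kd; apply: leq_subr.
rewrite qk fps_inv_mul1subXn ?qprod0 ?ki // -ki -qk.
(* If N < k_i, an element of weight N has no coefficient at y^(k_i), so the kernel is the whole
   space. *)
case: leqP => kN; last first.
  exists d1; split; last by rewrite addr0.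
  apply: eq_hasdim hd1 => P; rewrite -ker; split=> [[]//|hP]; split=> //.
  by case: hP => _ <-; rewrite tc_wproj leqNgt kN.
have [|d2 [hd2 ed2]] := IHm (N - k i)%N; first by lia.
exists (d1 + d2)%N; split; last by rewrite PoszD ed1 ed2.
apply: (hasdim_exact (f := tc i (k i))) hd2.
- move=> a u v [hu wu] [hv wv]; split; first exact: boundedP.
  by rewrite linearP /= wu wv.
- move=> P [hP wP]; split; first exact: bounded_tcoef.
  by rewrite /= -[in RHS]wP tc_wproj kN.
- move=> P [hP wP]; have [Q hQ tQ] := tc_ontoP charK (erefl (k i)) hP.
  exists (wproj N Q); last by rewrite /= tc_wproj kN tQ.
  by split; [exact: bounded_wproj|rewrite wproj_id eqxx].
- by apply: eq_hasdim hd1 => P; rewrite -ker.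
Qed.

End BoundedDimension.

Lemma count_factors n (m : {cmonom mode n}) x : count_mem x (factors m) = m x.
Proof.
rewrite /factors count_flatten -map_comp.
rewrite (eq_map (g := fun y => (m y * (y == x))%N)) => [|y /=]; last first.
  by rewrite count_nseq mulnC.
rewrite sumnE big_map; have [xm|xm] := boolP (x \in finsupp m).
  rewrite (big_fsetD1 x) //= eqxx muln1 big1_fset ?addn0 // => y.
  by rewrite !inE => /andP[/negbTE -> _]; rewrite muln0.
have /eqP -> : m x == 0%N by rewrite cmE_eq0.
rewrite big1_fset // => y ym _; case: eqP => [yx|]; rewrite ?muln0 //.
by rewrite yx (negbTE xm) in ym.
Qed.

(** [factors] follows the enumeration of a finite support, so equality holds only up to order;
    [perm_tmode] shows that the order does not affect the modes. *)
Lemma factorsM n (m : {cmonom mode n}) x :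
  perm_eq (factors (mmul (ucm x) m)) (x :: factors m).
Proof.
apply/allP => y _; rewrite /= !count_factors cmM ucmE.
by rewrite eq_sym.
Qed.

Lemma factors1 n : factors (mone : {cmonom mode n}) = [::].
Proof. by rewrite /factors mdom1. Qed.

(** * Translations and vertex operators on M(1) *)

Section TriangularSums.
Context (K : fieldType) (V : lmodType K).
Implicit Types (f h : nat -> V).

(** Convolutions are written as sums over all indices below N with an indicator of the total degree,
    so that summations can be exchanged freely; here one index is eliminated. *)
Lemma sum_pick N D t h : (D < N)%N ->
  \sum_(d < N) (d + t == D)%N%:R *: h d = if (t <= D)%N then h (D - t)%N else 0.
Proof.
move=> DN; case: leqP => tD; last first.
  by rewrite big1 // => d _; case: eqP => [|_]; [lia|rewrite scale0r].
have dN : (D - t < N)%N by lia.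
rewrite (bigD1 (Ordinal dN)) //= subnK // eqxx scale1r big1 ?addr0 // => d.
rewrite -val_eqE /= => dD; rewrite (_ : (d + t == D)%N = false) ?scale0r //.
by apply/negbTE/eqP; move/eqP: dD; lia.
Qed.

Lemma sum_pick_shift N D t p h : (D < N)%N ->
  \sum_(d < N) (d + t == D)%N%:R *: (if (p < d)%N then h (d - p.+1)%N else 0) =
  \sum_(d < N) (d + (t + p.+1) == D)%N%:R *: h d.
Proof.
move=> DN; rewrite (sum_pick _ (fun d => if (p < d)%N then h (d - p.+1)%N else 0)) //.
rewrite sum_pick //; case: (leqP t D) => tD; last by rewrite ifF //; lia.
case: (ltnP p (D - t)%N) => pD; last by rewrite ifF //; lia.
by rewrite ifT ?subnDA //; lia.
Qed.

Lemma sum_conv N (u : nat -> nat -> K) h : (forall j, (N <= j)%N -> h j = 0) ->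
  \sum_(x < N) \sum_(y < N) u x y *: h (y + x)%N =
  \sum_(j < N) (\sum_(x < j.+1) u x (j - x)%N) *: h j.
Proof.
move=> h0; transitivity (\sum_(x < N) \sum_(j < N) if (x <= j)%N then u x (j - x)%N *: h j else 0).
  apply: eq_bigr => x _.
  transitivity (\sum_(y < N) \sum_(j < N) (y + x == j)%N%:R *: (u x y *: h j)).
    apply: eq_bigr => y _; have [yN|yN] := ltnP (y + x) N.
      rewrite (bigD1 (Ordinal yN)) //= eqxx scale1r big1 ?addr0 // => j.
      by rewrite -val_eqE /= eq_sym => /negbTE ->; rewrite scale0r.
    rewrite h0 // scaler0 big1 // => j _; have := ltn_ord j.
    by case: eqP => [|_ _]; [lia|rewrite scale0r].
  rewrite exchange_big; apply: eq_bigr => j _ /=.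
  by rewrite (sum_pick _ (fun y => u x y *: h j)).
rewrite exchange_big; apply: eq_bigr => j _ /=.
rewrite scaler_suml -(big_mkord xpredT (fun x => u x (j - x)%N *: h j)).
rewrite -(big_mkord xpredT (fun x => if (x <= j)%N then u x (j - x)%N *: h j else 0)).
have jN := ltn_ord j; rewrite (big_cat_nat (n := j.+1)) //=.
rewrite [X in _ + X]big1_seq ?addr0 => [|x]; last first.
  by rewrite mem_index_iota => /andP[_ /andP[xj _]]; rewrite leqNgt xj.
by apply: eq_big_nat => x /andP[_]; rewrite ltnS => ->.
Qed.

End TriangularSums.

Section Fields.
Context (K : fieldType) (n : nat) (M : polyalg K n).
Hypothesis charK : forall k, k.+1%:R != 0 :> K.
Local Notation mode := (mode n).
(** For e^a acting on charge b: [alpha] holds the coordinates of a, [gamma] its products with the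
    basis, [c0] is <a, b>, and [D i d] is the mode d >= 0 of beta_i on M(1) (x) e^b. *)
Variables (alpha gamma : 'I_n -> K) (c0 : int).
Variable D : 'I_n -> nat -> M -> M.
Hypothesis Dlin : forall i d, linear (D i d).
Hypothesis DC : forall i d j e P, D i d (D j e P) = D j e (D i d P).
Hypothesis Dtc : forall i d j e P, tc j e (D i d P) = D i d (tc j e P).
Implicit Types (P Q : M) (s : seq mode) (k : int) (N : nat).

HB.instance Definition _ i d :=
  GRing.isLinear.Build K M M _ (D i d) (Dlin i d).

Definition newtonz (c : 'I_n -> K) (z : int) : M :=
  if z is Posz p then newton M c p else 0.

Lemma tc_newtonz i (a : int) d z : alpha i = a%:~R ->
  tc i d (newtonz alpha z) = gbin K a d *: newtonz alpha (z - d%:Z).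
Proof.
move=> ai; case: z => p /=; last by rewrite linear0; case: d => [|d] /=; rewrite scaler0.
rewrite (tc_newton M charK _ _ ai); case: leqP => dp.
  by rewrite subzn.
have : p%:Z - d%:Z < 0 by lia.
by case: (p%:Z - d%:Z) => // q _; rewrite scaler0.
Qed.

(* The mode [k] of Y(h_1(-p_1-1) ... h_l(-p_l-1) e^a, x), up to the factors
   [e^a] and [eps], with all sums truncated at [N]. *)
Fixpoint tmode N s k Q : M :=
  if s is (i, p) :: s' then
    \sum_(d < N) 'C(p + d, p)%:R *: (gen M (i, (p + d)%N) * tmode N s' (k + d%:Z) Q)
    + \sum_(d < N) ((-1) ^+ p * 'C(p + d, p)%:R) *:
        tmode N s' (k - (p + d).+1%:Z) (D i d Q)
  else \sum_(d < N) newtonz alpha (d%:Z - k - 1 - c0) * tcoef gamma d Q.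

Lemma tmode_nilE N k Q : tmode N [::] k Q =
  \sum_(d < N) newtonz alpha (d%:Z - k - 1 - c0) * tcoef gamma d Q.
Proof. by []. Qed.

Lemma tmode_consE N i p s k Q : tmode N ((i, p) :: s) k Q =
  \sum_(d < N) 'C(p + d, p)%:R *: (gen M (i, (p + d)%N) * tmode N s (k + d%:Z) Q)
  + \sum_(d < N) ((-1) ^+ p * 'C(p + d, p)%:R) *:
      tmode N s (k - (p + d).+1%:Z) (D i d Q).
Proof. by []. Qed.

Lemma tmode_linear N s k : linear (tmode N s k).
Proof.
elim: s k => [|[i p] s IH] k a P Q /=.
  rewrite scaler_sumr -big_split /=; apply: eq_bigr => d _.
  by rewrite linearP mulrDr scalerAr.
rewrite scalerDr !scaler_sumr addrACA; congr (_ + _); rewrite -big_split;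
  apply: eq_bigr => d _ /=.
  by rewrite IH mulrDr scalerDr -scalerAr !scalerA mulrC.
by rewrite linearP IH /= scalerDr !scalerA mulrC.
Qed.
HB.instance Definition _ N s k :=
  GRing.isLinear.Build K M M _ (tmode N s k) (tmode_linear N s k).

(** In the normal ordered product the creation operators all stand on the left and the [D] all act
    first on Q, so it suffices that the members of each family commute among themselves. *)
Lemma tmode_swap N x y s k Q :
  tmode N (x :: y :: s) k Q = tmode N (y :: x :: s) k Q.
Proof.
have aux i p j q : tmode N ((i, p) :: (j, q) :: s) k Q =
  \sum_(d < N) \sum_(e < N) ('C(p + d, p)%:R * 'C(q + e, q)%:R) *:
    (gen M (i, (p + d)%N) * (gen M (j, (q + e)%N) * tmode N s (k + (d + e)%N%:Z) Q))
  + (\sum_(d < N) \sum_(e < N) ('C(p + d, p)%:R * ((-1) ^+ q * 'C(q + e, q)%:R)) *: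
    (gen M (i, (p + d)%N) * tmode N s (k + d%:Z - (q + e).+1%:Z) (D j e Q))
  + \sum_(d < N) \sum_(e < N) ('C(q + d, q)%:R * ((-1) ^+ p * 'C(p + e, p)%:R)) *:
    (gen M (j, (q + d)%N) * tmode N s (k + d%:Z - (p + e).+1%:Z) (D i e Q)))
  + \sum_(d < N) \sum_(e < N)
    (((-1) ^+ p * 'C(p + d, p)%:R) * ((-1) ^+ q * 'C(q + e, q)%:R)) *:
    tmode N s (k - ((p + d).+1 + (q + e).+1)%N%:Z) (D j e (D i d Q)).
  rewrite [X in _ = _ + (_ + X) + _]exchange_big /= addrA -[RHS]addrA.
  congr (_ + _); rewrite -big_split; apply: eq_bigr => d _ /=.
    rewrite mulrDr scalerDr !mulr_sumr !scaler_sumr; congr (_ + _); apply: eq_bigr => e _.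
      by rewrite -!scalerAr scalerA PoszD addrA.
    by rewrite -!scalerAr scalerA.
  rewrite scalerDr !scaler_sumr; congr (_ + _); apply: eq_bigr => e _.
    by rewrite scalerA mulrC addrAC.
  by rewrite scalerA PoszD opprD addrA.
case: x y => [i p] [j q]; rewrite !aux; congr (_ + _ + _).
- rewrite exchange_big; apply: eq_bigr => d _; apply: eq_bigr => e _.
  by rewrite mulrC mulrCA [(e + d)%N]addnC.
- by rewrite addrC.
- rewrite exchange_big; apply: eq_bigr => d _; apply: eq_bigr => e _.
  by rewrite mulrC [((p + _).+1 + _)%N]addnC DC.
Qed.

Lemma tmode_cons N x s s' k Q : (forall k' Q', tmode N s k' Q' = tmode N s' k' Q') ->
  tmode N (x :: s) k Q = tmode N (x :: s') k Q.
Proof.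
case: x => i p ss' /=.
by congr (_ + _); apply: eq_bigr => d _; rewrite ss'.
Qed.

Lemma tmode_rem N x s k Q : x \in s -> tmode N s k Q = tmode N (x :: rem x s) k Q.
Proof.
elim: s k Q => // y s IH k Q; rewrite in_cons.
rewrite (_ : rem x (y :: s) = if y == x then s else y :: rem x s) //.
case: (eqVneq x y) => [->|xy xs] //.
rewrite (@tmode_cons N y s (x :: rem x s)) => [|k' Q']; last exact: IH.
exact: tmode_swap.
Qed.

Lemma perm_tmode N s s' k Q : perm_eq s s' -> tmode N s k Q = tmode N s' k Q.
Proof.
elim: s s' k Q => [|x s IH] s' k Q ss'.
  by move: ss'; rewrite perm_sym => /perm_nilP ->.
have xs' : x \in s' by rewrite -(perm_mem ss') mem_head.
rewrite [RHS](tmode_rem _ _ _ xs'); apply: tmode_cons => k' Q'; apply: IH.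
by rewrite -(perm_cons x); apply: perm_trans ss' (perm_to_rem xs').
Qed.

Definition pmode N k Q : M -> M := pext M (fun m => tmode N (factors m) k Q).
HB.instance Definition _ N k Q := GRing.Linear.on (pmode N k Q).

Lemma pmodeU N k Q m : pmode N k Q (mono M m) = tmode N (factors m) k Q.
Proof. exact: pextU. Qed.

Lemma pmode1 N k Q : pmode N k Q 1 =
  \sum_(d < N) newtonz alpha (d%:Z - k - 1 - c0) * tcoef gamma d Q.
Proof. by rewrite -mono1 pmodeU factors1. Qed.

Lemma pmode_gen N k Q i p P : pmode N k Q (gen M (i, p) * P) =
  \sum_(d < N) 'C(p + d, p)%:R *: (gen M (i, (p + d)%N) * pmode N (k + d%:Z) Q P)
  + \sum_(d < N) ((-1) ^+ p * 'C(p + d, p)%:R) *: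
        pmode N (k - (p + d).+1%:Z) (D i d Q) P.
Proof.
elim/pol_ind: P => [|a P P' IH IH'|m].
- rewrite mulr0 linear0 !big1 ?addr0 // => d _; rewrite linear0 ?mulr0 ?scaler0 //.
- rewrite mulrDr -scalerAr linearP /= IH IH' scalerDr !scaler_sumr addrACA.
  congr (_ + _); rewrite -big_split; apply: eq_bigr => d _ /=.
    by rewrite linearP /= mulrDr scalerDr -scalerAr !scalerA mulrC.
  by rewrite linearP /= scalerDr !scalerA mulrC.
rewrite gen_mul !pmodeU (perm_tmode _ _ _ (factorsM _ _)) /=.
by congr (_ + _); apply: eq_bigr => d _; rewrite pmodeU.
Qed.

(** For t < N, the coefficient of y^t in a product of three series; below, the three degrees belong
    to the translation of u, a binomial factor and the translation of v. *)
Definition tri N t (f : nat -> nat -> nat -> M) : M :=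
  \sum_(j < N) \sum_(e < N) \sum_(d < N) (d + (j + e) == t)%N%:R *: f d j e.

Lemma eq_tri N t f g : (forall d j e, f d j e = g d j e) -> tri N t f = tri N t g.
Proof.
by move=> fg; apply: eq_bigr => j _; apply: eq_bigr => e _; apply: eq_bigr => d _; rewrite fg.
Qed.

Lemma tri_linear N t a f g :
  tri N t (fun d j e => a *: f d j e + g d j e) = a *: tri N t f + tri N t g.
Proof.
rewrite /tri scaler_sumr -big_split; apply: eq_bigr => j _ /=.
rewrite scaler_sumr -big_split; apply: eq_bigr => e _ /=.
rewrite scaler_sumr -big_split; apply: eq_bigr => d _ /=.
by rewrite scalerDr !scalerA mulrC.
Qed.

Lemma tri0 N t f : (forall d j e, (d + (j + e) = t)%N -> f d j e = 0) -> tri N t f = 0.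
Proof.
move=> f0; rewrite /tri big1 // => j _; rewrite big1 // => e _; rewrite big1 // => d _.
by case: eqP => [/f0->|_]; rewrite ?scaler0 ?scale0r.
Qed.

Lemma tri_scale N t a f : tri N t (fun d j e => a *: f d j e) = a *: tri N t f.
Proof.
rewrite -[RHS]addr0 -[X in _ + X](_ : tri N t (fun _ _ _ => 0) = 0); last first.
  exact: tri0.
by rewrite -tri_linear; apply: eq_tri => d j e; rewrite addr0.
Qed.

Lemma tri_add N t f g : tri N t (fun d j e => f d j e + g d j e) = tri N t f + tri N t g.
Proof.
by rewrite -[X in X + _]scale1r -tri_linear; apply: eq_tri => d j e; rewrite scale1r.
Qed.

Lemma tri_mul N t P f : tri N t (fun d j e => P * f d j e) = P * tri N t f.
Proof.
rewrite /tri mulr_sumr; apply: eq_bigr => j _; rewrite mulr_sumr.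
apply: eq_bigr => e _; rewrite mulr_sumr; apply: eq_bigr => d _.
by rewrite scalerAr.
Qed.

Lemma tri_sum N t m (F : 'I_m -> nat -> nat -> nat -> M) :
  tri N t (fun d j e => \sum_x F x d j e) = \sum_x tri N t (F x).
Proof.
rewrite /tri [RHS]exchange_big; apply: eq_bigr => j _ /=.
rewrite [RHS]exchange_big; apply: eq_bigr => e _ /=.
rewrite [RHS]exchange_big; apply: eq_bigr => d _ /=.
by rewrite scaler_sumr.
Qed.

Variables (i0 : 'I_n) (a0 : int).
Hypothesis alpha_i0 : alpha i0 = a0%:~R.

(* The coefficient form of
     G(x) Y(u, z) v = Y(G(x - z) u, z) G(x) v,
   where G(x) is the translation operator with coefficients [tc i0]. *)
Definition tterm N k Q P d j e : M :=
  gbin K (a0 - d%:Z) j *: pmode N (k + j%:Z) (tc i0 e Q) (tc i0 d P).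

(** The series \sum_m 'C(p + m, p) z^m y^(p+m+1) is the expansion of (1/y - z)^(-p-1); [gbin_sub]
    absorbs it into the power (1/y - z)^(a0 - d) of the other factor. *)
Lemma tri_tterm_shift N t k Q P p : (t < N)%N ->
  \sum_(x < N) 'C(p + x, p)%:R *:
    (if (p + x < t)%N then tri N (t - (p + x).+1)%N (tterm N (k + x%:Z) Q P) else 0) =
  tri N t (fun d j e => gbin K (a0 - d%:Z) j *:
    pmode N (k + j%:Z) (tc i0 e Q) (shift (tc i0 ^~ P) p d)).
Proof.
move=> tN; transitivity (\sum_(x < N) \sum_(e < N) \sum_(d < N) \sum_(y < N)
    ('C(p + x, p)%:R * gbin K (a0 - d%:Z) y) *:
    ((d + (y + x + e + p.+1) == t)%N%:R *:
      pmode N (k + (y + x)%N%:Z) (tc i0 e Q) (tc i0 d P))).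
  apply: eq_bigr => x _ /=.
  transitivity ('C(p + x, p)%:R *: \sum_(e < N) \sum_(d < N) \sum_(y < N)
    (d + (y + x + e + p.+1) == t)%N%:R *: tterm N (k + x%:Z) Q P d y e).
    congr (_ *: _); rewrite /tri exchange_big; case: ifP => px.
      apply: eq_bigr => e _; rewrite exchange_big; apply: eq_bigr => d _.
      apply: eq_bigr => y _; congr ((nat_of_bool _)%:R *: _).
      by apply/eqP/eqP; lia.
    rewrite big1 // => e _; rewrite big1 // => d _; rewrite big1 // => y _.
    by case: eqP => [|_]; [lia|rewrite scale0r].
  rewrite scaler_sumr; apply: eq_bigr => e _; rewrite scaler_sumr; apply: eq_bigr => d _.
  rewrite scaler_sumr; apply: eq_bigr => y _.
  rewrite /tterm !scalerA; congr (_ *: pmode _ _ _ _); first by ring.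
  by rewrite PoszD addrAC addrA.
rewrite /tri exchange_big [RHS]exchange_big; apply: eq_bigr => e _ /=.
rewrite exchange_big /=.
transitivity (\sum_(j < N) \sum_(d < N) (d + (j + e + p.+1) == t)%N%:R *:
    (gbin K (a0 - d%:Z - p.+1%:Z) j *: pmode N (k + j%:Z) (tc i0 e Q) (tc i0 d P))).
  rewrite [RHS]exchange_big; apply: eq_bigr => d _ /=.
  rewrite (sum_conv (fun x y => 'C(p + x, p)%:R * gbin K (a0 - d%:Z) y)
    (h := fun j => (d + (j + e + p.+1) == t)%N%:R *:
      pmode N (k + j%:Z) (tc i0 e Q) (tc i0 d P))) => [|j jN]; last first.
    by case: eqP => [|_]; [lia|rewrite scale0r].
  apply: eq_bigr => j _; rewrite gbin_sub !scalerA mulrC; congr (_ *: _).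
apply: eq_bigr => j _.
rewrite -(sum_pick_shift _ _ (fun d => gbin K (a0 - d%:Z - p.+1%:Z) j *:
  pmode N (k + j%:Z) (tc i0 e Q) (tc i0 d P))) //.
apply: eq_bigr => d _; congr (_ *: _); rewrite /shift; case: ltnP => pd.
  by congr (gbin K _ _ *: _); lia.
by rewrite linear0 scaler0.
Qed.

(** In (x - z)^(a0 - d) = x^(a0 - d) (1 - z y)^(a0 - d), with y = 1/x, the exponent a0 comes from
    the zero mode of G on e^a and - d from the degree d coefficient of the translation of P. The
    j-th binomial term carries z^j, which raises the mode by j. *)
Lemma tc_pmode N t k Q P : (t < N)%N ->
  tc i0 t (pmode N k Q P) = tri N t (tterm N k Q P).
Proof.
elim/gen_ind: P t k Q => [|a P P' IH IH'||[i p] P IH] t k Q tN.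
- rewrite !linear0 tri0 // => d j e _; by rewrite /tterm !linear0.
- rewrite !linearP /= IH // IH' // -tri_linear; apply: eq_tri => d j e.
  by rewrite /tterm !linearP.
- rewrite pmode1 raddf_sum /=.
  rewrite (eq_bigr (fun d : 'I_N => \sum_(j < N) \sum_(e < N) (e + j == t)%N%:R *:
    (gbin K a0 j *: (newtonz alpha (d%:Z - (k + j%:Z) - 1 - c0) * tcoef gamma d (tc i0 e Q)))));
    last first.
    move=> d _; rewrite tcM.
    transitivity (\sum_(j < N) if (j <= t)%N then
      tc i0 j (newtonz alpha (d%:Z - k - 1 - c0)) * tc i0 (t - j) (tcoef gamma d Q) else 0).
      rewrite -big_mkcond /= (big_ord_widen_cond N xpredT (fun j =>
        tc i0 j (newtonz alpha (d%:Z - k - 1 - c0)) * tc i0 (t - j) (tcoef gamma d Q))) //.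
    apply: eq_bigr => j _; rewrite (sum_pick _ (fun e => gbin K a0 j *:
      (newtonz alpha (d%:Z - (k + j%:Z) - 1 - c0) * tcoef gamma d (tc i0 e Q)))) //.
    case: ifP => // jt; rewrite (tc_newtonz _ _ alpha_i0) tcC -scalerAl.
    by congr (_ *: (newtonz _ _ * _)); ring.
  rewrite exchange_big; apply: eq_bigr => j _ /=.
  rewrite exchange_big; apply: eq_bigr => e _ /=.
  rewrite -scaler_sumr -scaler_sumr -pmode1.
  have N0 : (0 < N)%N by lia.
  rewrite [RHS](bigD1 (Ordinal N0)) //= [X in _ = _ + X]big1 => [|d].
    by rewrite addr0 /tterm /= add0n addnC subr0 [tc i0 0 1]tcoef1.
  rewrite -val_eqE /= /tterm => /negbTE d0.
  by rewrite [tc i0 d 1]tcoef1 d0 linear0 !scaler0.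
(* [tc i0] does not commute with the creation part of the field of beta_i; the correction terms must
   match those produced by the translation of [gen M (i, p)] inside u. *)
rewrite pmode_gen linearD /= !raddf_sum /=.
under eq_bigr => d _ do rewrite linearZ /= tc_gen IH // scalerBr.
under [X in _ + X = _]eq_bigr => d _ do rewrite linearZ /= IH //.
rewrite sumrB.
have -> : tri N t (tterm N k Q (gen M (i, p) * P)) =
  tri N t (fun d j e => \sum_(x < N) 'C(p + x, p)%:R *:
      (gen M (i, (p + x)%N) * tterm N (k + x%:Z) Q P d j e))
  + tri N t (fun d j e => \sum_(x < N) ((-1) ^+ p * 'C(p + x, p)%:R) *:
        tterm N (k - (p + x).+1%:Z) (D i x Q) P d j e)
  - (i == i0)%:R *: tri N t (fun d j e => gbin K (a0 - d%:Z) j *: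
      pmode N (k + j%:Z) (tc i0 e Q) (shift (tc i0 ^~ P) p d)).
  rewrite -scaleNr -tri_scale -!tri_add.
  apply: eq_tri => d j e; rewrite /tterm tc_gen linearB linearZ /= pmode_gen.
  rewrite scalerBr scalerDr !scaler_sumr scaleNr !scalerA.
  rewrite [gbin _ _ _ * _]mulrC; congr (_ + _ - _); apply: eq_bigr => x _.
    rewrite -scalerAr !scalerA mulrC.
    by congr (_ *: (_ * pmode _ _ _ _)); ring.
  rewrite !scalerA mulrC Dtc.
  by congr (_ *: pmode _ _ _ _); ring.
rewrite addrAC -addrA [_ + (_ - _)]addrA; congr (_ + _ - _).
- rewrite tri_sum; apply: eq_bigr => x _.
  rewrite tri_scale; congr (_ *: _).
  by rewrite tri_mul.
- rewrite tri_sum; apply: eq_bigr => x _.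
  by rewrite tri_scale.
rewrite -tri_tterm_shift // scaler_sumr; apply: eq_bigr => x _.
rewrite scalerA mulrC -scalerA; congr (_ *: (_ *: _)); rewrite /shift.
by case: ltnP => // px; rewrite IH //; lia.
Qed.

End Fields.

Lemma linear_fun0 (K : fieldType) (V W : lmodType K) (f : V -> W) :
  linear f -> f 0 = 0.
Proof. by move=> fl; rewrite -[0 in LHS]addr0 -[X in X + _](scaler0 _ (-1)) fl scaleN1r addNr. Qed.

Section Vanishing.
Context (K : fieldType) (n : nat) (M : polyalg K n).
Variables (alpha gamma : 'I_n -> K) (c0 : int) (D : 'I_n -> nat -> M -> M).
Hypothesis Dlin : forall i d, linear (D i d).
Hypothesis Dnil : forall i P, exists B, forall d, (B <= d)%N -> D i d P = 0.

(** Lower truncation of Y(u, z) v. That k0 is independent of N is what lets the truncated sums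
    stabilize. *)
Lemma tmode_eq0 s (Q : M) : exists k0 : nat, forall (k : int) N, k0%:Z <= k ->
  tmode alpha gamma c0 D N s k Q = 0.
Proof.
elim: s Q => [|[i p] s IH] Q.
  have [B HB] := tcoef_bound gamma Q; exists (B + `|c0|)%N => k N kB /=.
  rewrite big1 // => d _; have [Bd|dB] := leqP B d; first by rewrite HB // mulr0.
  rewrite /newtonz; have : d%:Z - k - 1 - c0 < 0 by lia.
  by case: (d%:Z - k - 1 - c0) => // q _; rewrite mul0r.
have [k1 Hk1] := IH Q; have [B HB] := Dnil i Q.
have /choice[f Hf] := fun d => IH (D i d Q).
(* [k1] serves the creation terms. In the annihilation terms only d < B matter: (p + B) + 1 offsets
   the shift of the mode, and the maximum covers the bounds for the vectors [D i d Q]. *)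
exists (k1 + (p + B).+1 + \max_(d < B) f d)%N => k N kN /=.
rewrite !big1 ?addr0 // => d _; last first.
  by rewrite Hk1 ?mulr0 ?scaler0 //; lia.
have [Bd|dB] := leqP B d.
  by rewrite HB // (linear_fun0 (tmode_linear _ _ _ Dlin _ _ _)) scaler0.
have fB : (f d <= \max_(e < B) f e)%N.
  exact: (@leq_bigmax _ (fun e : 'I_B => f e) (Ordinal dB)).
by rewrite Hf ?scaler0 //; lia.
Qed.

End Vanishing.

(** * Exponentials of commuting operators *)

Section Exponentials.
Context (K : fieldType) (V : lmodType K).
Hypothesis charK : forall k, k.+1%:R != 0 :> K.
Variable a : nat -> V -> V.
Hypothesis alin : forall j, linear (a j).
Hypothesis aC : forall i j v, a i (a j v) = a j (a i v).

HB.instance Definition _ j := GRing.isLinear.Build K V V _ (a j) (alin j).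

Fixpoint powc (k p : nat) v : V :=
  if k is k'.+1 then \sum_(1 <= j < p.+1) a j (powc k' (p - j)%N v)
  else if p == 0%N then v else 0.

Lemma powcS k p v : powc k.+1 p v = \sum_(1 <= j < p.+1) a j (powc k (p - j)%N v).
Proof. by []. Qed.

Lemma powc0 p v : powc 0 p v = if p == 0%N then v else 0.
Proof. by []. Qed.

Arguments powc : simpl never.

Definition expc p v : V := \sum_(k < p.+1) (k`!%:R)^-1 *: powc k p v.

Lemma exchange_triangle p (F : nat -> nat -> V) :
  \sum_(1 <= j < p.+1) \sum_(1 <= i < (p - j).+1) F i j =
  \sum_(1 <= i < p.+1) \sum_(1 <= j < (p - i).+1) F i j.
Proof.
transitivity (\sum_(1 <= j < p.+1) \sum_(1 <= i < p.+1) if (i + j <= p)%N then F i j else 0).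
  apply: eq_big_nat => j /andP[j0 jp]; rewrite -big_mkcond /=.
  rewrite (big_nat_widen _ _ p.+1) ?ltnS ?leq_subr //=; apply: eq_bigl => i.
  by apply/idP/idP; lia.
rewrite exchange_big; apply: eq_big_nat => i /andP[i0 ip] /=; rewrite -big_mkcond /=.
rewrite [RHS](big_nat_widen _ _ p.+1) ?ltnS ?leq_subr //=; apply: eq_bigl => j.
by apply/idP/idP; lia.
Qed.

(** For A = \sum_j a_j x^j, the coefficient of x^p in x d/dx A^(k+1) = (k + 1) (x A') A^k, which
    needs the a_j to commute. *)
Lemma powc_newton k p v : p%:R *: powc k.+1 p v =
  k.+1%:R *: \sum_(1 <= j < p.+1) j%:R *: a j (powc k (p - j)%N v).
Proof.
elim: k p => [|k IH] p.
  rewrite scale1r powcS scaler_sumr; apply: eq_big_nat => j /andP[j0 jp].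
  rewrite powc0.
  case: eqP => [pj|_]; first by congr (_%:R *: _); lia.
  by rewrite !linear0.
rewrite powcS [LHS]scaler_sumr.
transitivity (\sum_(1 <= j < p.+1) (j%:R *: a j (powc k.+1 (p - j)%N v) +
    k.+1%:R *: \sum_(1 <= i < (p - j).+1) i%:R *: a i (a j (powc k (p - j - i)%N v)))).
  apply: eq_big_nat => j /andP[j0 jp].
  have -> : p%:R = j%:R + (p - j)%:R :> K by rewrite -natrD subnKC.
  rewrite scalerDl; congr (_ + _); rewrite -linearZ /= IH.
  rewrite linearZ raddf_sum; congr (_ *: _); apply: eq_bigr => i _.
  by rewrite /= linearZ /= aC.
rewrite big_split /= -scaler_sumr exchange_triangle -[k.+2]addn1 natrD addrC.
rewrite scalerDl scale1r; congr (_ *: _ + _); apply: eq_bigr => i _.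
rewrite -scaler_sumr; congr (_ *: _); rewrite powcS raddf_sum; apply: eq_bigr => j _.
by rewrite /= subnAC.
Qed.

Lemma powc_eq0 k p v : (p < k)%N -> powc k p v = 0.
Proof.
elim: k p => // k IH p pk; rewrite powcS big1_seq // => j /andP[_].
by rewrite mem_index_iota => /andP[j0 jp]; rewrite IH ?linear0 //; lia.
Qed.

Lemma expc0 v : expc 0 v = v.
Proof. by rewrite /expc big_ord1 /= powc0 fact0 invr1 scale1r. Qed.

(** The equation x d/dx exp(A) = (x A') exp(A). The sum defining [expc] may stop at k = p because A
    has no constant term. *)
Lemma expc_newton p v :
  p%:R *: expc p v = \sum_(1 <= j < p.+1) j%:R *: a j (expc (p - j)%N v).
Proof.
rewrite /expc big_ord_recl scalerDr /= !scaler_sumr.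
rewrite [X in X + _](_ : _ = 0) ?add0r; last first.
  by case: p => [|p]; rewrite ?scale0r // powc0 !scaler0.
transitivity (\sum_(i < p) \sum_(1 <= j < p.+1)
    j%:R *: a j ((i`!%:R)^-1 *: powc i (p - j)%N v)).
  apply: eq_bigr => i _; rewrite /bump /= add1n scalerA mulrC -scalerA.
  rewrite powc_newton scalerA factS natrM invfM.
  rewrite mulrAC mulVf // mul1r scaler_sumr; apply: eq_bigr => j _.
  by rewrite [a j (_ *: _)]linearZ /= !scalerA mulrC.
rewrite exchange_big; apply: eq_big_nat => j /andP[j0 jp] /=.
rewrite -scaler_sumr; congr (_ *: _); rewrite raddf_sum /=.
rewrite [RHS](big_ord_widen p (fun i => a j ((i`!%:R)^-1 *: powc i (p - j)%N v))); last by lia.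
rewrite [RHS]big_mkcond /=; apply: eq_bigr => i _.
by case: ltnP => // ip; rewrite powc_eq0 // scaler0 linear0.
Qed.

End Exponentials.

Opaque pder tcoef wproj newton ders.
Arguments tmode : simpl never.

(** * Vertex operators on the Fock space *)

Lemma fsbig_nat (V : zmodType) (F : nat -> V) N :
  (forall d, (N <= d)%N -> F d = 0) ->
  \sum_(d \in [set: nat]) F d = \sum_(d < N) F d.
Proof.
move=> F0; rewrite (fsbigE (iota 0 N)) ?iota_uniq //= => [|d _]; last first.
  by rewrite mem_iota add0n -leqNgt => /F0.
by rewrite -(big_mkord xpredT) /index_iota subn0; apply: eq_bigl => d; rewrite in_setT.
Qed.

Lemma mode_eqE (p d : nat) (c k : int) :
  (p%:R - d%:R + c%:~R = - k%:~R - 1 :> rat) <-> p%:Z = d%:Z - k - 1 - c.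
Proof.
have -> : p%:R - d%:R + c%:~R = (p%:Z - d%:Z + c)%:~R :> rat.
  by rewrite intrD intrB -!pmulrn.
have -> : - k%:~R - 1 = (- k - 1)%:~R :> rat by rewrite intrB intrN.
by split=> [/intr_inj|pE]; [lia|congr (_%:~R); lia].
Qed.

Lemma eventually_seq (T : eqType) (s : seq T) (Q : T -> nat -> Prop) :
  (forall x, x \in s -> exists N0, forall N, (N0 <= N)%N -> Q x N) ->
  exists N0, forall N, (N0 <= N)%N -> forall x, x \in s -> Q x N.
Proof.
elim: s => [|y s IH] H; first by exists 0%N.
have [|N1 H1] := IH; first by move=> x xs; apply: H; rewrite in_cons xs orbT.
have [N2 H2] := H y (mem_head _ _).
exists (maxn N1 N2) => N; rewrite geq_max => /andP[h1 h2] x.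
by rewrite in_cons => /predU1P[->|]; [exact: H2|exact: H1].
Qed.

Lemma pderC (K : fieldType) n (M : polyalg K n) x y (P : M) :
  pder x (pder y P) = pder y (pder x P).
Proof.
elim/gen_ind: P => [|a P P' IH IH'||z P IH]; first by rewrite !linear0.
- by rewrite !linearP /= IH IH'.
- by rewrite !pder1 !linear0.
have E u v : pder u (pder v (gen M z * P)) =
    (v == z)%:R *: pder u P + ((u == z)%:R *: pder v P + gen M z * pder u (pder v P)).
  by rewrite pder_gen linearD /= [pder u (_ *: _)]linearZ /= pder_gen.
rewrite !E IH; move: (_ *: _) (_ *: _) (_ * _) => A B C; exact: addrCA.
Qed.

Lemma dersC (K : fieldType) n (M : polyalg K n) c c' j j' (P : M) :
  ders c j (ders c' j' P) = ders c' j' (ders c j P).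
Proof.
have E e e' l l' : ders e l (ders e' l' P) = \sum_i \sum_i'
    ((l%:R * e i) * (l'%:R * e' i')) *: pder (i, l.-1) (pder (i', l'.-1) P).
  rewrite dersE; apply: eq_bigr => i _; rewrite [ders e' l' P]dersE.
  rewrite [pder _ (\sum_(_ <- _) _)]raddf_sum scaler_sumr; apply: eq_bigr => i' _ /=.
  by rewrite [pder _ (_ *: _)]linearZ /= scalerA.
rewrite [LHS]E [RHS]E [LHS]exchange_big.
apply: eq_bigr => i' _; apply: eq_bigr => i _ /=.
by rewrite pderC mulrC.
Qed.

Lemma tcoef_ders (K : fieldType) n (M : polyalg K n) c c' d j (P : M) :
  tcoef c d (ders c' j P) = ders c' j (tcoef c d P).
Proof.
rewrite !dersE raddf_sum; apply: eq_bigr => i _ /=.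
by rewrite linearZ /= tcoef_pder.
Qed.

Section FockModes.
Context (K : fieldType) (n : nat) (L : based_lattice n) (M : polyalg K n).
Hypothesis charK : forall k, k.+1%:R != 0 :> K.
Variable eps : dual_lattice L -> dual_lattice L -> K.
Local Notation fock := (fock K L).
Local Notation dual := (dual_lattice L).
Implicit Types (a b : dual) (P Q : M) (h : 'rV[K]_n) (m : {cmonom mode n}).

Definition emb b : M -> fock := pext M (fun m => fvec K m b).
HB.instance Definition _ b := GRing.Linear.on (emb b).

Lemma embU b m : emb b (mono M m) = fvec K m b.
Proof. exact: pextU. Qed.

Lemma linextU (f : {cmonom mode n} -> dual -> fock) m b :
  linext f (fvec K m b) = f m b.
Proof. exact: (lextU (fun x => f x.1 x.2) (m, b)). Qed.

Lemma linext_linear (f : {cmonom mode n} -> dual -> fock) : linear (linext f).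
Proof. exact: (lext_linear (fun x => f x.1 x.2)). Qed.

HB.instance Definition _ h j := GRing.isLinear.Build K fock fock _
  (@heis K n L h j) (linext_linear _).
HB.instance Definition _ a k := GRing.isLinear.Build K fock fock _
  (exp_mode eps a k) (linext_linear _).

Definition pairing h : 'I_n -> K := fun i => formF L h (delta_mx 0 i).

Definition hact h b (j : int) : M -> M :=
  match j with
  | Negz p => fun P => cgen M (h 0) p.+1 * P
  | Posz 0 => fun P => formF L h (dualK K b) *: P
  | Posz p.+1 => ders (pairing h) p.+1
  end.

Lemma hact_linear h b j : linear (hact h b j).
Proof.
case: j => [[|p]|p] a P Q /=.
- by rewrite scalerDr !scalerA mulrC.
- exact: linearP.
- by rewrite mulrDr scalerAr.
Qed.

Lemma heis_emb h j b P : heis h j (emb b P) = emb b (hact h b j P).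
Proof.
elim/pol_ind: P => [|c P Q IH IH'|m].
- by rewrite (linear_fun0 (@hact_linear h b j)) !linear0.
- by rewrite hact_linear !linearP /= IH IH'.
rewrite embU /heis linextU; case: j => [[|p]|p] /=.
- by rewrite linearZ /= embU.
- rewrite dersE raddf_sum; apply: eq_bigr => i _ /=.
  by rewrite linearZ /= pderU linearZ /= embU scalerA.
- rewrite /cgen mulr_suml raddf_sum; apply: eq_bigr => i _ /=.
  by rewrite -scalerAl gen_mul linearZ /= embU.
Qed.

Lemma expcoef_emb (A : nat -> fock -> fock) (al : nat -> M -> M) b p P :
  (forall j Q, (0 < j)%N -> A j (emb b Q) = emb b (al j Q)) ->
  expcoef A p (emb b P) = emb b (expc al p P).
Proof.
move=> AE; have pE k q : powcoef A k q (emb b P) = emb b (powc al k q P).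
  elim: k q => [|k IH] q; first by rewrite powc0 /=; case: ifP; rewrite ?linear0.
  rewrite powcS raddf_sum.
  rewrite (_ : powcoef A k.+1 q (emb b P) =
    \sum_(1 <= j < q.+1) A j (powcoef A k (q - j) (emb b P))) //.
  by apply: eq_big_nat => j /andP[j0 _]; rewrite IH AE.
rewrite /expcoef /expc raddf_sum; apply: eq_bigr => k _ /=.
by rewrite pE linearZ.
Qed.

(** Creation operators of a involve its coordinates, since the beta_i(-j) are the variables;
    annihilation operators are derivations and involve its products with the basis, whence
    [acoef]. *)
Definition ccoef a : 'I_n -> K := dualK K a 0.
Definition acoef a := pairing (dualK K a).

(** Both sides solve p u_p = \sum_j alpha(-j) u_(p-j) with u_0 = P. The annihilation exponential is
    identified with [tcoef] in the same way. *)
Lemma exp_creation_emb a p b P :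
  exp_creation a p (emb b P) = emb b (newton M (ccoef a) p * P).
Proof.
pose al j P := j%:R^-1 *: (cgen M (ccoef a) j * P) : M.
have al_lin j : linear (al j).
  by move=> c Q Q'; rewrite /al mulrDr scalerDr -scalerAr !scalerA mulrC.
have alC i j Q : al i (al j Q) = al j (al i Q).
  by rewrite /al -!scalerAr !scalerA mulrC mulrCA.
rewrite /exp_creation (@expcoef_emb _ al) => [|[//|j] Q _]; last first.
  rewrite -[- j.+1%:Z]/(Negz j) heis_emb /= /al linearZ; congr (_ *: emb b (_ * _)).
congr emb; have [q] := ubnP p; elim: q p => // q IH [|p] pq.
  by rewrite expc0 newton0 mul1r.
apply: (scalerI (charK p)); rewrite expc_newton // scalerAl newtonE // mulr_suml.
apply: eq_big_nat => j /andP[j0 jp]; rewrite IH; last by lia.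
case: j j0 jp => // j _ jp.
by rewrite /al scalerA divff // scale1r mulrA.
Qed.

Lemma exp_annihilation_emb a d b P :
  exp_annihilation a d (emb b P) = emb b (tcoef (acoef a) d P).
Proof.
pose al j P := (- j%:R^-1) *: ders (acoef a) j P : M.
have al_lin j : linear (al j).
  by move=> c Q Q'; rewrite /al linearP /= scalerDr !scalerA mulrC.
have alC i j Q : al i (al j Q) = al j (al i Q).
  by rewrite /al ![ders _ _ (_ *: _)]linearZ /= dersC !scalerA mulrC.
rewrite /exp_annihilation (@expcoef_emb _ al) => [|[//|j] Q _]; last first.
  by rewrite heis_emb /al scaleNr [emb b (- _)]linearN /= [emb b (_ *: _)]linearZ.
congr emb; have [q] := ubnP d; elim: q d => // q IH [|d] dq.
  by rewrite expc0 tcoef0.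
apply: (scalerI (charK d)); rewrite expc_newton // tcoef_newton -sumrN.
apply: eq_big_nat => j /andP[j0 jd]; rewrite IH; last by lia.
case: j j0 jd => // j _ jd.
by rewrite /al scalerA mulrN divff // scaleN1r tcoef_ders.
Qed.

Definition bmode b i d : M -> M := hact (delta_mx 0 i) b d%:Z.

Lemma bmode_linear b i d : linear (bmode b i d).
Proof. exact: hact_linear. Qed.

Lemma bmodeC b i d j e P : bmode b i d (bmode b j e P) = bmode b j e (bmode b i d P).
Proof.
case: d e => [|d] [|e]; rewrite /bmode /hact.
- by rewrite !scalerA mulrC.
- by rewrite linearZ.
- by rewrite linearZ.
- exact: dersC.
Qed.

Lemma bmode_tc b i d j e P : tc j e (bmode b i d P) = bmode b i d (tc j e P).
Proof.
by case: d => [|d]; rewrite /bmode /=; [rewrite linearZ|rewrite /tc tcoef_ders].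
Qed.

Lemma bmode_nil b i P : exists B, forall d, (B <= d)%N -> bmode b i d P = 0.
Proof.
have H x : exists B, forall q, (B <= q)%N -> pder (x, q) P = 0.
  elim/gen_ind: P => [|c P Q [B HB] [B' HB']||[y r] P [B HB]].
  - by exists 0%N => q _; rewrite linear0.
  - exists (maxn B B') => q; rewrite geq_max => /andP[h h'].
    by rewrite linearP /= HB // HB' // scaler0 addr0.
  - by exists 0%N => q _; rewrite pder1.
  exists (maxn B r.+1) => q; rewrite geq_max => /andP[h h'].
  rewrite pder_gen HB // mulr0 addr0 xpair_eqE [q == r](_ : _ = false).
    by rewrite andbF scale0r.
  by apply/negbTE; lia.
have [B HB] := @eventually_seq _ (enum 'I_n) (fun x q => pder (x, q) P = 0) (fun x _ => H x).
exists B.+1 => -[//|d] Bd; rewrite /bmode /= dersE big1 // => x _.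
by rewrite HB ?scaler0 // mem_enum.
Qed.

Local Notation tm a b c := (tmode (ccoef a) (acoef a) c (bmode b)).
Local Notation pm a b c := (pmode (ccoef a) (acoef a) c (bmode b)).

Lemma exp_mode_emb a b (c : int) k Q :
  formF L (val a) (val b) = c%:~R ->
  exists N0, forall N, (N0 <= N)%N ->
  exp_mode eps a k (emb b Q) = emb (a + b) (eps a b *: tm a b c N [::] k Q).
Proof.
move=> ab; elim/pol_ind: Q => [|x P Q [N1 H1] [N2 H2]|m].
- exists 0%N => N _; rewrite (linear_fun0 (tmode_linear _ _ _ (bmode_linear _) _ _ _)).
  by rewrite scaler0 !linear0.
- exists (maxn N1 N2) => N; rewrite geq_max => /andP[h1 h2].
  rewrite [emb b (_ + _)]linearP /= [exp_mode _ _ _ (_ + _)]linearP /= (H1 _ h1) (H2 _ h2).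
  rewrite (tmode_linear _ _ _ (bmode_linear _)) scalerDr scalerA mulrC -scalerA.
  by rewrite [RHS]linearP.
have [B HB] := tcoef_bound (acoef a) (mono M m); exists B => N BN.
rewrite embU /exp_mode linextU.
pose z d : int := d%:Z - k - 1 - c.
pose F (pd : nat * nat) := exp_creation a pd.1
  (exp_annihilation a pd.2 (Defs.etrans eps a (fvec K m b))).
have FE p d : F (p, d) = emb (a + b)
    (eps a b *: (newton M (ccoef a) p * tcoef (acoef a) d (mono M m))).
  rewrite /F /Defs.etrans linextU -embU -linearZ /= exp_annihilation_emb.
  by rewrite exp_creation_emb linearZ scalerAr.
(* The condition on (p, d) forces p = z d, which must be nonnegative; from d = B on, the
   annihilation factor vanishes. *)
transitivity (\sum_(d <- index_iota 0 N | 0 <= z d) F (`|z d|%N, d)).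
  rewrite (fsbigE [seq (`|z d|%N, d) | d <- index_iota 0 N & 0 <= z d]).
  - rewrite big_map big_filter_cond; apply: eq_bigl => d; rewrite andb_idr // => zd.
    by rewrite inE /= ab; apply/mode_eqE; rewrite gez0_abs.
  - by rewrite map_inj_uniq ?filter_uniq ?iota_uniq // => d d' [].
  - move=> [p d] /= /mapP[d']; rewrite mem_filter => /andP[zd _] [-> ->].
    by rewrite ab; apply/mode_eqE; rewrite gez0_abs.
  move=> [p d] /=; rewrite ab => /mode_eqE pdE pd; rewrite -/(F (p, d)) FE.
  rewrite HB ?mulr0 ?scaler0 ?linear0 //; rewrite leqNgt; apply/negP => dB.
  move/negP: pd; apply; apply/mapP; exists d; last by rewrite /z -pdE.
  rewrite mem_filter {1}/z -pdE /= mem_index_iota /=; exact: leq_trans dB BN.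
rewrite tmode_nilE scaler_sumr raddf_sum big_mkcond big_mkord; apply: eq_bigr => d _ /=.
rewrite -/(z d) /newtonz; case: (z d) => q /=; first by rewrite FE.
by rewrite mul0r scaler0 linear0.
Qed.

End FockModes.

Section VertexModes.
Context (K : fieldType) (n : nat) (L : based_lattice n) (M : polyalg K n).
Hypothesis charK : forall k, k.+1%:R != 0 :> K.
Variable eps : dual_lattice L -> dual_lattice L -> K.
Local Notation fock := (fock K L).
Local Notation dual := (dual_lattice L).
Local Notation emb := (@emb K n L M).
Implicit Types (a b : dual) (P Q : M) (h : 'rV[K]_n) (m : {cmonom mode n}).

Local Notation tm a b c := (tmode (ccoef K a) (acoef K a) c (@bmode K n L M b)).
Local Notation pm a b c := (pmode (ccoef K a) (acoef K a) c (@bmode K n L M b)).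

(** The sums over all d in [mon_mode] can be distributed over a sum of vectors only once their
    supports are known to be finite; hence a whole sum of charge components is treated at once, with
    one N for all charges. *)
Lemma mon_mode_emb a (s : seq (mode n)) (bs : seq dual) (c : dual -> int) k (Q : dual -> M) :
  (forall b, b \in bs -> formF L (val a) (val b) = (c b)%:~R) ->
  exists N0, forall N, (N0 <= N)%N ->
  mon_mode eps s a k (\sum_(b <- bs) emb b (Q b)) =
  \sum_(b <- bs) emb (a + b) (eps a b *: tm a b (c b) N s k (Q b)).
Proof.
move=> cE; elim: s k Q => [|[i p] s IH] k Q.
  have [N0 H0] := eventually_seq (fun b bb =>
    exp_mode_emb charK eps k (Q b) (cE b bb)).
  exists N0 => N N0N; rewrite [mon_mode _ _ _ _ _](_ : _ =
    exp_mode eps a k (\sum_(b <- bs) emb b (Q b))) // raddf_sum.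
  by rewrite !big_seq; apply: eq_bigr => b bb; apply: H0.
have [k0 Hk0] : exists k0 : nat, forall b, b \in bs -> forall (k' : int) N, k0%:Z <= k' ->
    tm a b (c b) N s k' (Q b) = 0.
  have [|k0 Hk0] := @eventually_seq _ bs (fun b k0 => forall (k' : int) N, k0%:Z <= k' ->
      tm a b (c b) N s k' (Q b) = 0); last first.
    by exists k0 => b bb k' N; apply: (Hk0 k0 (leqnn _) b bb k' N).
  move=> b _; have [k0 Hk0] := tmode_eq0 (ccoef K a) (acoef K a) (c b)
    (@bmode_linear K n L M b) (@bmode_nil K n L M b) s (Q b).
  by exists k0 => N k0N k' N' Nk'; apply: Hk0; apply: le_trans Nk'.
have [B2 HB2] := eventually_seq (fun b (_ : b \in bs) => bmode_nil b i (Q b)).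
(* For d >= [B1] the index k + d is at least k0, so the creation terms vanish; [B2] does the same
   for the annihilation terms. *)
pose B1 := (k0 + `|k|)%N.
have [N1 HN1] := eventually_seq (s := index_iota 0 B1) (fun d _ => IH (k + d%:Z) Q).
have [N2 HN2] := eventually_seq (s := index_iota 0 B2) (fun d _ =>
  IH (k - (p + d).+1%:Z) (fun b => bmode b i d (Q b))).
(* Below [B1] one threshold serves the finitely many d; beyond it both sides are 0. *)
have mm1 N d : (N1 <= N)%N -> mon_mode eps s a (k + d%:Z) (\sum_(b <- bs) emb b (Q b)) =
    \sum_(b <- bs) emb (a + b) (eps a b *: tm a b (c b) N s (k + d%:Z) (Q b)).
  move=> N1N; have [Bd|dB] := leqP B1 d; last by apply: HN1 => //; rewrite mem_index_iota.
  have [N' HN'] := IH (k + d%:Z) Q; rewrite (HN' N' (leqnn _)).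
  rewrite !big_seq; apply: eq_bigr => b bb.
  by rewrite !(Hk0 b bb) //; rewrite /B1 in Bd; lia.
have hE d : heis (delta_mx 0 i) d%:Z (\sum_(b <- bs) emb b (Q b)) =
    \sum_(b <- bs) emb b (bmode b i d (Q b)).
  by rewrite raddf_sum; apply: eq_bigr => b _ /=; rewrite heis_emb.
have mm2 N d : (N2 <= N)%N -> mon_mode eps s a (k - (p + d).+1%:Z)
      (heis (delta_mx 0 i) d%:Z (\sum_(b <- bs) emb b (Q b))) =
    \sum_(b <- bs) emb (a + b)
      (eps a b *: tm a b (c b) N s (k - (p + d).+1%:Z) (bmode b i d (Q b))).
  move=> N2N; rewrite hE; have [Bd|dB] := leqP B2 d; last first.
    by apply: HN2 => //; rewrite mem_index_iota.
  have [N' HN'] := IH (k - (p + d).+1%:Z) (fun b => bmode b i d (Q b)).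
  rewrite (HN' N' (leqnn _)) !big_seq; apply: eq_bigr => b bb.
  by rewrite HB2 // !(linear_fun0 (tmode_linear _ _ _ (@bmode_linear K n L M b) _ _ _)).
exists (maxn (maxn B1 B2) (maxn N1 N2)) => N.
rewrite !geq_max => /andP[/andP[B1N B2N] /andP[N1N N2N]].
transitivity (\sum_(d < N) 'C(p + d, p)%:R *:
        heis (delta_mx 0 i) (- (p + d).+1%:Z)
          (mon_mode eps s a (k + d%:Z) (\sum_(b <- bs) emb b (Q b)))
  + \sum_(d < N) ((-1) ^+ p * 'C(p + d, p)%:R) *:
        mon_mode eps s a (k - (p + d).+1%:Z)
          (heis (delta_mx 0 i) d%:Z (\sum_(b <- bs) emb b (Q b)))).
  congr (_ + _).
    apply: (@fsbig_nat fock (fun d => 'C(p + d, p)%:R *: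
        heis (delta_mx 0 i) (- (p + d).+1%:Z)
          (mon_mode eps s a (k + d%:Z) (\sum_(b <- bs) emb b (Q b))))) => d Nd.
    rewrite (mm1 N) // big_seq big1 ?linear0 ?scaler0 // => b bb.
    by rewrite (Hk0 b bb) ?scaler0 ?linear0 //; rewrite /B1 in B1N; lia.
  apply: (@fsbig_nat fock (fun d => ((-1) ^+ p * 'C(p + d, p)%:R) *:
        mon_mode eps s a (k - (p + d).+1%:Z)
          (heis (delta_mx 0 i) d%:Z (\sum_(b <- bs) emb b (Q b))))) => d Nd.
  rewrite (mm2 N) // big_seq big1 ?scaler0 // => b bb.
  rewrite HB2 //; last exact: leq_trans B2N Nd.
  by rewrite (linear_fun0 (tmode_linear _ _ _ (@bmode_linear K n L M b) _ _ _)) scaler0 linear0.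
transitivity (\sum_(b <- bs) emb (a + b) (eps a b *:
  (\sum_(d < N) 'C(p + d, p)%:R *: (gen M (i, (p + d)%N) * tm a b (c b) N s (k + d%:Z) (Q b))
  + \sum_(d < N) ((-1) ^+ p * 'C(p + d, p)%:R) *:
      tm a b (c b) N s (k - (p + d).+1%:Z) (bmode b i d (Q b))))); last first.
  by apply: eq_bigr => b _; rewrite tmode_consE.
under [RHS]eq_bigr => b _ do rewrite scalerDr !scaler_sumr [emb _ (_ + _)]raddfD /=.
rewrite [RHS]big_split; congr (_ + _).
  under [RHS]eq_bigr => b _ do rewrite [emb _ (\sum_(_ <- _) _)]raddf_sum /=.
  rewrite [RHS]exchange_big; apply: eq_bigr => d _.
  rewrite (mm1 N) // [heis _ _ (\sum_(_ <- _) _)]raddf_sum /= scaler_sumr.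
  apply: eq_bigr => b _.
  rewrite -[- (p + d).+1%:Z]/(Negz (p + d)) heis_emb -[LHS]linearZ.
  congr (emb _ _); rewrite /hact /cgen (bigD1 i) //= big1 ?addr0 => [|j ji].
    by rewrite mxE !eqxx scale1r -scalerAr scalerA mulrC -scalerA.
  by rewrite mxE (negbTE ji) andbF scale0r.
under [RHS]eq_bigr => b _ do rewrite [emb _ (\sum_(_ <- _) _)]raddf_sum /=.
rewrite [RHS]exchange_big; apply: eq_bigr => d _.
rewrite (mm2 N) // scaler_sumr; apply: eq_bigr => b _.
by rewrite -[LHS]linearZ; congr (emb _ _); rewrite !scalerA mulrC.
Qed.

Lemma vprod_linear k (v : fock) : linear (fun u => vprod eps u k v).
Proof. exact: linext_linear. Qed.

Lemma vprod_emb a P (bs : seq dual) (c : dual -> int) k (Q : dual -> M) :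
  (forall b, b \in bs -> formF L (val a) (val b) = (c b)%:~R) ->
  exists N0, forall N, (N0 <= N)%N ->
  vprod eps (emb a P) k (\sum_(b <- bs) emb b (Q b)) =
  \sum_(b <- bs) emb (a + b) (eps a b *: pm a b (c b) N k (Q b) P).
Proof.
move=> cE; set v := \sum_(b <- bs) _.
elim/pol_ind: P => [|x P P' [N1 H1] [N2 H2]|m].
- exists 0%N => N _; rewrite linear0 (linear_fun0 (vprod_linear k v)) big1 // => b _.
  by rewrite linear0 scaler0 linear0.
- exists (maxn N1 N2) => N; rewrite geq_max => /andP[h1 h2].
  rewrite [emb a (_ + _)]linearP /= (vprod_linear k v) (H1 _ h1) (H2 _ h2).
  rewrite scaler_sumr -big_split; apply: eq_bigr => b _ /=.
  rewrite [pm a b (c b) _ _ _ (_ + _)]linearP /= scalerDr scalerA mulrC -scalerA.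
  by rewrite [RHS]linearP.
have [N0 HN0] := mon_mode_emb (factors m) k Q cE; exists N0 => N N0N.
rewrite embU /vprod linextU (HN0 _ N0N); apply: eq_bigr => b _.
by rewrite pmodeU.
Qed.

End VertexModes.

(** * Charge components of the Fock space *)

Section Components.
Context (K : fieldType) (n : nat) (L : based_lattice n) (M : polyalg K n).
Local Notation fock := (fock K L).
Local Notation dual := (dual_lattice L).
Local Notation emb := (@emb K n L M).
Implicit Types (a b : dual) (P Q : M) (u v : fock).

Definition component b : fock -> M := lext (fun x => if x.2 == b then mono M x.1 else 0).
HB.instance Definition _ b := GRing.Linear.on (component b).

Lemma component_emb b b' P : component b (emb b' P) = if b' == b then P else 0.
Proof.
elim/pol_ind: P => [|c P Q IH IH'|m]; first by rewrite !linear0 if_same.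
  rewrite [emb _ (_ + _)]linearP /= [component _ (_ + _)]linearP /= IH IH'.
  by case: ifP; rewrite ?scaler0 ?addr0.
by rewrite embU /component /fvec lextU.
Qed.

(** Any duplicate-free list containing the support is allowed, so that several vectors can be
    expanded over a common list. *)
Lemma component_span v : exists bs : seq dual, forall bs', uniq bs' -> {subset bs <= bs'} ->
  v = \sum_(b <- bs') emb b (component b v).
Proof.
elim/malg_ind: v => [|c u v [bs1 H1] [bs2 H2]|[m b]].
- by exists [::] => bs' _ _; rewrite big1 // => b _; rewrite !linear0.
- exists (bs1 ++ bs2) => bs' ubs' sub; rewrite {1}(H1 bs') //; last first.
    by move=> b bb; apply: sub; rewrite mem_cat bb.
  rewrite {1}(H2 bs') //; last by move=> b bb; apply: sub; rewrite mem_cat bb orbT.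
  rewrite scaler_sumr -big_split; apply: eq_bigr => b _ /=.
  by rewrite [component b (_ + _)]linearP /= [RHS]linearP.
exists [:: b] => bs' ubs' sub; rewrite -[<< _ >>](@embU K n L M b m).
rewrite (bigD1_seq b) //=; last by apply: sub; rewrite mem_head.
rewrite component_emb eqxx big1 ?addr0 // => b' bb'.
by rewrite component_emb eq_sym (negbTE bb') linear0.
Qed.

Lemma emb_inj b : injective (emb b).
Proof. by move=> P Q /(congr1 (component b)); rewrite !component_emb eqxx. Qed.

Lemma charge_spaceP b v : charge_space b v <-> v = emb b (component b v).
Proof.
split=> [vb|->]; last first.
  move: (component b v) => P; elim/pol_ind: P => [|c P Q IH IH'|m] x.
  - by rewrite linear0 msupp0 inE.
  - rewrite [emb _ (_ + _)]linearP /= => /(fsubsetP (msuppD_le _ _)).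
    rewrite inE => /orP[/(fsubsetP (msuppZ_le _ _))|]; [exact: IH|exact: IH'].
  - by rewrite embU /fvec msuppU oner_eq0 inE => /eqP ->.
rewrite /component /lext raddf_sum [LHS]malg_span; apply: eq_big_seq => -[m b'] xv /=.
have /= b'b := vb _ xv; rewrite b'b eqxx [RHS]linearZ /=; congr (_ *: _).
by rewrite embU.
Qed.

Lemma fexpE b : fexp K b = emb b 1.
Proof. by rewrite -mono1 embU. Qed.

End Components.

(** * Modes of the vacuum, of the Heisenberg fields and of the conformal vector *)

Section Zero.
Context (K : fieldType) (n : nat) (L : based_lattice n) (M : polyalg K n).
Hypothesis charK : forall k, k.+1%:R != 0 :> K.
Variable eps : dual_lattice L -> dual_lattice L -> K.
Hypothesis eps0 : forall b, eps 0 b = 1.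
Local Notation fock := (fock K L).
Local Notation dual := (dual_lattice L).
Local Notation emb := (@emb K n L M).
Implicit Types (a b : dual) (P Q : M) (u v : fock) (k : int).
Local Notation pm b := (pmode (ccoef K (0 : dual)) (acoef K (0 : dual)) 0 (@bmode K n L M b)).

Lemma dualK0 : dualK K (0 : dual) = 0.
Proof. by apply/rowP => i; rewrite !mxE /ratr mul0r. Qed.

Lemma newton_ccoef0 p : newton M (ccoef K (0 : dual)) p = (p == 0%N)%:R.
Proof.
case: p => [|p] //; apply: (scalerI (charK p)); rewrite newtonE // scaler0.
rewrite big1 // => j _; rewrite /cgen big1 ?mul0r // => i _.
by rewrite /ccoef dualK0 mxE scale0r.
Qed.

Lemma tcoef_acoef0 d P : tcoef (acoef K (0 : dual)) d P = if d == 0%N then P else 0.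
Proof.
case: d => [|d]; first by rewrite tcoef0.
apply: (scalerI (charK d)); rewrite tcoef_newton scaler0 big1 ?oppr0 // => j _.
rewrite dersE big1 ?linear0 // => i _.
by rewrite /acoef /pairing dualK0 /formF !mul0mx mxE mulr0 scale0r.
Qed.

Lemma pmode_vac b N k Q : (0 < N)%N -> pm b N k Q 1 = (k == -1)%:R *: Q.
Proof.
move=> N0; rewrite pmode1 (bigD1 (Ordinal N0)) //= big1 ?addr0 => [|d].
  have zE z : z = - k - 1 ->
      newtonz M (ccoef K (0 : dual)) z = (k == -1)%:R.
    case: z => [p|p] pk; rewrite /newtonz ?newton_ccoef0.
      by congr ((nat_of_bool _)%:R); apply/eqP/eqP; lia.
    by rewrite (_ : (k == -1) = false) //; apply/negbTE; lia.
  rewrite tcoef_acoef0 zE; last by rewrite /=; lia.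
  by case: eqP; rewrite ?mul1r ?mul0r ?scale1r ?scale0r.
rewrite -val_eqE /= => /negbTE d0; by rewrite tcoef_acoef0 d0 mulr0.
Qed.

Lemma hact_delta b i p Q : hact (delta_mx 0 i) b (Negz p) Q = gen M (i, p) * Q.
Proof.
rewrite /hact /cgen (bigD1 i) //= big1 ?addr0 => [|j ji].
  by rewrite mxE !eqxx scale1r.
by rewrite mxE (negbTE ji) andbF scale0r.
Qed.

Lemma pmode_heis b N k Q i : (`|k| < N)%N ->
  pm b N k Q (gen M (i, 0%N)) = hact (delta_mx 0 i) b k Q.
Proof.
move=> kN; rewrite -[gen _ _]mulr1 (pmode_gen _ _ _ (@bmodeC K n L M b)).
have N0 : (0 < N)%N by lia.
under eq_bigr => d _ do rewrite add0n bin0 scale1r pmode_vac //.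
under [X in _ + X]eq_bigr => d _ do rewrite add0n bin0 expr0 mulr1 scale1r pmode_vac //.
have off (B : bool) P : ~~ B -> B%:R *: P = 0 by move/negbTE->; rewrite scale0r.
have on (B : bool) P : B -> B%:R *: P = P by move->; rewrite scale1r.
case: k kN => p pN.
  rewrite [X in X + _]big1 => [|d _]; last by rewrite off ?mulr0 //; apply/eqP; lia.
  rewrite add0r (bigD1 (Ordinal pN)) //= on; last by apply/eqP; lia.
  rewrite big1 ?addr0 // => d.
  by rewrite -val_eqE /= => dp; rewrite off //; apply/eqP; lia.
have {pN} pN : (p < N)%N by lia.
rewrite [X in _ + X]big1 => [|d _]; last by rewrite off //; apply/eqP; lia.
rewrite hact_delta addr0 (bigD1 (Ordinal pN)) //= on; last by apply/eqP; lia.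
rewrite big1 ?addr0 // => d.
by rewrite -val_eqE /= => dp; rewrite off ?mulr0 //; apply/eqP; lia.
Qed.

(** An effect of the truncation: the annihilation modes stop at N - 1. It removes the boundary term
    in the computation of L(0). *)
Lemma pmode_heis_ge b N (k : nat) Q i : (0 < N)%N -> (N <= k)%N ->
  pm b N k Q (gen M (i, 0%N)) = 0.
Proof.
move=> N0 Nk; rewrite -[gen _ _]mulr1 (pmode_gen _ _ _ (@bmodeC K n L M b)).
rewrite !big1 ?addr0 // => d _; rewrite pmode_vac //.
  by case: eqP => [|_]; [have := ltn_ord d; lia|rewrite scale0r scaler0].
by case: eqP => [|_]; [lia|rewrite scale0r mulr0 scaler0].
Qed.

Lemma vprod_emb0 b P k Q : exists N0, forall N, (N0 <= N)%N ->
  vprod eps (emb 0 P) k (emb b Q) = emb b (pm b N k Q P).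
Proof.
have [|N0 H0] := vprod_emb charK eps (a := 0) P (bs := [:: b]) (c := fun _ => 0)
  k (fun _ => Q).
  by move=> b' _; rewrite /formF !mul0mx mxE.
exists N0 => N N0N; have := H0 N N0N.
by rewrite !big_seq1 add0r eps0 scale1r.
Qed.

Lemma vprod_heis b i k Q :
  vprod eps (emb 0 (gen M (i, 0%N))) k (emb b Q) = emb b (hact (delta_mx 0 i) b k Q).
Proof.
have [N0 H0] := vprod_emb0 b (gen M (i, 0%N)) k Q.
by rewrite (H0 (maxn N0 `|k|.+1)) ?leq_maxl // pmode_heis // leq_max ltnSn orbT.
Qed.

(** The Euler operator of the weight grading, cut off at N. *)
Definition wder N Q : M :=
  \sum_i \sum_(d < N) d.+1%:R *: (gen M (i, d : nat) * pder (i, d : nat) Q).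

Lemma wder_mono m : exists N0, forall N, (N0 <= N)%N ->
  wder N (mono M m) = (wt m)%:R *: mono M m.
Proof.
elim/mon_ind: m => [|[i p] m [N0 H0]].
  exists 0%N => N _; rewrite wt1 scale0r /wder big1 // => i _; rewrite big1 // => d _.
  by rewrite mono1 pder1 mulr0 scaler0.
exists (maxn N0 p.+1) => N; rewrite geq_max => /andP[N0N pN].
rewrite wtM wtU natrD scalerDl -gen_mul.
transitivity (p.+1%:R *: (gen M (i, p) * mono M m) + gen M (i, p) * wder N (mono M m));
  last by rewrite (H0 _ N0N) -scalerAr.
rewrite /wder (bigD1 i) //= [in RHS](bigD1 i) //= mulrDr addrA; congr (_ + _); last first.
  rewrite mulr_sumr; apply: eq_bigr => j ji; rewrite mulr_sumr; apply: eq_bigr => d _.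
  by rewrite pder_gen xpair_eqE (negbTE ji) scale0r add0r -scalerAr mulrCA.
rewrite (bigD1 (Ordinal pN)) //= [in RHS](bigD1 (Ordinal pN)) //= mulrDr addrA.
congr (_ + _); last first.
  rewrite mulr_sumr; apply: eq_bigr => d; rewrite -val_eqE /= => dp.
  by rewrite pder_gen xpair_eqE (negbTE dp) andbF scale0r add0r -scalerAr mulrCA.
by rewrite pder_gen eqxx scale1r mulrDr scalerDr -[in RHS]scalerAr.
Qed.

Let A : 'M[K]_n := map_mx intr (gram L).
Hypothesis Aunit : A \in unitmx.

Lemma formF_delta i j : formF L (delta_mx 0 i : 'rV[K]_n) (delta_mx 0 j) = A i j.
Proof. by rewrite /formF -rowE trmx_delta -colE !mxE. Qed.

Lemma A_sym : A^T = A.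
Proof. by apply/matrixP => i j; rewrite !mxE lformC. Qed.

Lemma invA_l i j : \sum_l invmx A i l * A l j = (i == j)%:R.
Proof. by have := mulVmx Aunit; move/matrixP/(_ i j); rewrite !mxE. Qed.

Lemma invA_r i j : \sum_l invmx A l i * A l j = (i == j)%:R.
Proof.
have := mulmxV Aunit; move/matrixP/(_ j i); rewrite !mxE eq_sym => <-.
by apply: eq_bigr => l _; rewrite -[in A l j]A_sym mxE mulrC.
Qed.

(** The left side is the operator (beta^i)_d of the dual basis vector beta^i, which pairs only with
    beta_i. *)
Lemma ders_invA_l i d Q : (0 < d)%N ->
  \sum_j invmx A i j *: ders (pairing L (delta_mx 0 j)) d Q = d%:R *: pder (i, d.-1) Q.
Proof.
move=> d0; transitivity (\sum_l \sum_j (invmx A i j * A j l) *: (d%:R *: pder (l, d.-1) Q)).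
  rewrite exchange_big; apply: eq_bigr => j _; rewrite dersE scaler_sumr.
  apply: eq_bigr => l _; rewrite /pairing formF_delta !scalerA; congr (_ *: _); ring.
transitivity (\sum_l (i == l)%:R *: (d%:R *: pder (l, d.-1) Q)).
  by apply: eq_bigr => l _; rewrite -invA_l scaler_suml.
rewrite (bigD1 i) //= eqxx scale1r big1 => [|l li]; first by rewrite addr0.
by rewrite eq_sym (negbTE li) scale0r.
Qed.

Lemma ders_invA_r j d Q : (0 < d)%N ->
  \sum_i invmx A i j *: ders (pairing L (delta_mx 0 i)) d Q = d%:R *: pder (j, d.-1) Q.
Proof.
move=> d0; transitivity (\sum_l \sum_i (invmx A i j * A i l) *: (d%:R *: pder (l, d.-1) Q)).
  rewrite exchange_big; apply: eq_bigr => i _; rewrite dersE scaler_sumr.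
  apply: eq_bigr => l _; rewrite /pairing formF_delta !scalerA; congr (_ *: _); ring.
transitivity (\sum_l (j == l)%:R *: (d%:R *: pder (l, d.-1) Q)).
  by apply: eq_bigr => l _; rewrite -invA_r scaler_suml.
rewrite (bigD1 j) //= eqxx scale1r big1 => [|l li]; first by rewrite addr0.
by rewrite eq_sym (negbTE li) scale0r.
Qed.

Lemma form_invA (x : 'rV[K]_n) :
  \sum_i \sum_j invmx A i j * (formF L (delta_mx 0 j) x * formF L (delta_mx 0 i) x)
  = formF L x x.
Proof.
have E i : formF L (delta_mx 0 i) x = (A *m x^T) i 0.
  by rewrite /formF -mulmxA -rowE mxE.
transitivity (((A *m x^T)^T *m (invmx A *m (A *m x^T))) 0 0).
  rewrite [RHS]mxE; apply: eq_bigr => i _; rewrite [_^T _ _]mxE.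
  rewrite [(invmx A *m _) i 0]mxE mulr_sumr.
  by apply: eq_bigr => j _; rewrite !E; ring.
by rewrite mulKmx // trmx_mul trmxK A_sym.
Qed.

Lemma conformalE : conformal K L =
  emb 0 (2^-1 *: \sum_i \sum_j invmx A i j *: (gen M (i, 0%N) * gen M (j, 0%N))).
Proof.
rewrite /conformal linearZ /=; congr (_ *: _); rewrite raddf_sum; apply: eq_bigr => i _ /=.
rewrite raddf_sum; apply: eq_bigr => j _ /=; rewrite [RHS]linearZ /=; congr (_ *: _).
rewrite (_ : fvac K L = emb 0 1); last exact: fexpE.
by rewrite -[-1]/(Negz 0) !heis_emb !hact_delta mulr1.
Qed.

(** In L(0), the terms where the first factor creates and those where the second does both give the
    Euler operator, which cancels the factor 1/2; the zero modes give <b, b> / 2. *)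
Lemma pmode_conformal b m : exists N0, forall N, (N0 <= N)%N ->
  pm b N 1 (mono M m)
    (2^-1 *: \sum_i \sum_j invmx A i j *: (gen M (i, 0%N) * gen M (j, 0%N))) =
  ((wt m)%:R + formF L (dualK K b) (dualK K b) / 2) *: mono M m.
Proof.
set Q := mono M m; have two : 2 != 0 :> K by exact: charK 1%N.
have [N1 H1] := wder_mono m.
have [N2 H2] := @eventually_seq _ (enum 'I_n) _ (fun j _ => @bmode_nil K n L M b j Q).
exists (maxn N1.+2 N2.+2) => N; rewrite geq_max => /andP[N1N N2N].
case: N N1N N2N => // N N1N N2N.
have pmE i j : pm b N.+1 1 Q (gen M (i, 0%N) * gen M (j, 0%N)) =
  \sum_(d < N) gen M (i, d : nat) * ders (pairing L (delta_mx 0 j)) d.+1 Q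
  + ((formF L (delta_mx 0 j) (dualK K b) * formF L (delta_mx 0 i) (dualK K b)) *: Q
  + \sum_(d < N) gen M (j, d : nat) * ders (pairing L (delta_mx 0 i)) d.+1 Q).
  rewrite (pmode_gen _ _ _ (@bmodeC K n L M b)).
  congr (_ + _).
    rewrite big_ord_recr /= -[1 + N%:Z]/(N.+1%:Z) pmode_heis_ge // mulr0 scaler0 addr0.
    apply: eq_bigr => d _; rewrite add0n bin0 scale1r pmode_heis //.
    by have := ltn_ord d; lia.
  (* In mode 1, the index d = 0 of the second sum gives the product of the zero modes; the later
     indices create in direction j. *)
  rewrite big_ord_recl; congr (_ + _).
    rewrite add0n bin0 expr0 mulr1 scale1r (_ : 1 - _ = 0) // pmode_heis //.
    by rewrite /bmode /= scalerA.
  apply: eq_bigr => d _; rewrite add0n bin0 expr0 mulr1 scale1r.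
  have -> : 1 - (lift ord0 d).+1%:Z = Negz d by rewrite lift0; lia.
  by rewrite pmode_heis ?hact_delta //; have := ltn_ord d; lia.
rewrite linearZ raddf_sum /=.
transitivity (2^-1 *: ((\sum_i \sum_(d < N) gen M (i, d : nat) *
      \sum_j invmx A i j *: ders (pairing L (delta_mx 0 j)) d.+1 Q)
  + ((\sum_i \sum_j invmx A i j *
      (formF L (delta_mx 0 j) (dualK K b) * formF L (delta_mx 0 i) (dualK K b))) *: Q
  + \sum_j \sum_(d < N) gen M (j, d : nat) *
      \sum_i invmx A i j *: ders (pairing L (delta_mx 0 i)) d.+1 Q))).
  congr (_ *: _); rewrite scaler_suml [X in _ = _ + (_ + X)](eq_bigr (fun j =>
      \sum_i invmx A i j *: \sum_(d < N) gen M (j, d : nat) *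
        ders (pairing L (delta_mx 0 i)) d.+1 Q)) => [|j _]; last first.
    under [RHS]eq_bigr => i _ do rewrite scaler_sumr.
    rewrite [RHS]exchange_big; apply: eq_bigr => d _; rewrite mulr_sumr.
    by apply: eq_bigr => i _; rewrite scalerAr.
  rewrite [X in _ = _ + (_ + X)]exchange_big -!big_split; apply: eq_bigr => i _ /=.
  rewrite scaler_suml (eq_bigr (fun d : 'I_N => \sum_j invmx A i j *:
    (gen M (i, d : nat) * ders (pairing L (delta_mx 0 j)) d.+1 Q))) => [|d _]; last first.
    by rewrite mulr_sumr; apply: eq_bigr => j _; rewrite scalerAr.
  rewrite [X in _ = X + _]exchange_big -!big_split raddf_sum; apply: eq_bigr => j _ /=.
  by rewrite [LHS]linearZ /= pmE !scalerDr scalerA scaler_sumr.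
have wE : wder N Q = \sum_i \sum_(d < N) gen M (i, d : nat) * (d.+1%:R *: pder (i, d : nat) Q).
  by apply: eq_bigr => i _; apply: eq_bigr => d _; rewrite scalerAr.
rewrite [X in X + _](_ : _ = wder N Q); last first.
  rewrite wE; apply: eq_bigr => i _; apply: eq_bigr => d _.
  by rewrite ders_invA_l.
rewrite [X in _ + (_ + X)](_ : _ = wder N Q); last first.
  rewrite wE; apply: eq_bigr => i _; apply: eq_bigr => d _.
  by rewrite ders_invA_r.
rewrite form_invA H1; last by lia.
rewrite -!scalerDl scalerA; congr (_ *: _).
by field.
Qed.

Lemma L0_embU b m : L0 eps (emb b (mono M m)) =
  ((wt m)%:R + formF L (dualK K b) (dualK K b) / 2) *: emb b (mono M m).
Proof.
rewrite /L0 conformalE.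
have [N1 H1] := vprod_emb0 b
  (2^-1 *: \sum_i \sum_j invmx A i j *: (gen M (i, 0%N) * gen M (j, 0%N))) 1 (mono M m).
have [N2 H2] := pmode_conformal b m.
rewrite (H1 (maxn N1 N2) (leq_maxl _ _)) (H2 _ (leq_maxr _ _)).
by rewrite [LHS]linearZ.
Qed.

End Zero.

Lemma linear_fun_sum (K : fieldType) (V W : lmodType K) (f : V -> W) (I : Type)
  (r : seq I) (F : I -> V) :
  linear f -> f (\sum_(i <- r) F i) = \sum_(i <- r) f (F i).
Proof.
move=> fl; elim: r => [|i r IH]; first by rewrite !big_nil linear_fun0.
by rewrite !big_cons -IH; have := fl 1 (F i) (\sum_(j <- r) F j); rewrite !scale1r.
Qed.

(** * The upper bound *)

Section LatticeFacts.
Context (n : nat) (L : based_lattice n).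
Local Notation dual := (dual_lattice L).

Lemma lcoord_basis i : lcoord (lbasis L i) = delta_mx 0 i.
Proof.
rewrite -[RHS](lbasisK L); congr lcoord; rewrite (bigD1 i) //= big1 => [|j ji].
  by rewrite addr0 mxE !eqxx mulr1z.
by rewrite mxE (negbTE ji) andbF mulr0z.
Qed.

Lemma lcoordD (x y : L) : lcoord (x + y) = lcoord x + lcoord y.
Proof.
rewrite -[RHS](lbasisK L); congr lcoord.
rewrite -{1}(lcoordK x) -{1}(lcoordK y) -big_split; apply: eq_bigr => i _ /=.
by rewrite mxE mulrzDr.
Qed.

Lemma lcoordN (x : L) : lcoord (- x) = - lcoord x.
Proof.
rewrite -[RHS](lbasisK L); congr lcoord.
rewrite -{1}(lcoordK x) -sumrN; apply: eq_bigr => i _ /=.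
by rewrite mxE mulrNz.
Qed.

Lemma dual_eq (b : dual) (k : 'rV[int]_n) : val b = map_mx intr k ->
  exists2 x : L, lcoord x = k & b = to_dual x.
Proof.
move=> bk; exists (\sum_i lbasis L i *~ k 0 i); first exact: lbasisK.
by apply: val_inj; rewrite bk /= /coordF lbasisK.
Qed.

Lemma formFC (F : fieldType) (u v : 'rV[F]_n) : formF L u v = formF L v u.
Proof.
rewrite /formF; transitivity ((u *m map_mx intr (gram L) *m v^T)^T 0 0).
  by rewrite [RHS]mxE.
rewrite !trmx_mul trmxK mulmxA; congr ((_ *m _ *m _) 0 0).
by apply/matrixP => i j; rewrite !mxE lformC.
Qed.

Lemma form_int (x : L) (b : dual) : exists c : int,
  formF L (val (to_dual x)) (val b) = c%:~R.
Proof.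
have /asboolP/(_ x) := valP b; rewrite formFC => /intrP[c cE].
by exists c.
Qed.

End LatticeFacts.

Lemma intr_neq0 (F : fieldType) (z : int) :
  (forall k, k.+1%:R != 0 :> F) -> z != 0 -> z%:~R != 0 :> F.
Proof.
by move=> charF; case: z => [[|p]|p] // _; rewrite ?NegzE ?mulrNz ?oppr_eq0 -pmulrn charF.
Qed.

Lemma map_intr_inj n (F : fieldType) : (forall k, k.+1%:R != 0 :> F) ->
  injective (map_mx intr : 'rV[int]_n -> 'rV[F]_n).
Proof.
move=> charF k l /rowP kl; apply/rowP => i; move: (kl i); rewrite !mxE => /eqP.
rewrite -subr_eq0 -intrB; apply: contraTeq; rewrite -subr_eq0.
exact: intr_neq0.
Qed.

Section UpperBound.
Context (K : fieldType) (n : nat) (L : based_lattice n) (M : polyalg K n).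
Hypothesis charK : forall k, k.+1%:R != 0 :> K.
Variable eps : dual_lattice L -> dual_lattice L -> K.
Local Notation fock := (fock K L).
Local Notation dual := (dual_lattice L).
Local Notation emb := (@emb K n L M).
Local Notation component := (@component K n L M).
Implicit Types (a b l : dual) (P Q : M) (u v : fock).
Local Notation pm a b c := (pmode (ccoef K a) (acoef K a) c (@bmode K n L M b)).

Variables (r s : nat).
Definition unconstrained (i : 'I_n) := (r <= i < r + s)%N.

Definition charge_ok (k : 'rV[int]_n) : Prop :=
  (forall i : 'I_n, (i < r)%N -> 0 <= k 0 i) /\
  (forall i : 'I_n, (r + s <= i)%N -> k 0 i = 0).

Definition charge_bounded (k : 'rV[int]_n) P : Prop :=
  forall i d, ~~ unconstrained i -> (absz (k 0%R i) < d)%N -> tc i d P = 0.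

(** The alternative P = 0 keeps the condition linear at every charge, including those that do not
    occur in W(R,S;l). *)
Definition admissible l b P : Prop := P = 0 \/
  exists k : 'rV[int]_n, [/\ val b = val l + map_mx intr k, charge_ok k
    & charge_bounded k P].

(* W(R,S;l), characterized by the translations in the directions outside S. *)
Definition Wexpl l : set fock := [set v | forall b, admissible l b (component b v)].

Lemma charge_ok_ge0 k i : charge_ok k -> ~~ unconstrained i -> 0 <= k 0 i.
Proof.
case=> k1 k2; rewrite /unconstrained negb_and -ltnNge -leqNgt => /orP[/k1//|/k2 -> //].
Qed.

Lemma charge_unique l b (k k' : 'rV[int]_n) :
  val b = val l + map_mx intr k -> val b = val l + map_mx intr k' -> k = k'.
Proof.
by move=> -> /addrI/map_intr_inj; apply => q; rewrite pnatr_eq0.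
Qed.

Lemma admissibleP l b c P Q :
  admissible l b P -> admissible l b Q -> admissible l b (c *: P + Q).
Proof.
case=> [->|[k [bk ok hP]]]; first by rewrite scaler0 add0r.
case=> [->|[k' [bk' ok' hQ]]].
  right; exists k; split=> // i d fi kd; rewrite addr0 linearZ /= hP //.
  by rewrite scaler0.
right; exists k; split=> // i d fi kd; rewrite (charge_unique bk' bk) in hQ.
by rewrite linearP /= hP // hQ // scaler0 addr0.
Qed.

Lemma Wexpl_subspace l : is_subspace (Wexpl l).
Proof.
split=> [b|c u v hu hv b]; first by rewrite linear0; left.
by rewrite linearP; apply: admissibleP.
Qed.

Lemma Wexpl_emb l b P : admissible l b P -> Wexpl l (emb b P).
Proof. by move=> hP b'; rewrite component_emb; case: eqP => [<-//|_]; left. Qed.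

Lemma Wexpl_sum l (I : eqType) (bs : seq I) (F : I -> fock) :
  (forall i, i \in bs -> Wexpl l (F i)) -> Wexpl l (\sum_(i <- bs) F i).
Proof.
move=> hF; rewrite big_seq; have [W0 WP] := Wexpl_subspace l.
by elim/big_rec: _ => // i v bb hv; rewrite -[F i]scale1r; apply: WP => //; apply: hF.
Qed.

Lemma pmode_0 a b c N k P : pm a b c N k 0 P = 0.
Proof.
elim/pol_ind: P => [|x P Q IH IH'|m]; first by rewrite linear0.
  by rewrite linearP /= IH IH' scaler0 addr0.
by rewrite pmodeU (linear_fun0 (tmode_linear _ _ _ (@bmode_linear K n L M b) _ _ _)).
Qed.

(** A nonzero term has d <= p and e <= q; then (1 - t)^(p - d) is a polynomial, which forces j <= p
    - d and so d + j + e <= p + q. *)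
Lemma tc_pmode_eq0 a b c N t k i (p q : nat) P Q :
  ccoef K a i = p%:Z%:~R -> (t < N)%N -> (p + q < t)%N ->
  (forall d, (p < d)%N -> tc i d P = 0) -> (forall d, (q < d)%N -> tc i d Q = 0) ->
  tc i t (pm a b c N k Q P) = 0.
Proof.
move=> ap tN pqt hP hQ.
rewrite (tc_pmode charK (acoef K a) c (@bmodeC K n L M b)
  (@bmode_tc K n L M b) ap) //.
apply: tri0 => d j e djet; rewrite /tterm.
have [pd|dp] := ltnP p d; first by rewrite hP // linear0 scaler0.
have [qe|eq] := ltnP q e; first by rewrite hQ // pmode_0 scaler0.
rewrite (_ : p%:Z - d%:Z = (p - d)%N); last by lia.
by rewrite gbin_small ?scale0r //; lia.
Qed.

(** Charges add up, and so do the bounds, by [tc_pmode_eq0]. *)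
Lemma Wexpl_vprod l u v k : Wexpl 0 u -> Wexpl l v -> Wexpl l (vprod eps u k v).
Proof.
move=> hu hv; have [as' /(_ (undup as') (undup_uniq _))] := component_span M u.
move=> ->; last by move=> x; rewrite mem_undup.
have [bs' /(_ (undup bs') (undup_uniq _))] := component_span M v.
move=> vE; rewrite vE; last by move=> x; rewrite mem_undup.
set bs := undup bs'; rewrite -/bs in vE.
rewrite (linear_fun_sum _ _ (vprod_linear eps k _)).
apply: Wexpl_sum => a _; have := hu a; move: (component a u) => P.
case=> [->|[ka [aka oka hP]]].
  by rewrite linear0 (linear_fun0 (vprod_linear _ _ _)); case: (Wexpl_subspace l).
rewrite (_ : val 0 = 0) // add0r in aka.
have [x xk ax] := dual_eq aka.
have /choice[c cE] : forall b, exists c : int, formF L (val a) (val b) = c%:~R.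
  by move=> b; rewrite ax; apply: form_int.
have [N0 H0] := vprod_emb charK eps P (bs := bs) (c := c) k (component^~ v) (fun b _ => cE b).
move=> b0; set F := component b0 _.
(* As the left factor has the single charge a, the charge b0 is reached only from the component of v
   of charge b0 - a. *)
have FE N : (N0 <= N)%N -> F = if b0 - a \in bs then
    eps a (b0 - a) *: pm a (b0 - a) (c (b0 - a)) N k (component (b0 - a) v) P else 0.
  move=> N0N; rewrite /F (H0 N N0N) raddf_sum /=; case: ifP => bb.
    rewrite (bigD1_seq (b0 - a)) ?undup_uniq //= component_emb [a + (b0 - a)]addrC subrK eqxx.
    rewrite big1 ?addr0 // => b bb0; rewrite component_emb ifF //; apply/negbTE.
    by apply: contra bb0 => /eqP <-; rewrite [a + b]addrC addrK.
  rewrite big1_seq // => b /andP[_ bbs]; rewrite component_emb ifF //; apply/negbTE.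
  by apply/negP => /eqP ab; move: bb; rewrite -ab [a + b]addrC addrK bbs.
case: (boolP (b0 - a \in bs)) => bb; last first.
  by rewrite (FE N0 (leqnn _)) (negbTE bb); left.
case: (hv (b0 - a)) => [Q0|[kb [bkb okb hQ]]].
  by rewrite (FE N0 (leqnn _)) bb Q0 pmode_0 scaler0; left.
right; exists (ka + kb); split.
- rewrite map_mxD addrCA -bkb -aka -[in LHS](subrK a b0) addrC.
  by rewrite [LHS]raddfD.
- case: oka okb => [k1 k2] [k3 k4]; split=> i ir; rewrite mxE; first by rewrite addr_ge0 ?k1 ?k3.
  by rewrite k2 // k4 // addr0.
(* The truncation is taken beyond d, since [tc_pmode] holds in degrees below N. *)
move=> i d fi kd; rewrite (FE (maxn N0 d.+1)) ?leq_maxl // bb linearZ /=.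
have ka0 := charge_ok_ge0 oka fi; have kb0 := charge_ok_ge0 okb fi.
rewrite (@tc_pmode_eq0 a _ _ _ _ _ i (absz (ka 0 i)) (absz (kb 0 i))) ?scaler0 //.
- by rewrite /ccoef /dualK aka !mxE ratr_int gez0_abs.
- by rewrite leq_max ltnSn orbT.
- apply: leq_ltn_trans kd; rewrite mxE.
  by case: (ka 0 i) (kb 0 i) ka0 kb0 => [p|p] [q|q].
- by move=> e; apply: hP.
- by move=> e; apply: hQ.
Qed.

Let R0 := [set lbasis L i | i in [set i : 'I_n | (i < r)%N]]%classic.
Let S0 := [set lbasis L i | i in [set i : 'I_n | (r <= i < r + s)%N]]%classic.

Lemma tc1 i d : (0 < d)%N -> tc i d (1 : M) = 0.
Proof. by case: d => // d _; rewrite /tc tcoef1. Qed.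

Lemma admissible_to_dual (x : L) P : charge_ok (lcoord x) ->
  charge_bounded (lcoord x) P -> admissible 0 (to_dual x) P.
Proof. by move=> ok hP; right; exists (lcoord x); split=> //=; rewrite add0r. Qed.

Lemma charge_bounded1 k : charge_bounded k 1.
Proof. by move=> i d _ kd; rewrite tc1 //; lia. Qed.

Lemma coordF_basis i : coordF K (lbasis L i) = delta_mx 0 i.
Proof. by rewrite /coordF lcoord_basis; apply/rowP => j; rewrite !mxE; case: (_ && _). Qed.

Lemma heis_vac i : heis (coordF K (lbasis L i)) (-1) (fvac K L) = emb 0 (gen M (i, 0%N)).
Proof.
rewrite coordF_basis (_ : fvac K L = emb 0 1); last exact: fexpE.
by rewrite -[-1]/(Negz 0) heis_emb hact_delta mulr1.
Qed.

Lemma pcoef_component m b u : pcoef m (component b u) = u@_(m, b).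
Proof.
elim/malg_ind: u => [|c u v IH IH'|[m' b']]; first by rewrite !linear0 mcoeff0.
  by rewrite !linearP /= IH IH' mcoeffD mcoeffZ.
rewrite -[<< _ >>](@embU K n L M b' m') component_emb embU mcoeffU xpair_eqE.
by case: eqP => _; rewrite ?andbT ?andbF ?pcoefU ?linear0.
Qed.

Lemma charge_ok_basis (i : 'I_n) : (i < r + s)%N -> charge_ok (lcoord (lbasis L i)).
Proof.
move=> irs; rewrite lcoord_basis; split=> j jr; rewrite mxE.
  by rewrite ler0n.
by case: (j =P i) => [ji|_]; [move: jr irs; rewrite ji; lia|rewrite andbF].
Qed.

Lemma charge_ok_free c i : unconstrained i -> charge_ok (c *: lcoord (lbasis L i)).
Proof.
move=> /andP[ri irs]; rewrite lcoord_basis; split=> j jr; rewrite !mxE /=.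
  by rewrite (_ : (j == i) = false) ?mulr0 //; apply/negbTE/eqP => ji; move: jr ri; rewrite ji; lia.
by rewrite (_ : (j == i) = false) ?mulr0 //; apply/negbTE/eqP => ji; move: jr irs; rewrite ji; lia.
Qed.

Lemma Walg_sub : (Walg eps R0 S0 `<=` Wexpl 0)%classic.
Proof.
apply: smallest_sub; first split.
- exact: Wexpl_subspace.
- move=> u hu x xu; have := hu x.2; case=> [c0|[k [xk _ _]]].
    move: xu; rewrite -mcoeff_neq0 [x]surjective_pairing -pcoef_component c0 linear0.
    by rewrite eqxx.
  rewrite add0r in xk; have [y _ ->] := dual_eq xk; by exists y.
- rewrite (_ : fvac K L = emb 0 1); last exact: fexpE.
  apply: Wexpl_emb; right; exists 0; split; last exact: charge_bounded1.
    by rewrite add0r; apply/rowP => i; rewrite !mxE.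
  by split=> i _; rewrite mxE.
- by move=> u v k hu hv; apply: Wexpl_vprod.
have sub1 (x : L) : charge_ok (lcoord x) -> Wexpl 0 (fexp K (to_dual x)).
  move=> ok; rewrite (fexpE M); apply: Wexpl_emb; apply: admissible_to_dual => //.
  exact: charge_bounded1.
move=> u [[[|]|]|] [x [i ir <-] <-].
- by apply/sub1/charge_ok_basis; exact: leq_trans ir (leq_addr _ _).
- by apply/sub1/charge_ok_basis; case/andP: ir.
- by apply/sub1; rewrite lcoordN -scaleN1r; apply: charge_ok_free.
rewrite heis_vac; apply: Wexpl_emb; right; exists 0; split.
- by rewrite add0r; apply/rowP => j; rewrite !mxE.
- by split=> j _; rewrite mxE.
(* beta_i(-1) is moved only by the translation in direction i, and i belongs to S, where no bound is
   imposed. *)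
move=> j d fj; rewrite mxE => d0; rewrite -[gen _ _]mulr1 tc_gen /=.
rewrite (_ : (i == j) = false); last by apply/negbTE; apply: contra fj => /eqP <-.
by rewrite scale0r subr0 tc1 ?mulr0.
Qed.

Lemma Wmod_sub l : (Wmod eps R0 S0 l `<=` Wexpl l)%classic.
Proof.
apply: smallest_sub.
  split; first exact: Wexpl_subspace.
  by move=> w v k /Walg_sub hw hv; apply: Wexpl_vprod.
move=> _ ->; rewrite (fexpE M); apply: Wexpl_emb; right; exists 0; split.
- by rewrite -[LHS]addr0; congr (_ + _); apply/rowP => i; rewrite !mxE.
- by split=> i _; rewrite mxE.
- exact: charge_bounded1.
Qed.

End UpperBound.

(** * The lower bound *)

Section LowerBound.
Context (K : fieldType) (n : nat) (L : based_lattice n) (M : polyalg K n).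
Hypothesis charK : forall k, k.+1%:R != 0 :> K.
Variable eps : dual_lattice L -> dual_lattice L -> K.
Hypothesis eps_neq0 : forall a b, eps a b != 0.
Hypothesis eps0 : forall b, eps 0 b = 1.
Local Notation fock := (fock K L).
Local Notation dual := (dual_lattice L).
Local Notation emb := (@emb K n L M).
Implicit Types (a b : dual) (P Q : M) (i : 'I_n).

Variables (r s : nat) (l : dual) (W : set fock).
Let R0 := [set lbasis L i | i in [set i : 'I_n | (i < r)%N]]%classic.
Let S0 := [set lbasis L i | i in [set i : 'I_n | (r <= i < r + s)%N]]%classic.
(** [W] is any of the submodules whose intersection is [Wmod]; each is shown to contain [Wexpl]. *)
Hypothesis subW : is_submodule eps (Walg eps R0 S0) W.
Hypothesis Wl : W (fexp K l).

Lemma W_lin b c P Q : W (emb b P) -> W (emb b Q) -> W (emb b (c *: P + Q)).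
Proof. by case: subW => -[_ WP] _ hP hQ; rewrite [emb _ _]linearP; apply: WP. Qed.

Lemma W_0 b : W (emb b 0).
Proof. by rewrite linear0; case: subW => -[]. Qed.

Lemma W_scale b c P : W (emb b P) -> W (emb b (c *: P)).
Proof. by move=> hP; rewrite -[_ *: _]addr0; apply: W_lin => //; apply: W_0. Qed.

Lemma W_add b P Q : W (emb b P) -> W (emb b Q) -> W (emb b (P + Q)).
Proof. by move=> hP hQ; rewrite -[P]scale1r; apply: W_lin. Qed.

Lemma W_sum b (I : eqType) (t : seq I) (A : pred I) (F : I -> M) :
  (forall j, j \in t -> A j -> W (emb b (F j))) -> W (emb b (\sum_(j <- t | A j) F j)).
Proof.
move=> hF; rewrite big_seq_cond; elim/big_rec: _ => [|j P /andP[jt Aj] hP].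
  exact: W_0.
by apply: W_add => //; apply: hF.
Qed.

Lemma W_gen b i p P : unconstrained r s i -> W (emb b P) -> W (emb b (gen M (i, p) * P)).
Proof.
move=> fi hP; rewrite -(hact_delta b) -(vprod_heis charK eps0) -heis_vac.
case: subW => _; apply => //; apply: sub_gen_smallest; right.
by exists (lbasis L i) => //; exists i.
Qed.

Lemma W_hsym b i q P : unconstrained r s i -> W (emb b P) -> W (emb b (hsym M i q * P)).
Proof.
move=> fi hP; have [m] := ubnP q; elim: m q => // m IH [|q] qm.
  by rewrite /hsym newton0 mul1r.
rewrite -[hsym _ _ _]scale1r -(mulVf (charK q)) -scalerA /hsym newtonE //.
rewrite -scalerAl mulr_suml; apply: W_scale.
apply: W_sum => j; rewrite mem_index_iota => /andP[j0 jq] _.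
rewrite -mulrA /cgen mulr_suml (bigD1 i) //= big1 ?addr0 => [|x xi]; last first.
  by rewrite /delta (negbTE xi) scale0r mul0r.
rewrite /delta eqxx scale1r; apply: W_gen => //; apply: IH.
by move: j0 jq qm; lia.
Qed.

(** With c = <x, b>, the mode - q - 1 - c pairs the creation degree q + d with the annihilation
    degree d. The cocycle enters as a nonzero scalar, which is divided out. *)
Lemma W_exp x b q P : Walg eps R0 S0 (fexp K (to_dual x)) -> W (emb b P) ->
  exists N0, forall N, (N0 <= N)%N -> W (emb (to_dual x + b)
    (\sum_(d < N) newton M (ccoef K (to_dual x)) (q + d) * tcoef (acoef K (to_dual x)) d P)).
Proof.
move=> hx hP; have [c cE] := form_int x b.
have [|N0 H0] := vprod_emb charK eps (a := to_dual x) (1 : M) (bs := [:: b])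
  (c := fun=> c) (- q%:Z - 1 - c) (fun=> P).
  by move=> b'; rewrite inE => /eqP ->.
exists N0 => N N0N; have := H0 N N0N; rewrite !big_seq1 -fexpE pmode1 => E.
rewrite -[X in emb _ X]scale1r -(mulVf (eps_neq0 (to_dual x) b)) -scalerA.
apply: W_scale; rewrite (_ : \sum_(d < N) _ = \sum_(d < N)
  newtonz M (ccoef K (to_dual x)) (d%:Z - (- q%:Z - 1 - c) - 1 - c) *
    tcoef (acoef K (to_dual x)) d P); last first.
  apply: eq_bigr => d _; congr (_ * _).
  by rewrite (_ : _ - _ - 1 - c = (q + d)%N); last by lia.
by rewrite -E; case: subW => _; apply.
Qed.

Lemma W_exp1 x b : Walg eps R0 S0 (fexp K (to_dual x)) -> W (emb b 1) ->
  W (emb (to_dual x + b) 1).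
Proof.
move=> hx h1; have [N0 H0] := W_exp 0 hx h1.
have := H0 N0.+1 (leqnSn _); rewrite big_ord_recl big1 ?addr0 => [|d _].
  by rewrite newton0 tcoef0 mul1r.
by rewrite tcoef1 mulr0.
Qed.

Lemma ccoef_basis i : ccoef K (to_dual (lbasis L i)) = delta K i.
Proof.
apply/funext => j; rewrite /ccoef /dualK mxE /= coordF_basis mxE eqxx /= /delta.
by rewrite ratr_nat.
Qed.

(* A mode of e^(beta_i) maps v = P (x) e^b to
   \sum_d h_(q + d) E_d(P) (x) e^(b + beta_i), where E_0 is the identity and E_d
   lowers the weight by d. *)
Lemma W_hsym_exp i b (k : 'I_n -> nat) : (i < r)%N ->
  (forall P, bounded k P -> W (emb b P)) ->
  forall q P, bounded k P -> W (emb (to_dual (lbasis L i) + b) (hsym M i q * P)).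
Proof.
move=> ir hb; have hi : Walg eps R0 S0 (fexp K (to_dual (lbasis L i))).
  apply: sub_gen_smallest; left; left; left.
  by exists (lbasis L i) => //; exists i.
(* Strong induction on the weight: beyond the leading term, the mode involves coefficients of a
   translate of P, which have lower weight and satisfy the same bound k. *)
have hom w : forall q P, wproj w P = P -> bounded k P ->
    W (emb (to_dual (lbasis L i) + b) (hsym M i q * P)).
  have [m] := ubnP w; elim: m w => // m IH w wm q P wP hP.
  have [N0 H0] := W_exp q hi (hb P hP).
  have := H0 N0.+1 (leqnSn _); rewrite big_ord_recl addn0 tcoef0 ccoef_basis.
  set T := \sum_(_ < _) _ => HT.
  rewrite -[hsym M i q * P](addrK T); apply: W_add; first exact: HT.
  rewrite -scaleN1r; apply: W_scale.
  apply: W_sum => d _ _; rewrite lift0.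
  have [dw|wd] := leqP d.+1 w; last first.
    by rewrite -wP tcoef_wproj leqNgt wd mulr0; apply: W_0.
  apply: (IH (w - d.+1)%N); first by lia.
    by rewrite -wP tcoef_wproj dw wproj_id eqxx.
  exact: bounded_tcoef.
move=> q P hP; have [B /(_ B (leqnn B)) PE] := wproj_sum P.
rewrite PE mulr_sumr; apply: W_sum => w _ _.
apply: (hom w); first by rewrite wproj_id eqxx.
exact: bounded_wproj.
Qed.

(** Each step applies e^(beta_i) or e^(-beta_i), i in S, after bringing one coordinate closer to 0;
    the walk starts at e^l. *)
Lemma W_free1 b (k : 'rV[int]_n) : val b = val l + map_mx intr k ->
  (forall i, ~~ unconstrained r s i -> k 0 i = 0) -> W (emb b 1).
Proof.
have [m] := ubnP (\sum_i absz (k 0%R i)); elim: m b k => // m IH b k km bk kf.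
have [/forallP k0|/forallPn[i ki]] := boolP [forall i, k 0 i == 0].
  rewrite (_ : b = l) -?fexpE //; apply: val_inj; rewrite bk -[RHS]addr0.
  by congr (_ + _); apply/rowP => i; rewrite !mxE (eqP (k0 i)).
have fi : unconstrained r s i by apply: contraT => /kf k0; rewrite k0 eqxx in ki.
have step (x : L) (e : int) : lcoord x = e *: delta_mx 0 i ->
    (absz (k 0%R i - e) < absz (k 0%R i))%N ->
    Walg eps R0 S0 (fexp K (to_dual x)) -> W (emb b 1).
  move=> xe ek hx; rewrite -(subrK (to_dual x) b) addrC; apply: W_exp1 => //.
  apply: (IH _ (k - e *: delta_mx 0 i)).
  - rewrite -ltnS (leq_trans _ km) // ltnS (bigD1 i) //= [X in (_ < X)%N](bigD1 i) //=.
    rewrite -addSn leq_add ?leq_sum // => [|j ji].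
      by rewrite !mxE !eqxx /= mulr1.
    by rewrite !mxE (negbTE ji) /= mulr0 subr0.
  - rewrite [LHS]raddfB /= bk -xe -addrA; congr (_ + _).
    by rewrite /coordF -map_mxB.
  - move=> j fj; rewrite !mxE kf // (_ : (j == i) = false) ?mulr0 ?subr0 //.
    by apply/negbTE; apply: contra fj => /eqP ->.
have [ki0|ki0] := ltP 0 (k 0 i).
  apply: (step (lbasis L i) 1); first by rewrite lcoord_basis scale1r.
    by lia.
  apply: sub_gen_smallest; left; left; right.
  by exists (lbasis L i) => //; exists i.
apply: (step (- lbasis L i) (-1)); first by rewrite lcoordN lcoord_basis scaleN1r.
  by move/eqP: ki; lia.
apply: sub_gen_smallest; left; right.
by exists (lbasis L i) => //; exists i.
Qed.

(** Induction on the total bound, down to constants, by [bounded_hspan]. For i in S, Heisenberg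
    modes supply the factor h_q at unchanged charge; for i in R it comes from a mode of e^(beta_i),
    so bound and charge drop together. Hence [kap] is the charge off S and free on S. *)
Lemma W_bounded b (k : 'rV[int]_n) (kap : 'I_n -> nat) P :
  val b = val l + map_mx intr k ->
  (forall i, ~~ unconstrained r s i -> k 0 i = kap i) ->
  (forall i, (r + s <= i)%N -> kap i = 0%N) ->
  bounded kap P -> W (emb b P).
Proof.
have [m] := ubnP (\sum_i kap i); elim: m b k kap P => // m IH b k kap P km bk kk kap0 hP.
have [/forallP k0|/forallPn[i ki]] := boolP [forall i, kap i == 0%N].
  have [|a ->] := @bounded_const _ _ _ charK kap P _ hP; first by move=> i; apply/eqP.
  apply: W_scale; apply: (W_free1 bk) => i fi; rewrite kk //.
  by rewrite (eqP (k0 i)).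
pose kap' j := (kap j - (j == i))%N.
have kE : incr kap' i = kap.
  by apply/funext => j; rewrite /incr /kap'; case: eqP => [->|_]; lia.
have k'm : (\sum_j kap' j < m)%N.
  rewrite -ltnS (leq_trans _ km) // ltnS (bigD1 i) //= [X in (_ < X)%N](bigD1 i) //=.
  rewrite -addSn leq_add //; first by rewrite /kap' eqxx; lia.
  by rewrite leq_sum // => j _; apply: leq_subr.
have k'0 (j : 'I_n) : (r + s <= j)%N -> kap' j = 0%N by move=> /kap0; rewrite /kap'; lia.
rewrite -kE in hP; have {hP} := bounded_hspan charK hP.
have [fi|fi] := boolP (unconstrained r s i).
  elim=> [|q Q P' hQ _ IHP]; first exact: W_0.
  apply: W_add => //; apply: W_hsym => //.
  apply: (IH b k kap') => // j fj; rewrite kk // /kap' (_ : (j == i) = false) ?subn0 //.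
  by apply/negbTE; apply: contra fj => /eqP ->.
have ir : (i < r)%N.
  move: fi; rewrite /unconstrained negb_and -ltnNge -leqNgt => /orP[//|/kap0 ki0].
  by rewrite ki0 in ki.
pose b' := b - to_dual (lbasis L i); have -> : b = to_dual (lbasis L i) + b'.
  by rewrite /b' addrC subrK.
elim=> [|q Q P' hQ _ IHP]; first exact: W_0.
apply: W_add => //; apply: (W_hsym_exp ir _ q hQ) => {hQ}Q hQ.
apply: (IH b' (k - delta_mx 0 i) kap') => //.
  rewrite /b' [LHS]raddfB /= bk -addrA; congr (_ + _).
  by rewrite /coordF lcoord_basis -map_mxB.
move=> j fj; rewrite !mxE kk // /kap' eqxx /=; case: (eqVneq j i) => [->|_].
  by move: ki; case: (kap i) => // p _; rewrite subn1 /= -addn1 PoszD addrK.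
by rewrite subn0 subr0.
Qed.

Lemma Wexpl_subW : (Wexpl M r s l `<=` W)%classic.
Proof.
move=> v hv; have [bs' /(_ (undup bs') (undup_uniq _))] := component_span M v.
move=> ->; last by move=> x; rewrite mem_undup.
have Wsum (t : seq dual) (F : dual -> fock) : (forall b, W (F b)) -> W (\sum_(b <- t) F b).
  case: subW => -[W0 WP] _ hF; elim/big_rec: _ => // b u _ hu.
  by rewrite -[F b]scale1r; apply: WP.
apply: Wsum => b; case: (hv b) => [->|[k [bk ok hP]]]; first exact: W_0.
move: (component M b v) hP => P hP.
(* Each translation of P has finite degree in y, which supplies a bound in the directions of S. *)
have /choice[B HB] : forall i, exists B, forall d, (B <= d)%N -> tc i d P = 0.
  by move=> i; apply: tcoef_bound.
apply: (W_bounded (k := k) (kap := fun i => if unconstrained r s i then B i else absz (k 0%R i)) bk).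
- by move=> i fi; rewrite (negbTE fi) gez0_abs ?(charge_ok_ge0 ok fi).
- move=> i ri; case: ok => _ /(_ i ri) ->; rewrite ifF // /unconstrained.
  by apply/negbTE; rewrite negb_and -leqNgt ri orbT.
move=> i d; case: ifP => fi kd; first by apply: HB; apply: ltnW.
by apply: hP => //; rewrite fi.
Qed.

End LowerBound.

(** * Weights and graded dimensions *)

Section Gram.
Context (n : nat) (L : based_lattice n).

Lemma lform_suml (x z : L) : lform x z = \sum_i lcoord x 0 i * lform (lbasis L i) z.
Proof.
have l0 : lform (0 : L) z = 0.
  by apply: (addrI (lform 0 z)); rewrite addr0 -lformDl addr0.
have lN (y : L) : lform (- y) z = - lform y z.
  by apply/eqP; rewrite -subr_eq0 opprK -lformDl addNr l0.
have lMn (y : L) p : lform (y *+ p) z = p%:Z * lform y z.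
  elim: p => [|p IH]; first by rewrite mulr0n l0 mul0r.
  by rewrite mulrS lformDl IH; ring.
rewrite -{1}(lcoordK x); elim: (index_enum _) => [|i t IH]; first by rewrite !big_nil.
rewrite !big_cons lformDl IH; congr (_ + _).
case: (lcoord x 0 i) => p; first exact: lMn.
by rewrite NegzE mulrNz lN lMn mulNr.
Qed.

(** A null vector with integer entries is a lattice element orthogonal to the basis, hence to all of
    L. *)
Lemma gram_det : lattice_nondegenerate L -> \det (gram L) != 0.
Proof.
move=> ndL; apply/negP => /det0P[v v0 vG].
pose x := \sum_i lbasis L i *~ v 0 i.
have xv : lcoord x = v by exact: lbasisK.
have x0 : x = 0.
  apply: ndL => y; rewrite lformC lform_suml big1 // => j _.
  rewrite lformC lform_suml xv; have := congr1 (fun A : 'rV[int]_n => A 0 j) vG.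
  rewrite !mxE => E; rewrite (eq_bigr (fun i => v 0 i * gram L i j)) ?E ?mulr0 // => i _.
  by rewrite mxE.
move/negP: v0; apply; rewrite -xv x0; apply/eqP.
by apply: (addrI (lcoord (0 : L))); rewrite -lcoordD !addr0.
Qed.

Lemma gram_unit (F : fieldType) : (forall k, k.+1%:R != 0 :> F) ->
  lattice_nondegenerate L -> map_mx intr (gram L) \in @unitmx F n.
Proof.
move=> charF /gram_det d0; rewrite unitmxE det_map_mx unitfE.
exact: intr_neq0.
Qed.

End Gram.

Section Weights.
Context (K : numFieldType) (n : nat) (L : based_lattice n) (M : polyalg K n).
Hypothesis ndL : lattice_nondegenerate L.
Variable eps : dual_lattice L -> dual_lattice L -> K.
Hypothesis eps0 : forall b, eps 0 b = 1.
Local Notation dual := (dual_lattice L).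
Local Notation emb := (@emb K n L M).
Implicit Types (b : dual) (P Q : M) (m : {cmonom mode n}).

Lemma charK (k : nat) : k.+1%:R != 0 :> K.
Proof. by rewrite pnatr_eq0. Qed.

Definition normsq2 b : rat := formF L (val b) (val b) / 2.

Lemma formF_dualK b : formF L (dualK K b) (dualK K b) = ratr (formF L (val b) (val b)).
Proof.
rewrite /formF /dualK map_trmx (_ : map_mx intr (gram L) =
  map_mx ratr (map_mx intr (gram L)) :> 'M[K]_n).
  by rewrite -!map_mxM mxE.
by apply/matrixP => i j; rewrite !mxE ratr_int.
Qed.

Definition weight_op b : M -> M :=
  pext M (fun m => ratr ((wt m)%:R + normsq2 b) *: mono M m).
HB.instance Definition _ b := GRing.Linear.on (weight_op b).

Lemma weight_opU b m : weight_op b (mono M m) = ratr ((wt m)%:R + normsq2 b) *: mono M m.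
Proof. exact: pextU. Qed.

(** [L0_embU] treats monomials; linearity in P is read off a common truncation of the three products
    involved. *)
Lemma L0_emb b P : L0 eps (emb b P) = emb b (weight_op b P).
Proof.
have L0_linear : linear (fun P : M => L0 eps (emb b P)).
  move=> c Q Q'; rewrite /L0 (conformalE L M).
  set X := 2^-1 *: _.
  have [N1 H1] := vprod_emb0 charK eps0 b X 1 Q.
  have [N2 H2] := vprod_emb0 charK eps0 b X 1 Q'.
  have [N3 H3] := vprod_emb0 charK eps0 b X 1 (c *: Q + Q').
  pose N := (N1 + N2 + N3)%N.
  rewrite (H1 N) ?(H2 N) ?(H3 N) /N; try lia.
  rewrite -[RHS]linearP; congr (emb b _); elim/pol_ind: X {H1 H2 H3} => [|x Y Y' IH IH'|m].
  - by rewrite !linear0 ?scaler0 addr0.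
  - rewrite ![pmode _ _ _ _ _ _ _ (_ + _)]linearP /= IH IH' !scalerDr !scalerA addrACA.
    by rewrite (mulrC x).
  - by rewrite !pmodeU; apply: tmode_linear; apply: bmode_linear.
elim/pol_ind: P => [|c P Q IH IH'|m].
- by rewrite (linear_fun0 L0_linear) !linear0.
- by rewrite L0_linear IH IH' [weight_op b (_ + _)]linearP /= [RHS]linearP.
rewrite L0_embU //; [|exact: charK|exact: gram_unit charK ndL].
rewrite weight_opU. rewrite [RHS]linearZ. rewrite formF_dualK.
have -> : (wt m)%:R + ratr (formF L (val b) (val b)) / 2 = ratr ((wt m)%:R + normsq2 b) :> K.
  by rewrite rmorphD /= ratr_nat fmorph_div /= ratr_nat.
by [].
Qed.

Lemma weight_spaceP b e P : weight_space eps e (emb b P) <->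
  forall m, pcoef m P != 0 -> (wt m)%:R + normsq2 b = e.
Proof.
have coefE m : pcoef m (weight_op b P) = ratr ((wt m)%:R + normsq2 b) * pcoef m P.
  apply: (@pcoef_diag _ _ _ (weight_op b) (fun m => ratr ((wt m)%:R + normsq2 b))) => {}m.
  exact: pextU.
rewrite /weight_space /= L0_emb -[RHS]linearZ /=; split=> [/emb_inj E m mP|E].
  have := congr1 (pcoef m) E; rewrite coefE linearZ /= => /(mulIf mP).
  exact: fmorph_inj.
congr (emb b _); apply: polP => m; rewrite -!/(pcoef _ _) coefE linearZ /=.
by have [->|/E <-] := eqVneq (pcoef m P) 0; rewrite /GRing.scale /= ?mulr0.
Qed.

Lemma wproj_homP N P : wproj N P = P <-> forall m, pcoef m P != 0 -> wt m = N.
Proof.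
have coefE m : pcoef m (wproj N P) = (wt m == N)%:R * pcoef m P.
  apply: (@pcoef_diag _ _ _ (wproj N) (fun m => (wt m == N)%:R)) => {}m.
  by rewrite /= wprojU; case: eqP; rewrite ?scale1r ?scale0r.
split=> [E m mP|E].
  have := coefE m; rewrite E; case: eqP => // _; rewrite mul0r => P0.
  by rewrite P0 eqxx in mP.
apply: polP => m; rewrite -!/(pcoef _ _) coefE.
by have [->|/E ->] := eqVneq (pcoef m P) 0; rewrite ?mulr0 // eqxx mul1r.
Qed.

End Weights.

Section Denominator.
Context (n r s : nat) (k : 'rV[int]_n).
Hypothesis rsn : (r + s <= n)%N.
Hypothesis k0 : forall i : 'I_n, (r + s <= i)%N -> k 0 i = 0.

(** In a direction of S, the bound N turns the factor (q)_oo into (q)_N, which agrees with it up to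
    q^N. *)
Definition exponents N (i : 'I_n) : nat :=
  if unconstrained r s i then N else absz (k 0%R i).

Let agree N (f : fps) (F : {poly int}) := forall m, (m <= N)%N -> f m = F`_m.

Lemma agree_mul N f g F G : agree N f F -> agree N g G -> agree N (fps_mul f g) (F * G).
Proof.
move=> fF gG m mN; rewrite /fps_mul coefM; apply: eq_bigr => i _.
have im := ltn_ord i; rewrite fF ?gG //; lia.
Qed.

Lemma agree_one N : agree N fps_one 1.
Proof. by move=> m _; rewrite coef1. Qed.

Lemma prod_unconstrained (F : {poly int}) :
  \prod_(i < n | unconstrained r s i) F = F ^+ s.
Proof.
rewrite -(big_mkord (fun i => (r <= i < r + s)%N) (fun _ => F)).
rewrite (big_cat_nat (n := (r + s)%N)) //= (big_cat_nat (n := r)) ?leq_addr //=.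
rewrite [X in X * _ * _]big1_seq => [|i]; last first.
  by rewrite mem_index_iota => /andP[/andP[? _] /andP[_ ?]]; lia.
rewrite [X in _ * X]big1_seq => [|i]; last first.
  by rewrite mem_index_iota => /andP[/andP[_ ?] /andP[? _]]; lia.
by rewrite mul1r mulr1 -big_nat prodr_const_nat addKn.
Qed.

Lemma agree_denominator N :
  agree N (char_denominator r s k) (qprod (exponents N)).
Proof.
have -> : qprod (exponents N) =
    (\prod_(i < n | (i < r)%N) qpochp (absz (k 0%R i))) * (qpochp N ^+ s).
  rewrite /qprod (bigID (fun i : 'I_n => (i < r)%N)) /=; congr (_ * _).
    by apply: eq_bigr => i ir; rewrite /exponents /unconstrained leqNgt ir.
  rewrite -prod_unconstrained [LHS]big_mkcond [RHS]big_mkcond; apply: eq_bigr => i _.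
  rewrite /exponents; case: ifP => ir; case: ifP => fi //.
    rewrite k0 ?/qpochp ?big_geq //; move: ir fi; rewrite /unconstrained; lia.
  by move: ir fi; rewrite /unconstrained; lia.
apply: agree_mul.
  elim/big_rec2: _ => [|i F f _ fF]; first exact: agree_one.
  by apply: agree_mul.
elim: s => [|s' IH] /=; first by rewrite expr0; exact: agree_one.
rewrite exprS; apply: agree_mul => // m mN.
by rewrite [qpoch_inf m](_ : _ = (qpochp m)`_m) // (qpochp_stable mN).
Qed.

Lemma fps_inv_denominator N : fps_inv (char_denominator r s k) N =
  fps_inv (fun m => (qprod (exponents N))`_m) N.
Proof. by apply: eq_fps_inv => m mN; apply: agree_denominator. Qed.

End Denominator.

Section GradedDimension.
Context (K : numFieldType) (n : nat) (L : based_lattice n) (M : polyalg K n).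
Hypothesis ndL : lattice_nondegenerate L.
Variable eps : dual_lattice L -> dual_lattice L -> K.
Hypothesis eps0 : forall b, eps 0 b = 1.
Local Notation dual := (dual_lattice L).
Local Notation emb := (@emb K n L M).
Variables (r s : nat) (l : dual).
Hypothesis rsn : (r + s <= n)%N.
Implicit Types (b t : dual) (P Q : M) (m : {cmonom mode n}) (k : 'rV[int]_n).
Local Notation charK := (charK K).

Lemma tc_wproj_gt i d N P : (N < d)%N -> wproj N P = P -> tc i d P = 0.
Proof. by move=> Nd <-; rewrite tc_wproj leqNgt Nd. Qed.

Lemma graded_component t e v :
  (Wexpl M r s l `&` charge_space (t + l) `&` weight_space eps e)%classic v <->
  exists P, [/\ v = emb (t + l) P, admissible r s l (t + l) P
    & forall m, pcoef m P != 0 -> (wt m)%:R + normsq2 (t + l) = e].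
Proof.
split=> [[[hv /(charge_spaceP M) vb] hw]|[P [-> hP we]]].
  exists (component M (t + l) v); split=> //.
  by apply: (@weight_spaceP K n L M ndL eps eps0 (t + l) e _).1; rewrite -vb.
split; last exact: (@weight_spaceP K n L M ndL eps eps0 (t + l) e P).2.
split; first exact: Wexpl_emb.
by apply/(charge_spaceP M); rewrite component_emb eqxx.
Qed.

Lemma graded_dim0 t e :
  (forall P, admissible r s l (t + l) P ->
    (forall m, pcoef m P != 0 -> (wt m)%:R + normsq2 (t + l) = e) -> P = 0) ->
  has_dim (Wexpl M r s l `&` charge_space (t + l) `&` weight_space eps e) 0.
Proof.
move=> h0; apply: hasdim0 => v; rewrite graded_component.
split=> [[P [-> hP /(h0 P hP) ->]]|->]; first by rewrite linear0.
by exists 0; split=> [||m]; rewrite ?linear0 ?eqxx //; left.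
Qed.

Lemma graded_dim t k N : val t = map_mx intr k -> charge_ok r s k -> exists d,
  has_dim (Wexpl M r s l `&` charge_space (t + l)
    `&` weight_space eps (normsq2 (t + l) + N%:R)) d /\
  d%:Z = fps_inv (char_denominator r s k) N.
Proof.
move=> tk ok; have [d [hd dE]] := bounded_dim M charK (exponents r s k N) N.
exists d; split; last by rewrite (fps_inv_denominator rsn) //; case: ok.
have hd' := hasdim_inj (@emb_inj K n L M (t + l)) hd.
apply: eq_hasdim hd' => v; rewrite graded_component.
split=> [[P [hP wP] <-]|[P [-> hP we]]].
  exists P; split=> //.
    right; exists k; split=> //; first by rewrite [LHS]raddfD /= tk addrC.
    by move=> i d' fi kd; apply: hP; rewrite /exponents (negbTE fi).
  by move=> m /((wproj_homP N P).1 wP) ->; rewrite addrC.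
have wP : wproj N P = P.
  apply/wproj_homP => m /we /eqP; rewrite addrC (inj_eq (addrI _)) eqr_nat.
  by move=> /eqP.
(* In a direction of S the bound N follows from the weight alone; elsewhere it is the bound attached
   to the charge. *)
exists P => //; split=> // i d'; rewrite /exponents; case: ifP => fi kd.
  exact: tc_wproj_gt wP.
case: hP => [->|[k' [tk' _ hP]]]; first by rewrite linear0.
have tk'' : val (t + l) = val l + map_mx intr k by rewrite [LHS]raddfD /= tk addrC.
by apply: hP; rewrite ?fi // (charge_unique tk' tk'').
Qed.

Lemma qshiftE c f N : qshift c f (c + N%:R) = f N.
Proof.
rewrite /qshift (fsbigE [:: N]) //= => [|m|m].
- by rewrite big_cons big_nil ifT ?addr0 // inE.
- by rewrite /= inE => /eqP ->.
- by move=> /addrI/eqP; rewrite eqr_nat inE => ->.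
Qed.

Lemma qshift0 c f e : (forall N : nat, c + N%:R <> e) -> qshift c f e = 0.
Proof. by move=> ce; rewrite /qshift fsbig1 // => m /= /ce. Qed.

Lemma char_sumE k e : charge_ok r s k ->
  char_sum L r s (val l) (map_mx intr k) e =
  qshift (formF L (map_mx intr k + val l) (map_mx intr k + val l) / 2)
    (fps_inv (char_denominator r s k)) e.
Proof.
move=> ok; rewrite /char_sum (fsbigE [:: k]) //= => [|k'|k'].
- by rewrite big_cons big_nil ifT ?eqxx ?addr0 // inE.
- by rewrite /= inE => /eqP ->.
move=> _; rewrite inE => /eqP kk'; case: eqP => // E; case: kk'; apply: esym.
by apply: (@map_intr_inj n rat) E => q; rewrite pnatr_eq0.
Qed.

Lemma char_sum0 (x : 'rV[rat]_n) e :
  (forall k, charge_ok r s k -> x <> map_mx intr k) -> char_sum L r s (val l) x e = 0.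
Proof. by move=> hx; rewrite /char_sum fsbig1 // => k /= /hx; case: eqP. Qed.

Lemma Wexpl_graded_dim :
  is_graded_dim eps (Wexpl M r s l) l (char_sum L r s (val l)).
Proof.
split=> [t e|x e xd]; last first.
  apply: char_sum0 => k _ xk; move/negP: xd; apply; rewrite xk.
  by have := coordF_dual (\sum_i lbasis L i *~ k 0 i); rewrite /coordF lbasisK.
(* Both sides vanish unless t is one of the charges of the sum and e exceeds <t + l, t + l> / 2 by a
   natural number. *)
have [[k [tk ok]]|nk] := pselect (exists k, val t = map_mx intr k /\ charge_ok r s k).
  have nE : normsq2 (t + l) =
      formF L (map_mx intr k + val l) (map_mx intr k + val l) / 2.
    by rewrite /normsq2 -tk.
  rewrite tk char_sumE // -nE.
  have [[N <-]|ne] := pselect (exists N : nat, normsq2 (t + l) + N%:R = e).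
    have [d [hd dE]] := graded_dim N tk ok; exists d; split=> //.
    by rewrite qshiftE dE.
  exists 0%N; split; last by rewrite qshift0 // => N Ne; apply: ne; exists N.
  apply: graded_dim0 => P _ we; apply: polP => m; rewrite -!/(pcoef _ _) linear0.
  apply: contra_notP ne => /eqP/we <-; exists (wt m); exact: addrC.
exists 0%N; split; last by rewrite char_sum0 // => k ok tk; apply: nk; exists k.
apply: graded_dim0 => P [//|[k [tk ok _]]] _; exfalso; apply: nk; exists k; split=> //.
by apply: (addIr (val l)); rewrite [RHS]addrC -tk [RHS]raddfD.
Qed.

End GradedDimension.

Theorem theorem2p2 (R : realType) (n : nat) (L : based_lattice n)
  (hL : lattice_nondegenerate L)
  (eps : dual_lattice L -> dual_lattice L -> R[i]) (heps : standard_cocycle eps)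
  (r s : nat) (hrs : (r + s <= n)%N) (lambda : dual_lattice L) :
  is_graded_dim eps
    (Wmod eps [set lbasis L i | i in [set i : 'I_n | (i < r)%N]]
              [set lbasis L i | i in [set i : 'I_n | (r <= i < r + s)%N]]
              lambda)
    lambda
    (char_sum L r s (val lambda)).
Proof.
have [eps_neq0 eps0 _ _ _] := heps.
pose M := polyalg_exists R[i] n.
have cK := charK R[i].
rewrite (_ : Wmod _ _ _ _ = Wexpl M r s lambda).
  exact: (Wexpl_graded_dim M hL eps0).
apply/seteqP; split; first exact: (Wmod_sub M cK).
move=> v hv W [subW Wl].
by apply: (Wexpl_subW cK eps_neq0 eps0 subW) hv; apply: Wl.
Qed.
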